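(* Let $k$ be a field and let $\mathcal A$ be a finite set of hyperplanes through the origin in $\mathbb R^d$, with intersection lattice $\mathcal L$ and face semigroup algebra $k\mathcal F$. The Hochschild homology $\operatorname{HH}_i(k\mathcal F)$ and the Hochschild cohomology $\operatorname{HH}^i(k\mathcal F)$ of $k\mathcal F$ vanish in positive degrees $i>0$. In degree zero the homology is $\operatorname{HH}_0(k\mathcal F)\cong k^{\#\mathcal L}$ and the cohomology is $\operatorname{HH}^0(k\mathcal F)\cong k$.
   Context: For each $H\in\mathcal A$ fix a labelling $H^+,H^-$ of the two open half-spaces determined by $H$, and put $H^0=H$. A face of $\mathcal A$ is a nonempty set of the form $x=\bigcap_{H\in\mathcal A}H^{\sigma_H}$ with $\sigma_H\in\{+,-,0\}$; write $\sigma_H(x)=\sigma_H$. $\mathcal F$ is the set of faces. The support of a face is $\operatorname{supp}(x)=\bigcap_{H:\sigma_H(x)=0}H$ (equal to $\mathbb R^d$ if no $\sigma_H(x)$ is $0$). The intersection lattice $\mathcal L=\operatorname{supp}(\mathcal F)$ (equivalently, the set of intersections of subsets of $\mathcal A$) is ordered by inclusion. The product $xy$ of faces is the face with $\sigma_H(xy)=\sigma_H(x)$ if $\sigma_H(x)\ne0$ and $\sigma_H(xy)=\sigma_H(y)$ if $\sigma_H(x)=0$. This makes $\mathcal F$ a semigroup with identity $1=\bigcap_{H\in\mathcal A}H$, and $k\mathcal F$ is its semigroup algebra over $k$. For a $k$-algebra $A$, $\operatorname{HH}_i(A)=\operatorname{HH}_i(A,A)$ and $\operatorname{HH}^i(A)=\operatorname{HH}^i(A,A)$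 are the usual Hochschild homology and cohomology over $k$ of $A$ with coefficients in the bimodule $A$. *)

(* Defs.v *)
From HB Require Import structures.
From mathcomp Require Import all_boot all_order all_algebra.
From mathcomp Require Import finmap generic_quotient ring_quotient.
From mathcomp Require Import boolp classical_sets functions reals.
From mathcomp Require Import monalg zify.

Set Implicit Arguments.
Unset Strict Implicit.
Unset Printing Implicit Defensive.

Import Order.TTheory GRing.Theory Num.Theory.
Local Open Scope ring_scope.

Section Submodule.
Variables (k : fieldType) (V : lmodType k).

Record submodule := Submodule {
  smset :> V -> Prop;
  sm0 : smset 0;
  smP : forall (a : k) x y, smset x -> smset y -> smset (a *: x + y) }.

Definition smpred (W : submodule) : {pred V} := fun x => `[< W x >].

Variable W : submodule.

Fact smpred_closed : zmod_closed (smpred W).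
Proof.
split=> [|x y /asboolP Wx /asboolP Wy]; apply/asboolP; first exact: sm0.
by rewrite addrC -scaleN1r; apply: smP.
Qed.
HB.instance Definition _ := GRing.isZmodClosed.Build V (smpred W) smpred_closed.

Definition quotmod := Quotient.quot (smpred W).
HB.instance Definition _ := GRing.Zmodule.on quotmod.

Definition quotpi (x : V) : quotmod := \pi_(quotmod)%qT x.

Lemma quotpi_eq x y : quotpi x = quotpi y <-> W (x - y).
Proof.
split=> [e|Wxy]; last by apply/eqP; rewrite -Quotient.idealrBE; apply/asboolP.
by have /eqP := e; rewrite -Quotient.idealrBE => /asboolP.
Qed.

Lemma quotpiK (q : quotmod) : quotpi (repr q) = q. Proof. exact: reprK. Qed.

Lemma quotpiB : {morph quotpi : x y / x - y}.
Proof. exact: pi_is_zmod_morphism. Qed.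

Lemma quotpiD : {morph quotpi : x y / x + y}.
Proof.
move=> x y; have e0 : quotpi 0 = 0 by rewrite -[0 in LHS](subrr 0) quotpiB subrr.
by rewrite -[y in LHS]opprK quotpiB -[- y]sub0r quotpiB e0 sub0r opprK.
Qed.

Definition quot_scale (a : k) (q : quotmod) : quotmod := quotpi (a *: repr q).

Lemma quot_scaleE a x : quot_scale a (quotpi x) = quotpi (a *: x).
Proof.
apply/quotpi_eq; rewrite -scalerBr -[_ *: _]addr0; apply: smP; last exact: sm0.
by apply/quotpi_eq; rewrite quotpiK.
Qed.

Fact quot_scaleA a b q : quot_scale a (quot_scale b q) = quot_scale (a * b) q.
Proof. by rewrite -[q]quotpiK !quot_scaleE scalerA. Qed.
Fact quot_scale1 : left_id 1 quot_scale.
Proof. by move=> q; rewrite -[q]quotpiK quot_scaleE scale1r. Qed.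
Fact quot_scaleDr : right_distributive quot_scale +%R.
Proof.
move=> a p q; rewrite -[p]quotpiK -[q]quotpiK -quotpiD !quot_scaleE.
by rewrite scalerDr quotpiD.
Qed.
Fact quot_scaleDl q : {morph quot_scale^~ q : a b / a + b}.
Proof. by move=> a b; rewrite -[q]quotpiK !quot_scaleE scalerDl quotpiD. Qed.
HB.instance Definition _ := GRing.Zmodule_isLmodule.Build k quotmod
  quot_scaleA quot_scale1 quot_scaleDr quot_scaleDl.

Fact quotpi_linear : linear quotpi.
Proof. by move=> a x y; rewrite quotpiD -quot_scaleE. Qed.
HB.instance Definition _ :=
  GRing.isLinear.Build k V quotmod _ quotpi quotpi_linear.

Section Lift.
Variables (U : lmodType k) (f : {linear V -> U}).
Hypothesis f0 : forall x, W x -> f x = 0.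

Definition quotlift (q : quotmod) : U := f (repr q).

Lemma quotlift_pi x : quotlift (quotpi x) = f x.
Proof.
apply/eqP; rewrite -subr_eq0 -linearB; apply/eqP/f0.
by apply/quotpi_eq; rewrite quotpiK.
Qed.

Lemma quotlift_linear : linear quotlift.
Proof.
move=> a p q; rewrite -[p]quotpiK -[q]quotpiK -linearP !quotlift_pi.
exact: linearP.
Qed.

End Lift.
End Submodule.

Section Homology.
Variables (k : fieldType) (U V W : lmodType k).
Variables (f : {linear U -> V}) (g : {linear V -> W}).

Definition kerpred : {pred V} := fun x => g x == 0.

Fact kerpred_closed : submod_closed kerpred.
Proof.
split=> [|a x y]; rewrite !unfold_in ?linear0 // => /eqP gx /eqP gy.
by rewrite linearP gx gy scaler0 addr0.
Qed.
HB.instance Definition _ := GRing.isSubmodClosed.Build k V kerpred kerpred_closed.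

Record kermod := KerMod { kerval :> V; _ : kerpred kerval }.
HB.instance Definition _ := [isSub for kerval].
HB.instance Definition _ := [Choice of kermod by <:].
HB.instance Definition _ := [SubChoice_isSubLmodule of kermod by <:].

Fact im_closed0 : exists u, f u = val (0 : kermod).
Proof. by exists 0; rewrite linear0. Qed.
Fact im_closedP (a : k) (x y : kermod) :
  (exists u, f u = val x) -> (exists u, f u = val y) ->
  exists u, f u = val (a *: x + y).
Proof. by move=> [u fu] [v fv]; exists (a *: u + v); rewrite linearP fu fv. Qed.

(* The submodule [ker g :&: im f] of [ker g]; it is [im f] if [g \o f = 0]. *)
Definition imker : submodule kermod := Submodule im_closed0 im_closedP.

Definition homology : lmodType k := quotmod imker.

End Homology.

Section Multilinear.
Variables (k : fieldType) (A : lmodType k) (n : nat).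
Local Notation An := {ffun 'I_n -> A}.

Definition upd (a : An) (j : 'I_n) (x : A) : An :=
  [ffun i => if i == j then x else a i].

Definition multilinear (V : lmodType k) (f : An -> V) : Prop :=
  forall a j (c : k) x y,
    f (upd a j (c *: x + y)) = c *: f (upd a j x) + f (upd a j y).

Definition multilinear_pred (V : lmodType k) : {pred An -> V} :=
  fun f => `[< multilinear f >].

Fact multilinear_closed (V : lmodType k) : submod_closed (@multilinear_pred V).
Proof.
split=> [|c f g /asboolP fP /asboolP gP]; apply/asboolP => a j b x y.
  by change (0 = b *: 0 + 0 :> V); rewrite scaler0 addr0.
pose h u := c *: f u + g u.
change (h (upd a j (b *: x + y)) = b *: h (upd a j x) + h (upd a j y)).
by rewrite /h fP gP !scalerDr !scalerA [b * c]mulrC addrACA.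
Qed.
HB.instance Definition _ (V : lmodType k) := GRing.isSubmodClosed.Build k (An -> V)
  (@multilinear_pred V) (@multilinear_closed V).

Record mlin (V : lmodType k) :=
  MLin { mlin_fun :> An -> V; _ : multilinear_pred mlin_fun }.
HB.instance Definition _ (V : lmodType k) := [isSub for @mlin_fun V].
HB.instance Definition _ (V : lmodType k) := [Choice of mlin V by <:].
HB.instance Definition _ (V : lmodType k) := [SubChoice_isSubLmodule of mlin V by <:].

Definition mkmlin (V : lmodType k) (f : An -> V) (fP : multilinear f) : mlin V :=
  MLin (asboolT fP).

Lemma mlinP (V : lmodType k) (f : mlin V) : multilinear f.
Proof. exact/asboolP/(valP f). Qed.

(* The tensor power of [A] is the free module on [A ^ n] modulo the
   multilinearity relations. *)
Local Notation free := {malg k[An]}.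

Definition tensor_rel (r : free) : Prop :=
  exists a j c x y, r = << upd a j (c *: x + y) >>
                        - c *: << upd a j x >> - << upd a j y >>.

Definition tensor_span (r : free) : Prop :=
  forall W : submodule free, (forall s, tensor_rel s -> W s) -> W r.

Fact tensor_span0 : tensor_span 0.
Proof. by move=> W _; apply: sm0. Qed.
Fact tensor_spanP c x y :
  tensor_span x -> tensor_span y -> tensor_span (c *: x + y).
Proof. by move=> hx hy W hW; apply: smP; [apply: hx|apply: hy]. Qed.

Definition tensor_relations : submodule free :=
  Submodule tensor_span0 tensor_spanP.

Definition tpow : lmodType k := quotmod tensor_relations.

Definition tens (a : An) : tpow := quotpi tensor_relations << a >>.

Lemma tens_multilinear : multilinear tens.
Proof.
move=> a j c x y; rewrite /tens -linearP; apply/quotpi_eq => W; apply.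
by exists a, j, c, x, y; rewrite opprD addrA.
Qed.

(* The universal property: [tlift f] is the linear map with
   [tlift f (tens a) = f a]. *)
Section TensorLift.
Variables (V : lmodType k) (f : mlin V).

Definition freelift (g : free) : V := \sum_(a <- msupp g) g@_a *: f a.

Lemma freeliftE (D : {fset An}) g : (msupp g `<=` D)%fset ->
  freelift g = \sum_(a <- D) g@_a *: f a.
Proof.
move=> sD; rewrite /freelift (big_fset_incl _ sD) //= => a _.
by rewrite -mcoeff_eq0 => /eqP ->; rewrite scale0r.
Qed.

Fact freelift_linear : linear freelift.
Proof.
move=> c g h; pose D := (msupp g `|` msupp h `|` msupp (c *: g + h)%R)%fset.
have sg : (msupp g `<=` D)%fset by rewrite /D -fsetUA fsubsetUl.
have sh : (msupp h `<=` D)%fset by rewrite /D fsetUAC fsubsetUr.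
have sgh : (msupp (c *: g + h)%R `<=` D)%fset by rewrite /D fsubsetUr.
rewrite (freeliftE sg) (freeliftE sh) (freeliftE sgh).
rewrite scaler_sumr -big_split /=; apply: eq_bigr => a _.
by rewrite mcoeffD mcoeffZ scalerDl scalerA.
Qed.
HB.instance Definition _ :=
  GRing.isLinear.Build k free V _ freelift freelift_linear.

Lemma freeliftU a : freelift << a >> = f a.
Proof.
rewrite (@freeliftE [fset a]%fset) ?msuppU_le // big_seq_fset1.
by rewrite mcoeffUU scale1r.
Qed.

Fact freelift_ker : forall r, tensor_relations r -> freelift r = 0.
Proof.
have k0 : (fun r => freelift r = 0) 0 by rewrite linear0.
have kP : forall c x y, freelift x = 0 -> freelift y = 0 ->
    freelift (c *: x + y) = 0.
  by move=> c x y hx hy; rewrite freelift_linear hx hy scaler0 addr0.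
move=> r /(_ (Submodule k0 kP)); apply=> s [a [j [c [x [y ->]]]]] /=.
by rewrite !linearB linearZ /= !freeliftU mlinP -addrA -opprD subrr.
Qed.

Definition tlift : tpow -> V := quotlift freelift.

Fact tlift_linear : linear tlift.
Proof. exact: quotlift_linear freelift_ker. Qed.
HB.instance Definition _ := GRing.isLinear.Build k tpow V _ tlift tlift_linear.

Lemma tlift_tens a : tlift (tens a) = f a.
Proof. exact: etrans (quotlift_pi freelift_ker _) (freeliftU a). Qed.

End TensorLift.
End Multilinear.

(* As [k] is a field, HH is computed by the standard (bar) complexes. *)
Section Hochschild.
Variables (k : fieldType) (A : algType k).

(* [(a_0, ..., a_n)] becomes
   [(a_0, ..., a_i a_(i+1), ..., a_n)]. *)
Definition mulface n (i : 'I_n) (a : {ffun 'I_n.+1 -> A}) : {ffun 'I_n -> A} :=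
  [ffun j : 'I_n => if (j < i)%N then a (widen_ord (leqnSn n) j)
                    else if j == i then a (widen_ord (leqnSn n) i) * a (lift ord0 i)
                    else a (lift ord0 j)].

(* [(a_0, ..., a_(n+1))] becomes [(a_(n+1) a_0, a_1, ..., a_n)]. *)
Definition cycface n (a : {ffun 'I_n.+2 -> A}) : {ffun 'I_n.+1 -> A} :=
  [ffun j : 'I_n.+1 => if j == ord0 then a ord_max * a ord0
                       else a (widen_ord (leqnSn n.+1) j)].

Definition behead_ffun n (a : {ffun 'I_n.+1 -> A}) : {ffun 'I_n -> A} :=
  [ffun j => a (lift ord0 j)].

Definition belast_ffun n (a : {ffun 'I_n.+1 -> A}) : {ffun 'I_n -> A} :=
  [ffun j => a (widen_ord (leqnSn n) j)].

Definition slotwise m n (phi : {ffun 'I_m -> A} -> {ffun 'I_n -> A}) : Prop :=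
  forall a j, exists j' (L : A -> A), linear L /\
    forall x, phi (upd a j x) = upd (phi a) j' (L x).

Lemma multilinear_slotwise m n (V : lmodType k) (phi : {ffun 'I_m -> A} -> {ffun 'I_n -> A})
    (f : {ffun 'I_n -> A} -> V) :
  slotwise phi -> multilinear f -> multilinear (f \o phi).
Proof.
move=> hphi hf a j c x y; have [j' [L [linL eL]]] := hphi a j.
by rewrite /= !eL linL hf.
Qed.

Lemma mulface_slotwise n (i : 'I_n) : slotwise (@mulface n i).
Proof.
move=> a j; have [lt_jn lt_in] := (ltn_ord j, ltn_ord i).
pose L (x : A) : A := if j == widen_ord (leqnSn n) i then x * a (lift ord0 i)
            else if j == lift ord0 i then a (widen_ord (leqnSn n) i) * x else x.
have jn : ((if (j <= i)%N then j : nat else j.-1) < n)%N by case: (leqP j i) => ?; lia.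
exists (Ordinal jn), L; split.
  move=> c x y; rewrite /L; case: ifP => _; last case: ifP => _ //.
    by rewrite mulrDl scalerAl.
  by rewrite mulrDr scalerAr.
move=> x; apply/ffunP => l; rewrite !ffunE /L -!(inj_eq val_inj) /= /bump /= !add1n.
do ![case: ifP]; try lia; move=> *; by [].
Qed.

Lemma cycface_slotwise n : slotwise (@cycface n).
Proof.
move=> a j; have lt_jn := ltn_ord j.
pose L (x : A) : A := if j == ord_max then x * a ord0
            else if j == ord0 then a ord_max * x else x.
have jn : ((if j == n.+1 :> nat then 0 else j) < n.+1)%N by case: ifP => ?; lia.
exists (Ordinal jn), L; split.
  move=> c x y; rewrite /L; case: ifP => _; last case: ifP => _ //.
    by rewrite mulrDl scalerAl.
  by rewrite mulrDr scalerAr.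
move=> x; apply/ffunP => l; have lt_ln := ltn_ord l.
rewrite !ffunE /L -!(inj_eq val_inj) /=.
do ![case: ifP]; try lia; move=> *; by [].
Qed.

Lemma multilinearD n (V : lmodType k) (f g : {ffun 'I_n -> A} -> V) :
  multilinear f -> multilinear g -> multilinear (fun a => f a + g a).
Proof. by move=> fP gP a j c x y; rewrite fP gP scalerDr addrACA. Qed.

Lemma multilinearZ n (V : lmodType k) (c : k) (f : {ffun 'I_n -> A} -> V) :
  multilinear f -> multilinear (fun a => c *: f a).
Proof.
by move=> fP a j b x y; rewrite fP scalerDr !scalerA [b * c]mulrC.
Qed.

Lemma multilinear_sum n (V : lmodType k) m (f : 'I_m -> {ffun 'I_n -> A} -> V) :
  (forall i, multilinear (f i)) -> multilinear (fun a => \sum_(i < m) f i a).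
Proof.
move=> fP a j c x y; rewrite scaler_sumr -big_split /=.
by apply: eq_bigr => i _; apply: fP.
Qed.

(* [A ⊗ A^(⊗ n)], the coefficient bimodule [A] being the factor of index 0. *)

Definition chains n : lmodType k := tpow A n.+1.

Definition boundary_fun n (a : {ffun 'I_n.+2 -> A}) : chains n :=
  \sum_(i < n.+1) (-1) ^+ i *: tens (mulface i a)
  + (-1) ^+ n.+1 *: tens (cycface a).

Fact boundary_multilinear n : multilinear (@boundary_fun n).
Proof.
apply: multilinearD; first apply: multilinear_sum => i.
  exact: multilinearZ (multilinear_slotwise (mulface_slotwise i)
                         (@tens_multilinear _ _ _)).
exact: multilinearZ (multilinear_slotwise (@cycface_slotwise n)
                       (@tens_multilinear _ _ _)).
Qed.

Definition boundary n : {linear chains n.+1 -> chains n} :=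
  tlift (mkmlin (@boundary_multilinear n)).

(* The outgoing map of [chains n], with zero in degree -1. *)
Definition boundary_from n : {linear chains n -> chains n.-1} :=
  match n with
  | 0 => \0
  | m.+1 => boundary m
  end.

Definition hochschild_homology n : lmodType k :=
  homology (boundary n) (boundary_from n).

Definition cochains n : lmodType k := mlin A n A.

Definition coboundary_fun n (f : cochains n) (a : {ffun 'I_n.+1 -> A}) : A :=
  a ord0 * mlin_fun f (behead_ffun a)
  + \sum_(i < n) (-1) ^+ i.+1 *: mlin_fun f (mulface i a)
  + (-1) ^+ n.+1 *: (mlin_fun f (belast_ffun a) * a ord_max).

Fact coboundary_multilinear n (f : cochains n) : multilinear (coboundary_fun f).
Proof.
have fP := mlinP f; apply: multilinearD; first apply: multilinearD.
- move=> a j c x y; case: (unliftP ord0 j) => [i ->|->].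
    have bE z : behead_ffun (upd a (lift ord0 i) z) = upd (behead_ffun a) i z.
      by apply/ffunP => l; rewrite !ffunE (inj_eq lift_inj).
    by rewrite !bE fP !ffunE /= mulrDr scalerAr.
  have bE z : behead_ffun (upd a ord0 z) = behead_ffun a.
    by apply/ffunP => l; rewrite !ffunE.
  by rewrite !bE !ffunE eqxx mulrDl scalerAl.
- apply: multilinear_sum => i.
  exact: multilinearZ (multilinear_slotwise (mulface_slotwise i) fP).
apply: multilinearZ => a j c x y; have [ej|nj] := eqVneq j ord_max.
  have bE z : belast_ffun (upd a j z) = belast_ffun a.
    apply/ffunP => l; rewrite !ffunE ej -(inj_eq val_inj) /=.
    by rewrite ltn_eqF.
  by rewrite !bE !ffunE ej eqxx mulrDr scalerAr.
have jn : (j < n)%N.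
  by rewrite ltn_neqAle -ltnS ltn_ord andbT -(inj_eq val_inj) in nj *.
have bE z : belast_ffun (upd a j z) = upd (belast_ffun a) (Ordinal jn) z.
  by apply/ffunP => l; rewrite !ffunE -!(inj_eq val_inj).
by rewrite !bE fP !ffunE eq_sym (negPf nj) mulrDl scalerAl.
Qed.

Definition coboundary n (f : cochains n) : cochains n.+1 :=
  mkmlin (coboundary_multilinear f).

Fact coboundary_linear n : linear (@coboundary n).
Proof.
move=> c f g; apply: val_inj; apply/funext => a.
change (coboundary_fun (c *: f + g) a
  = c *: coboundary_fun f a + coboundary_fun g a).
have E b : mlin_fun (c *: f + g) b = c *: mlin_fun f b + mlin_fun g b by [].
rewrite /coboundary_fun !E !scalerDr !mulrDr !mulrDl.
rewrite scaler_sumr.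
rewrite (eq_bigr (fun i : 'I_n => c *: ((-1) ^+ i.+1 *: mlin_fun f (mulface i a))
   + (-1) ^+ i.+1 *: mlin_fun g (mulface i a))); last first.
  by move=> i _; rewrite E scalerDr !scalerA mulrC.
rewrite big_split /= scalerDr -!scalerAl -!scalerAr !scalerA [_ * c]mulrC.
by rewrite [RHS]addrACA [X in _ = X + _]addrACA.
Qed.
HB.instance Definition _ n := GRing.isLinear.Build k (cochains n) (cochains n.+1)
  _ (@coboundary n) (@coboundary_linear n).

(* The incoming map of [cochains n], with zero in degree -1. *)
Definition coboundary_to n : {linear cochains n.-1 -> cochains n} :=
  match n with
  | 0 => \0
  | m.+1 => @coboundary m
  end.

Definition hochschild_cohomology n : lmodType k :=
  homology (coboundary_to n) (@coboundary n).

End Hochschild.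

(* The labelling of the two open half-spaces of [H] is given by a linear form
   with kernel [H]; every labelling is of this kind. *)
Record arrangement (R : realType) (d : nat) := Arrangement {
  hyperplanes :> {fset {vspace 'rV[R]_d}};
  hform : hyperplanes -> 'Hom('rV[R]_d, R^o);
  dim_hyperplane : forall H : hyperplanes, (\dim (val H)).+1 = d;
  lker_hform : forall H : hyperplanes, lker (hform H) = val H }.

Section Faces.
Variables (R : realType) (d : nat) (A : arrangement R d).
Local Open Scope classical_set_scope.

(* [Some true], [Some false] and [None] stand for the signs +, - and 0. *)
Definition sign := option bool.

Definition halfspace (H : A) (s : sign) : set 'rV[R]_d :=
  match s with
  | Some true => [set v | 0 < hform H v]
  | Some false => [set v | hform H v < 0]
  | None => [set v | v \in val H]
  end.

Definition face_set (s : {ffun A -> sign}) : set 'rV[R]_d :=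
  \bigcap_(H in [set: A]) halfspace H (s H).

(* A face is represented by its sign vector, which it determines: see
   [face_set_inj] below. *)
Record face := Face { fsign :> {ffun A -> sign}; _ : `[< face_set fsign !=set0 >] }.
HB.instance Definition _ := [isSub for fsign].

(* Opaque on purpose: with the instances transferred along [fsign], unification
   in [{malg k[face A]}] diverges. *)
HB.instance Definition _ := gen_eqMixin face.
HB.instance Definition _ := gen_choiceMixin face.

Fact face_pickleK : pcancel (fun x : face => choice.pickle (val x))
  (fun n => obind (fun s => insub s : option face) (choice.unpickle n)).
Proof. by move=> x; rewrite choice.pickleK /= valK. Qed.
HB.instance Definition _ := Choice_isCountable.Build face face_pickleK.

Fact face_enumP : Finite.axiom (pmap insub (enum {ffun A -> sign}) : seq face).
Proof.
move=> x; rewrite count_uniq_mem; last first.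
  by apply: (pmap_uniq (@insubK _ _ _)); rewrite enum_uniq.
rewrite mem_pmap; apply/eqP; rewrite eqb1; apply/mapP.
by exists (val x); rewrite ?mem_enum // valK.
Qed.
HB.instance Definition _ := isFinite.Build face face_enumP.

Definition sign_of (x : R) : sign := if x == 0 then None else Some (0 < x).

Lemma halfspaceP H s v : halfspace H s v <-> s = sign_of (hform H v).
Proof.
rewrite /sign_of; case: s => [[]|] /=.
- split=> [fv|]; first by rewrite gt_eqF // fv.
  by case: eqP => // _ [<-].
- split=> [fv|]; first by rewrite lt_eqF // le_gtF // ltW.
  by case: ltgtP => // fv [].
- rewrite -lker_hform memv_ker; split=> [->//|].
  by case: ifP.
Qed.

Lemma face_setP s v : face_set s v <-> forall H, s H = sign_of (hform H v).
Proof.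
by split=> [sv H|sv H _]; apply/halfspaceP => //; apply: sv.
Qed.

Lemma faceP (x : face) : face_set x !=set0.
Proof. exact/asboolP/(valP x). Qed.

Lemma face_set_inj : injective (fun x : face => face_set x).
Proof.
move=> x y exy; have [v xv] := faceP x.
have yv : face_set y v by rewrite -exy.
apply/val_inj/ffunP => H.
by rewrite (face_setP x v).1 // (face_setP y v).1.
Qed.

Definition mul_sign (s t : {ffun A -> sign}) : {ffun A -> sign} :=
  [ffun H => if s H is None then t H else s H].

Fact mul_sign_face (x y : face) : face_set (mul_sign x y) !=set0.
Proof.
have [[v /face_setP xv] [w /face_setP yw]] := (faceP x, faceP y).
pose M := 1 + \sum_(H : A) `|hform H w| / `|hform H v|.
have ltM (H : A) : hform H v != 0 -> `|hform H w| < M * `|hform H v|.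
  move=> v0; rewrite -ltr_pdivrMr ?normr_gt0 // /M (bigD1 H) //=.
  rewrite addrCA -[ltLHS]addr0 ltrD2l ltr_pwDl //.
  by apply: sumr_ge0 => i _; rewrite divr_ge0.
have M0 : 0 < M.
  by rewrite ltr_pwDl //; apply: sumr_ge0 => i _; rewrite divr_ge0.
exists (M *: v + w); apply/face_setP => H.
rewrite ffunE xv yw /sign_of linearP /=.
have [->|v0] := eqVneq (hform H v) 0; first by rewrite scaler0 add0r.
have := ltM H v0; rewrite /GRing.scale /=.
case: (ltgtP 0 (hform H v)) v0 => // fv _.
- rewrite (gtr0_norm fv) ltr_norml => /andP[lt1 _].
  by rewrite -ltrBlDl sub0r in lt1 * => //; rewrite gt_eqF ?lt1 // -ltrBlDl sub0r.
- rewrite (ltr0_norm fv) ltr_norml mulrN => /andP[_ lt1].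
  have lt2 : M * hform H v + hform H w < 0 by rewrite -ltrBrDl sub0r.
  by rewrite lt_eqF // le_gtF // ltW.
Qed.

Definition face_mul (x y : face) : face := Face (asboolT (mul_sign_face x y)).

Fact face_one_subproof : face_set [ffun=> None] !=set0.
Proof. by exists 0 => H _ /=; rewrite ffunE /= mem0v. Qed.

Definition face_one : face := Face (asboolT face_one_subproof).

Fact face_mulA : associative face_mul.
Proof.
by move=> x y z; apply/val_inj/ffunP => H; rewrite !ffunE; case: (x H).
Qed.
Fact face_mul1 : left_id face_one face_mul.
Proof. by move=> x; apply/val_inj/ffunP => H; rewrite !ffunE. Qed.
Fact face_mulr1 : right_id face_one face_mul.
Proof. by move=> x; apply/val_inj/ffunP => H; rewrite !ffunE; case: (x H). Qed.
Fact face_unit x y : face_mul x y = face_one -> x = face_one /\ y = face_one.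
Proof.
move=> /(congr1 val)/ffunP /= exy.
by split; apply/val_inj/ffunP => H; have := exy H; rewrite !ffunE;
  case: (x H).
Qed.
HB.instance Definition _ := Choice_isMonomialDef.Build face
  face_mulA face_mul1 face_mulr1 face_unit.

Definition supp (x : face) : {vspace 'rV[R]_d} :=
  (\bigcap_(H : A | x H == None) val H)%VS.

Definition intersection_lattice : {fset {vspace 'rV[R]_d}} :=
  [fset supp x | x : face]%fset.

End Faces.

Fact malg_scaleAr (k : fieldType) (M : monomType) (c : k) (x y : {malg k[M]}) :
  c *: (x * y) = x * (c *: y).
Proof.
apply/malgP => m; rewrite mcoeffZ mcoeffMl.
rewrite (@mcoeffMlw _ _ (msupp x) (msupp y)) ?fsubset_refl ?msuppZ_le //.
rewrite mulr_sumr; apply: eq_bigr => i _; rewrite mulr_sumr; apply: eq_bigr => j _.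
by rewrite mcoeffZ mulrnAr mulrCA.
Qed.

(* [{malg k[M]}] is declared to be an [algType] only for commutative [M], hence
   the alias. *)
Section FaceAlgebra.
Variables (k : fieldType) (R : realType) (d : nat) (A : arrangement R d).

Definition face_algebra := {malg k[face A]}.
HB.instance Definition _ := GRing.Lalgebra.on face_algebra.
HB.instance Definition _ :=
  GRing.Lalgebra_isAlgebra.Build k face_algebra (@malg_scaleAr k (face A)).

End FaceAlgebra.

(* Main.v *)
Require Import Defs.
From HB Require Import structures.
From mathcomp Require Import all_boot all_order all_algebra.
From mathcomp Require Import finmap reals.
From mathcomp Require Import boolp monalg zify.
From mathcomp Require classical_sets.

(** The semigroup of faces is treated as a set of sign vectors that satisfies the
    covector axioms of an oriented matroid ([realizable_covectors]). As the faces
    are a basis of the algebra, Hochschild cochains are functions on words of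
    faces.

    Cohomology in positive degrees. The algebra is filtered by two-sided ideals
    such that each successive quotient is spanned by a layer, the set of the
    faces with one support [X]. The faces outside [X] annihilate the layer and
    form an ideal with a right unit, which can be excised ([right_unit],
    [excision]); this leaves the faces contained in [X]. They act on the layer,
    that is on the chambers of [X], trivially from the right, so that the
    cohomology is [Ext^n(k, C)] for the left module [C] of chambers. It vanishes
    in all degrees as soon as there is a hyperplane ([chamber_exact]). Indeed,
    removing a hyperplane makes [C] an extension of the chambers of the deletion
    by the chambers of the restriction ([wall_exact]), and this reduces the claim
    to one hyperplane. In this case [C] consists of the functions on the
    difference of two right ideals which are contractible, like the cones that
    define them ([contractible_cone], [contractible_flat]). The functions on the
    complement of such an ideal have no cohomology: for a principal ideal they
    are a summand of a coinduced module ([exact_principal]), and the general case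
    follows by Mayer-Vietoris arguments ([contractible_exact]). The remaining
    layer is that of the face 1; it is a projective module of dimension one, with
    cohomology in degree zero only ([layerT_alg_exact]).

    Homology in positive degrees. By finite duality it vanishes if the cohomology
    with values in the dual of the algebra does ([exact_transpose]). The dual has
    a filtration by the duals of the layers, and after excision the complex of
    such a layer is contracted by evaluation at one face ([layer_dual_exact]).

    Degree zero. The quotient of the algebra by its commutators has the supports
    as a basis ([homology_degree0]). The centre is spanned by 1: exactness in
    degree zero for the ideal of the faces other than 1 says that this ideal
    contains no central element but zero ([cohomology_degree0]). *)

Import GRing.Theory.
Local Open Scope ring_scope.
Set Implicit Arguments.
Unset Strict Implicit.
Unset Printing Implicit Defensive.

(** * Cochains on words *)

Section Cochains.
Variables (k : fieldType) (T : finType) (mul : T -> T -> T).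

(** The module proper is the submodule [dom] of [car]. The bimodules below all
    consist of functions on one finite type and differ in their supports, so
    that inclusions and restrictions between them are maps of one space. *)
Record bimodule := Bimodule {
  car :> lmodType k;
  dom : submodule car;
  lact : T -> {linear car -> car};
  ract : T -> {linear car -> car} }.

Record bimodule_over (S : {set T}) (M : bimodule) : Prop := BimoduleOver {
  lact_dom : forall b v, b \in S -> dom M v -> dom M (lact M b v);
  ract_dom : forall b v, b \in S -> dom M v -> dom M (ract M b v);
  lactM : forall b c v, b \in S -> c \in S -> dom M v ->
    lact M b (lact M c v) = lact M (mul b c) v;
  ractM : forall b c v, b \in S -> c \in S -> dom M v ->
    ract M b (ract M c v) = ract M (mul c b) v;
  lractC : forall b c v, b \in S -> c \in S -> dom M v ->
    lact M b (ract M c v) = ract M c (lact M b v) }.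

Lemma bimodule_overS (S B : {set T}) M : S \subset B ->
  bimodule_over B M -> bimodule_over S M.
Proof.
by move=> /subsetP SB [ld rd lM rM lr]; split=> *; [apply: ld|apply: rd|apply: lM|apply: rM|apply: lr];
  auto.
Qed.

Section Differential.
Variable M : bimodule.
Implicit Types (f g : seq T -> M) (b c : T) (s t : seq T).

(** Cochains of all degrees together are functions of words. A word is read
    from right to left: its first letter is the last argument. Up to a sign in
    each degree, the Hochschild differential is then given by a recursion on
    words: the first letter either acts on the right or is multiplied into the
    next one, which starts an alternating sum that ends with the left action of
    the last letter. *)
Fixpoint absorb f b s : M :=
  if s is c :: t then f (mul c b :: t) - absorb (fun t => f (b :: t)) c t
  else lact M b (f [::]).

Definition codiff f s : M :=
  if s is b :: t then ract M b (f t) - absorb f b t else 0.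

Definition words (S : {set T}) : pred (seq T) := all (mem S).

Definition mul_closed (S : {set T}) := forall b c, b \in S -> c \in S -> mul b c \in S.

Definition right_ideal (S U : {set T}) := U \subset S /\
  forall x b, x \in U -> b \in S -> mul x b \in U.

Definition cochain (S : {set T}) f := forall s, words S s -> dom M (f s).

Lemma dom_lin a v w : dom M v -> dom M w -> dom M (a *: v + w).
Proof. exact: smP. Qed.
Lemma domD v w : dom M v -> dom M w -> dom M (v + w).
Proof. by move=> hv hw; rewrite -[v]scale1r; apply: smP. Qed.
Lemma domZ a v : dom M v -> dom M (a *: v).
Proof. by move=> hv; rewrite -[_ *: _]addr0; apply: smP => //; apply: sm0. Qed.
Lemma domN v : dom M v -> dom M (- v).
Proof. by move=> hv; rewrite -scaleN1r; apply: domZ. Qed.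
Lemma domB v w : dom M v -> dom M w -> dom M (v - w).
Proof. by move=> hv hw; apply: domD => //; apply: domN. Qed.
Lemma dom_sum (I : Type) (r : seq I) (P : pred I) (F : I -> M) :
  (forall i, P i -> dom M (F i)) -> dom M (\sum_(i <- r | P i) F i).
Proof. by move=> h; elim/big_ind: _ => //; [apply: sm0|apply: domD]. Qed.

Lemma absorbP a f g b s :
  absorb (fun t => a *: f t + g t) b s = a *: absorb f b s + absorb g b s.
Proof.
elim: s f g b => [|c s IH] f g b /=; first by rewrite linearP.
by rewrite IH scalerBr addrACA -opprD.
Qed.

Lemma codiffP a f g s :
  codiff (fun t => a *: f t + g t) s = a *: codiff f s + codiff g s.
Proof.
case: s => [|b s] /=; first by rewrite scaler0 addr0.
by rewrite linearP absorbP scalerBr addrACA -opprD.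
Qed.

Lemma absorb_scale (c : nat -> k) f b s :
  absorb (fun t => c (size t) *: f t) b s = c (size s) *: absorb f b s.
Proof.
elim: s c f b => [|d s IH] c f b /=; first by rewrite linearZ.
by rewrite (IH (fun n => c n.+1) (fun t => f (b :: t))) scalerBr.
Qed.

Lemma codiff_scale (c : nat -> k) f b s :
  codiff (fun t => c (size t) *: f t) (b :: s) = c (size s) *: codiff f (b :: s).
Proof. by rewrite /= linearZ absorb_scale scalerBr. Qed.

Lemma absorb_linear (L : {linear M -> M}) f b s (S : {set T}) :
  (forall c v, c \in S -> dom M v -> L (lact M c v) = lact M c (L v)) ->
  cochain S f -> b \in S -> words S s ->
  absorb (fun t => L (f t)) b s = L (absorb f b s).
Proof.
move=> LC; elim: s f b => [|c s IH] f b fW bS /=; first by rewrite LC //; apply: fW.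
move=> /andP[cS sS]; rewrite linearB IH //.
by move=> t tS; apply: fW; rewrite /= bS.
Qed.

Variable S : {set T}.
Hypothesis mulA : associative mul.
Hypothesis SM : mul_closed S.
Hypothesis MP : bimodule_over S M.

Lemma eq_in_absorb f g b s : b \in S -> words S s ->
  (forall t, words S t -> size t = size s -> f t = g t) ->
  absorb f b s = absorb g b s.
Proof.
elim: s f g b => [|c s IH] f g b bS /= => [_ e|/andP[cS sS] e]; first by rewrite e.
rewrite e //=; last by rewrite SM.
congr (_ - _); apply: IH => // t tS ts; rewrite e //= ?bS //.
by rewrite ts.
Qed.

Lemma eq_in_codiff f g s : words S s ->
  (forall t, words S t -> (size t).+1 = size s -> f t = g t) ->
  codiff f s = codiff g s.
Proof.
case: s => //= b s /andP[bS sS] e; rewrite e //.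
by rewrite (@eq_in_absorb f g) // => t tS ts; rewrite e // ts.
Qed.

Lemma absorb_dom f b s : cochain S f -> b \in S -> words S s -> dom M (absorb f b s).
Proof.
elim: s f b => [|c s IH] f b fW bS /=.
  by move=> _; apply: (lact_dom MP) => //; apply: fW.
move=> /andP[cS sS]; apply: domB; first by apply: fW; rewrite /= SM.
by apply: IH => // t tS; apply: fW; rewrite /= bS.
Qed.

Lemma codiff_dom f : cochain S f -> cochain S (codiff f).
Proof.
move=> fW [|b s] /=; first by move=> _; apply: sm0.
move=> /andP[bS sS]; apply: domB; last exact: absorb_dom.
by apply: (ract_dom MP) => //; apply: fW.
Qed.

Lemma cochain_shift f b : cochain S f -> b \in S -> cochain S (fun t => f (b :: t)).
Proof. by move=> fW bS t tS; apply: fW; rewrite /= bS. Qed.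

(** The terms that keep [b] as a letter of its own cancel, by the same identity
    for shorter words. *)
Lemma absorb_absorb f b c s : cochain S f -> b \in S -> c \in S -> words S s ->
  absorb (absorb f b) c s = absorb f (mul c b) s.
Proof.
elim: s f b c => [|d s IH] f b c fW bS cS /=.
  by move=> _; rewrite (lactM MP) //; apply: fW.
move=> /andP[dS sS].
have -> : absorb (fun t => f (mul c b :: t) - absorb (fun t => f (b :: t)) c t) d s
  = absorb (fun t => f (mul c b :: t)) d s - absorb (absorb (fun t => f (b :: t)) c) d s.
  rewrite addrC -[in RHS]scaleN1r -absorbP.
  by apply: eq_in_absorb => // t _ _; rewrite scaleN1r addrC.
rewrite IH //; last exact: cochain_shift.
by rewrite opprB addrA subrK mulA.
Qed.

Lemma absorb_codiff f b s : cochain S f -> b \in S -> words S s ->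
  absorb (codiff f) b s = ract M b (codiff f s).
Proof.
elim: s f b => [|c s IH] f b fW bS /=; first by rewrite !linear0.
move=> /andP[cS sS].
have -> : absorb (fun t => ract M b (f t) - absorb f b t) c s
   = ract M b (absorb f c s) - absorb (absorb f b) c s.
  rewrite -(@absorb_linear (ract M b) _ _ _ S) //; last first.
    by move=> d v dS vW; rewrite (lractC MP).
  rewrite addrC -[in RHS]scaleN1r -absorbP.
  by apply: eq_in_absorb => // t _ _; rewrite scaleN1r addrC.
rewrite absorb_absorb // opprB linearB (ractM MP) //; last exact: fW.
by rewrite addrA subrK.
Qed.

Lemma codiff_codiff f s : cochain S f -> words S s -> codiff (codiff f) s = 0.
Proof.
case: s => //= b s fW /andP[bS sS].
by rewrite absorb_codiff // subrr.
Qed.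

End Differential.

Definition cocycle (S : {set T}) (M : bimodule) (f : seq T -> M) :=
  cochain S f /\ forall s, words S s -> codiff f s = 0.

(** Over a field, cochains on words in a multiplicative basis [S] are the
    Hochschild cochains of the algebra spanned by [S]; this is the vanishing of
    its cohomology with values in [M], in the degrees in [D]. *)
Definition exact (D : pred nat) (S : {set T}) (M : bimodule) :=
  forall f : seq T -> M, cocycle S f ->
  exists2 g : seq T -> M, cochain S g &
    forall s, words S s -> D (size s) -> f s = codiff g s.

Record short_exact (S : {set T}) (L M N : bimodule)
    (i : {linear L -> M}) (p : {linear M -> N}) : Prop := ShortExact {
  inj_dom : forall v, dom L v -> dom M (i v);
  inj_lact : forall b v, b \in S -> dom L v -> i (lact L b v) = lact M b (i v);
  inj_ract : forall b v, b \in S -> dom L v -> i (ract L b v) = ract M b (i v);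
  inj_inj : forall v, dom L v -> i v = 0 -> v = 0;
  prj_dom : forall v, dom M v -> dom N (p v);
  prj_lact : forall b v, b \in S -> dom M v -> p (lact M b v) = lact N b (p v);
  prj_ract : forall b v, b \in S -> dom M v -> p (ract M b v) = ract N b (p v);
  prj_surj : forall w, dom N w -> exists2 v, dom M v & p v = w;
  prj_inj : forall v, dom L v -> p (i v) = 0;
  prj_ker : forall v, dom M v -> p v = 0 -> exists2 u, dom L u & i u = v }.

(** A primitive of [f] in the degrees in [D] is a primitive, in all degrees, of
    the part of [f] in these degrees. This reduces exactness in some degrees to
    exactness everywhere in the diagram chase for extensions. *)
Definition truncate (V : nmodType) (c : pred nat) (f : seq T -> V) s :=
  if c (size s) then f s else 0.

Lemma codiff_truncate (M : bimodule) (c : pred nat) (f : seq T -> M) s :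
  codiff (truncate c f) s = if c (size s).-1 then codiff f s else 0.
Proof.
case: s => [|b s] /=; first by rewrite if_same.
have -> : absorb (truncate c f) b s = if c (size s) then absorb f b s else 0.
  rewrite /truncate; elim: s (c) f b => [|d s IH] {}c f b /=.
    by case: ifP => // _; rewrite linear0.
  by rewrite (IH (fun n => c n.+1) (fun t => f (b :: t))); case: ifP; rewrite ?subr0.
by rewrite /truncate; case: ifP => _ //; rewrite linear0 subr0.
Qed.

Lemma cochain_truncate (S : {set T}) (M : bimodule) c (f : seq T -> M) :
  cochain S f -> cochain S (truncate c f).
Proof. by move=> fW s sS; rewrite /truncate; case: ifP => _; [apply: fW|apply: sm0]. Qed.

Lemma exact_truncate D S M : exact D S M ->
  forall f : seq T -> M, cocycle S f -> exists2 g : seq T -> M, cochain S g &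
    forall s, words S s -> truncate D f s = codiff g s.
Proof.
move=> Mx f fP; have [g gW fg] := Mx f fP.
exists (truncate (fun n => D n.+1) g); first exact: cochain_truncate.
move=> [|b s] sS; rewrite codiff_truncate /truncate [size _]/= ?[_.-1]/=.
  by rewrite if_same; case: ifP => // D0; rewrite fg.
by case: ifP => // Ds; rewrite fg.
Qed.

Lemma codiff_morph (S : {set T}) (M N : bimodule) (p : {linear M -> N}) f s :
  (forall b v, b \in S -> dom M v -> p (lact M b v) = lact N b (p v)) ->
  (forall b v, b \in S -> dom M v -> p (ract M b v) = ract N b (p v)) ->
  cochain S f -> words S s -> codiff (p \o f) s = p (codiff f s).
Proof.
move=> pl pr fW; case: s => [|b s] /=; first by rewrite linear0.
move=> /andP[bS sS]; rewrite linearB pr //; last exact: fW.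
congr (_ - _); elim: s f b fW bS sS => [|c s IH] f b fW bS /=.
  by rewrite pl //; apply: fW.
move=> /andP[cS sS]; rewrite linearB -IH //.
by move=> t tS; apply: fW; rewrite /= bS.
Qed.

(** ** The two-out-of-three property *)

(** These are the consequences of the long exact sequence of cohomology. The
    statement for the middle term holds in each degree separately; the other two
    involve neighbouring degrees. *)

Section TwoOfThree.
Variable S : {set T}.
Hypothesis mulA : associative mul.
Hypothesis SM : mul_closed S.
Variables (L M N : bimodule) (i : {linear L -> M}) (p : {linear M -> N}).
Hypotheses (LP : bimodule_over S L) (MP : bimodule_over S M) (iP : short_exact S i p).

Let i_codiff f s : cochain S f -> words S s -> codiff (i \o f) s = i (codiff f s).
Proof. by apply: codiff_morph => b v bS vW; [rewrite (inj_lact iP)|rewrite (inj_ract iP)]. Qed.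

Let p_codiff f s : cochain S f -> words S s -> codiff (p \o f) s = p (codiff f s).
Proof. by apply: codiff_morph => b v bS vW; [rewrite (prj_lact iP)|rewrite (prj_ract iP)]. Qed.

Lemma lift_prj (h : seq T -> N) : cochain S h ->
  exists2 g : seq T -> M, cochain S g & forall s, words S s -> p (g s) = h s.
Proof.
move=> hW.
have /choice[g gP] : forall s, exists v : M, words S s -> dom M v /\ p v = h s.
  move=> s; have [sS|nS] := boolP (words S s); last by exists 0.
  by have [v vW <-] := prj_surj iP (hW s sS); exists v.
by exists g => s sS; have [] := gP s sS.
Qed.

Lemma lift_inj (h : seq T -> M) : cochain S h -> (forall s, words S s -> p (h s) = 0) ->
  exists2 g : seq T -> L, cochain S g & forall s, words S s -> i (g s) = h s.
Proof.
move=> hW h0.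
have /choice[g gP] : forall s, exists v : L, words S s -> dom L v /\ i v = h s.
  move=> s; have [sS|nS] := boolP (words S s); last by exists 0.
  by have [v vW <-] := prj_ker iP (hW s sS) (h0 s sS); exists v.
by exists g => s sS; have [] := gP s sS.
Qed.

Let codiffD (f g : seq T -> M) s : codiff (fun t => f t + g t) s = codiff f s + codiff g s.
Proof.
rewrite -[codiff f s]scale1r -codiffP; congr (codiff _ s).
by apply/funext => t; rewrite scale1r.
Qed.

Let codiffB (f g : seq T -> M) s : codiff (fun t => f t - g t) s = codiff f s - codiff g s.
Proof.
rewrite addrC -scaleN1r -codiffP; congr (codiff _ s).
by apply/funext => t; rewrite scaleN1r addrC.
Qed.

(* If [p \o f] is the coboundary of [p \o g], then [f] minus the coboundary of
   [g] has values in [L]. *)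
Let reduce f g : cochain S f -> cochain S g ->
  (forall s, words S s -> p (f s) = codiff (p \o g) s) ->
  exists2 h : seq T -> L, cochain S h &
    forall s, words S s -> i (h s) = f s - codiff g s.
Proof.
move=> fW gW fg; apply: lift_inj => s sS.
  by apply: domB; [apply: fW|apply: (codiff_dom SM MP gW)].
by rewrite linearB fg // p_codiff // subrr.
Qed.

Lemma exact_ext D : exact D S L -> exact D S N -> exact D S M.
Proof.
move=> Lx Nx f [fW f0].
have [|h hW pfh] := exact_truncate Nx (f := p \o f).
  split=> s sS /=; first exact: prj_dom iP _ (fW s sS).
  by rewrite p_codiff // f0 // linear0.
have [g gW gh] := lift_prj hW.
have fDW := cochain_truncate D fW.
have [|e eW ie] := reduce fDW gW.
  move=> s sS; rewrite (eq_in_codiff SM (g := h) sS).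
    by rewrite -pfh // /truncate /=; case: ifP => //; rewrite linear0.
  by move=> t tS _; rewrite /= gh.
have [|e' e'W ee'] := Lx e.
  split=> // s sS; apply: (inj_inj iP); first exact: (codiff_dom SM LP _ sS).
  rewrite -i_codiff // (eq_in_codiff SM (g := fun s => truncate D f s - codiff g s) sS).
    by rewrite codiffB codiff_truncate f0 // if_same (codiff_codiff mulA SM MP _ sS) // subrr.
  by move=> t tS _; rewrite /= ie.
exists (fun s => g s + i (e' s)) => [s sS|s sS Ds].
  by apply: domD; [apply: gW|apply: inj_dom iP _ (e'W s sS)].
rewrite codiffD (i_codiff e'W sS) -ee' // ie // /truncate Ds.
by rewrite addrC subrK.
Qed.

Lemma exact_sub : exact predT S M -> exact predT S N -> exact predT S L.
Proof.
move=> Mx Nx f [fW f0].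
have ifW : cochain S (i \o f) by move=> s sS; apply: inj_dom iP _ (fW s sS).
have [|g gW fg] := Mx (i \o f).
  by split=> // s sS; rewrite i_codiff // f0 // linear0.
have pgW : cochain S (p \o g) by move=> s sS; apply: prj_dom iP _ (gW s sS).
have [|h hW gh] := Nx (p \o g).
  by split=> // s sS; rewrite p_codiff // -fg //= (prj_inj iP) //; apply: fW.
have [e eW eh] := lift_prj hW.
have [|q qW iq] := reduce gW eW.
  by move=> s sS; rewrite (eq_in_codiff SM (g := h) sS) => [|t tS _];
    [rewrite -gh|rewrite /= eh].
exists q => // s sS _; apply/eqP; rewrite -subr_eq0; apply/eqP/(inj_inj iP).
  by apply: domB; [apply: fW|apply: (codiff_dom SM LP _ sS)].
rewrite linearB -(i_codiff qW sS).
rewrite (eq_in_codiff SM (g := fun s => g s - codiff e s) sS).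
  by rewrite codiffB (codiff_codiff mulA SM MP _ sS) // subr0 -fg //= subrr.
by move=> t tS _; rewrite /= iq.
Qed.

Lemma exact_quo : exact predT S L -> exact predT S M -> exact predT S N.
Proof.
move=> Lx Mx f [fW f0].
have [g gW gf] := lift_prj fW.
have [|h hW ih] := lift_inj (codiff_dom SM MP gW).
  move=> s sS; rewrite -p_codiff // -[RHS](f0 s) //.
  by apply: (eq_in_codiff SM) => // t tS _; rewrite /= gf.
have [|e eW he] := Lx h.
  split=> // s sS; apply: (inj_inj iP); first exact: (codiff_dom SM LP _ sS).
  rewrite -i_codiff // -[RHS](codiff_codiff mulA SM MP gW sS).
  by apply: (eq_in_codiff SM) => // t tS _; rewrite /= ih.
have ieW : cochain S (i \o e) by move=> s sS; apply: inj_dom iP _ (eW s sS).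
have [|q qW gq] := Mx (fun s => g s - i (e s)).
  split=> s sS; first by apply: domB; [apply: gW|apply: ieW].
  by rewrite codiffB (i_codiff eW sS) -he // ih // subrr.
exists (p \o q) => [s sS|s sS _]; first exact: prj_dom iP _ (qW s sS).
rewrite p_codiff // -gq // linearB gf //.
by rewrite (prj_inj iP) ?subr0 //; apply: eW.
Qed.
End TwoOfThree.

Lemma exact0 D (S : {set T}) (M : bimodule) : (forall v, dom M v -> v = 0) -> exact D S M.
Proof.
move=> M0 f [fW f0]; exists f => // s sS _.
by rewrite f0 // (M0 _ (fW s sS)).
Qed.

(* An isomorphism is an extension by the zero bimodule. *)
Fact zero_set0 (V : lmodType k) : (0 : V) = 0. Proof. by []. Qed.
Fact zero_setP (V : lmodType k) (a : k) (v w : V) : v = 0 -> w = 0 -> a *: v + w = 0.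
Proof. by move=> -> ->; rewrite scaler0 addr0. Qed.
Definition zero_submodule (V : lmodType k) : submodule V :=
  Submodule (@zero_set0 V) (@zero_setP V).

Lemma exact_iso D (S : {set T}) (M N : bimodule) (p : {linear M -> N}) :
  associative mul -> mul_closed S -> bimodule_over S M ->
  (forall v, dom M v -> dom N (p v)) ->
  (forall b v, b \in S -> dom M v -> p (lact M b v) = lact N b (p v)) ->
  (forall b v, b \in S -> dom M v -> p (ract M b v) = ract N b (p v)) ->
  (forall v, dom M v -> p v = 0 -> v = 0) ->
  (forall w, dom N w -> exists2 v, dom M v & p v = w) ->
  exact D S N -> exact D S M.
Proof.
move=> mulA SM MP pd pl pr pi ps.
pose L := Bimodule (zero_submodule M) (lact M) (ract M).
apply: (exact_ext mulA SM (L := L) (i := idfun : {linear L -> M}) (p := p)) => //=.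
- by split=> /= [b v _ ->|b v _ ->|b c v _ _ ->|b c v _ _ ->|b c v _ _ ->]; rewrite !linear0.
- split=> //= [v ->|v -> | v vW pv0]; [exact: sm0|by rewrite linear0|].
  by exists 0 => //; rewrite [RHS]pi.
by apply: exact0 => v.
Qed.
End Cochains.

(** * Excision of an ideal *)

Section RightUnit.
Variables (k : fieldType) (T : finType) (mul : T -> T -> T).
Hypothesis mulA : associative mul.
Hypothesis mulxx : idempotent_op mul.
Hypothesis mulxyx : forall x y, mul (mul x y) x = mul x y.

(** In the semigroup algebra put [u = 1 - \prod_(y in I) (1 - y)], which lies in
    the span of [I]. For [x] in [I] one has [x u = x]: multiplying [x] by the
    factors that precede [1 - x] gives a combination of elements [w] that start
    with [x], and such a [w] satisfies [w x = w], hence [w (1 - x) = 0]. *)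
Lemma right_unit (V : lmodType k) (I : {set T}) : mul_closed mul I ->
  exists u : T -> k, forall (phi : T -> V) x, x \in I ->
    \sum_(y in I) u y *: phi (mul x y) = phi x.
Proof.
move=> IM.
suff /(_ (enum I))[|u uP] : forall L, all (mem I) L -> exists u : T -> k,
    forall (phi : T -> V) w x, x \in L -> mul w x = w ->
    \sum_(y in I) u y *: phi (mul w y) = phi w.
- by apply/allP => x; rewrite mem_enum.
- exists u => phi x xI; apply: uP (mulxx x).
  by rewrite mem_enum.
elim=> [|y L IH] /=; first by exists (fun=> 0).
move=> /andP[yI /IH[u uP]].
(* the coefficients of [y + u - y u], that is of [1 - (1 - y) (1 - u)] *)
exists (fun t => (t == y)%:R + u t - \sum_(z in I | mul y z == t) u z) => phi w x.
have -> : \sum_(t in I) ((t == y)%:R + u t - \sum_(z in I | mul y z == t) u z)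
    *: phi (mul w t) = phi (mul w y) + \sum_(z in I) u z *: phi (mul w z)
    - \sum_(z in I) u z *: phi (mul (mul w y) z).
  under eq_bigr => t _ do rewrite scalerBl scalerDl scaler_suml.
  rewrite sumrB big_split /=; congr (_ + _ - _).
    rewrite (bigD1 y) //= eqxx scale1r big1 ?addr0 // => t /andP[_ /negPf ->].
    by rewrite scale0r.
  rewrite (exchange_big_dep (mem I)) /=; last by move=> ? ? _ /andP[].
  apply: eq_bigr => z zI; rewrite (bigD1 (mul y z)) /=; last first.
    by rewrite zI eqxx IM.
  rewrite mulA big1 ?addr0 // => t /andP[/andP[_ /andP[_ /eqP->]]].
  by rewrite eqxx.
rewrite inE => /orP[/eqP->|xL] wx; first by rewrite wx addrK.
rewrite (uP phi w x) // (uP phi (mul w y) x) // 1?addrC ?addKr //.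
by rewrite -{1}wx -!mulA [mul x _]mulA mulxyx !mulA wx.
Qed.

End RightUnit.

Section Excision.
Variables (k : fieldType) (T : finType) (mul : T -> T -> T).
Hypothesis mulA : associative mul.
Variables (B S : {set T}).
Hypotheses (SB : S \subset B) (BM : mul_closed mul B) (SM : mul_closed mul S).
Hypothesis IM : forall x b, x \in B :\: S -> b \in B ->
  mul x b \in B :\: S /\ mul b x \in B :\: S.
Variable M : bimodule k T.
Hypothesis MP : bimodule_over mul B M.
Hypothesis M0 : forall x v, x \in B :\: S -> dom M v -> lact M x v = 0 /\ ract M x v = 0.
Variable u : T -> k.
Local Notation I := (B :\: S).
Hypothesis uP : forall (phi : T -> M) x, x \in I ->
    \sum_(y in I) u y *: phi (mul x y) = phi x.

Implicit Types (f g : seq T -> M) (s t : seq T).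
Local Notation absorb := (absorb mul).
Local Notation codiff := (codiff mul).

Let IB x : x \in I -> x \in B. Proof. by case/setDP. Qed.

(** The contracting homotopy: the right unit of the ideal [I] is inserted to the
    right of the first letter that lies in [I]. As [I] annihilates [M], the
    terms in which the unit or this letter acts on [M] disappear. *)
Fixpoint insert_unit f t : M :=
  if t is b :: s then
    if b \in I then \sum_(y in I) u y *: f (y :: t)
    else - insert_unit (fun s => f (b :: s)) s
  else 0.

Lemma eq_insert f g t : words B t ->
  (forall s, words B s -> f s = g s) -> insert_unit f t = insert_unit g t.
Proof.
elim: t f g => //= b t IH f g /andP[bB tB] e; case: ifP => _.
  by apply: eq_bigr => y yI; rewrite e //= IB // bB.
by congr (- _); apply: IH => // s sB; rewrite e //= bB.
Qed.

Lemma insertB f g t :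
  insert_unit (fun s => f s - g s) t = insert_unit f t - insert_unit g t.
Proof.
elim: t f g => [|b t IH] f g /=; first by rewrite subrr.
case: ifP => _; last by rewrite IH opprD.
by rewrite -sumrB; apply: eq_bigr => y _; rewrite scalerBr.
Qed.

Lemma insert_act (L : {linear M -> M}) f t :
  insert_unit (fun s => L (f s)) t = L (insert_unit f t).
Proof.
elim: t f => [|b t IH] f /=; first by rewrite linear0.
case: ifP => _; last by rewrite IH linearN.
by rewrite linear_sum; apply: eq_bigr => y _; rewrite linearZ.
Qed.

Lemma insert_dom f : cochain B f -> cochain B (insert_unit f).
Proof.
move=> fW t; elim: t f fW => [|b t IH] f fW /=; first by move=> _; apply: sm0.
move=> /andP[bB tB]; case: ifP => _.
  by apply: dom_sum => y yI; apply: domZ; apply: fW; rewrite /= bB IB.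
by apply: domN; apply: IH => // s sB; apply: fW; rewrite /= bB.
Qed.

Lemma absorb0 b t : absorb (fun=> 0 : M) b t = 0.
Proof. by elim: t b => [|c t IH] b /=; rewrite ?linear0 // IH subr0. Qed.

Lemma insert0 t : insert_unit (fun=> 0) t = 0.
Proof.
elim: t => //= b t IH; case: ifP => _; last by rewrite IH oppr0.
by rewrite big1 // => y _; rewrite scaler0.
Qed.

Lemma absorb_sum (F : T -> seq T -> M) b t :
  absorb (fun s => \sum_(y in I) u y *: F y s) b t
  = \sum_(y in I) u y *: absorb (F y) b t.
Proof.
elim: t F b => [|c t IH] F b /=.
  by rewrite linear_sum; apply: eq_bigr => y _; rewrite linearZ.
rewrite (IH (fun y s => F y (b :: s))) -sumrB.
by apply: eq_bigr => y _; rewrite scalerBr.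
Qed.

Lemma absorb_opp f b t : absorb (fun s => - f s) b t = - absorb f b t.
Proof.
have := absorbP mul (-1) f (fun=> 0) b t; rewrite absorb0 addr0 scaleN1r => <-.
by congr (absorb _ b t); apply/funext => s; rewrite scaleN1r addr0.
Qed.

(* From a first letter in [I], [absorb] reaches only words that start in [I],
   as [I] is an ideal and annihilates [M]. *)
Lemma absorb_ideal f g b t : b \in I -> words B t -> cochain B f -> cochain B g ->
  (forall c s, c \in I -> words B s -> f (c :: s) = g (c :: s)) ->
  absorb f b t = absorb g b t.
Proof.
move=> bI tB fW gW e; case: t tB => [|c t] /=.
  by move=> _; rewrite !(M0 bI _).1 //; [apply: gW|apply: fW].
move=> /andP[cB tB]; rewrite e //; last exact: (IM bI cB).2.
by congr (_ - _); apply: (eq_in_absorb BM) => // s sB _; apply: e.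
Qed.

(** The failure of the homotopy to commute with the differential comes from the
    letters of [S] that precede the first letter in [I]. *)
Definition defect f h t := insert_unit (absorb f h) t - absorb (insert_unit f) h t.

Let insert_cons f h : h \in S ->
  (fun s => insert_unit f (h :: s)) = fun s => - insert_unit (fun s => f (h :: s)) s.
Proof. by move=> hS; apply/funext => s /=; rewrite inE hS. Qed.

Lemma defect_cons f h c t : cochain B f -> h \in S -> c \in S -> words B t ->
  defect f h (c :: t) = defect (fun s => f (h :: s)) c t.
Proof.
move=> fW hS cS tB; rewrite /defect /= inE cS /= insertB insert_cons //.
rewrite inE SM //= absorb_opp !opprB !opprK.
by rewrite addrACA addNr addr0.
Qed.

Lemma defect_ideal f h x t : cochain B f -> h \in S -> x \in I -> words B t ->
  defect f h (x :: t) = \sum_(y in I) u y *: f (mul y h :: x :: t)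
    - f (h :: x :: t) - \sum_(y in I) u y *: f (y :: mul x h :: t).
Proof.
move=> fW hS xI tB; have hB := subsetP SB h hS.
rewrite /defect /= xI (IM xI hB).1 insert_cons // absorb_opp.
have -> : absorb (insert_unit (fun s => f (h :: s))) x t
    = \sum_(y in I) u y *: absorb (fun s => f (h :: y :: s)) x t.
  rewrite -absorb_sum; apply: absorb_ideal => //.
  - by apply: insert_dom; apply: cochain_shift.
  - move=> s sB; apply: dom_sum => y yI; apply: domZ; apply: fW.
    by rewrite /= hB IB.
  - by move=> c s cI sB /=; rewrite cI.
under eq_bigr => y yI do rewrite scalerBr scalerBr.
rewrite !sumrB (uP (fun z => f (h :: z :: t)) xI) opprB addrA.
rewrite opprD opprK addrACA.
by rewrite [X in X + _]addrAC addrACA subrr addr0 addrAC.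
Qed.

Definition clear n f := forall t, words B t -> has (mem I) (take n t) -> f t = 0.

Lemma defect_clear n f h t : cochain B f -> h \in S -> words B t -> clear n f ->
  has (mem I) (take n t) -> defect f h t = - f (h :: t).
Proof.
elim: t n f h => [|b t IH] [|n] f h //= fW hS /andP[bB tB] f0.
have hB := subsetP SB h hS.
have [bI _|bI] := boolP (b \in I).
  rewrite defect_ideal // big1 => [|y yI]; last first.
    rewrite f0 ?scaler0 //=; first by rewrite (IB (IM yI hB).1) bB.
    by rewrite (IM yI hB).1.
  rewrite big1 ?subr0 ?sub0r // => y yI.
  rewrite f0 ?scaler0 //= ?yI // tB andbT (IB yI).
  by rewrite (IB (IM bI hB).1).
have bS : b \in S by move: bI; rewrite inE bB andbT negbK.
rewrite /= => tI; rewrite defect_cons // (IH n) //; first exact: cochain_shift.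
by move=> s sB sI; apply: f0; rewrite /= ?hB // sI orbT.
Qed.

(** Adding the coboundary of the homotopy removes the values on the words
    whose first letter in [I] is the next one: there the homotopy formula
    reproduces the cocycle itself, with the opposite sign. *)
Lemma clear_step n f : cocycle mul B f -> clear n f ->
  clear n.+1 (fun t => f t + codiff (insert_unit f) t).
Proof.
move=> [fW f0] fn [|b t] //= /andP[bB tB].
have hom : insert_unit (codiff f) (b :: t) = 0.
  by rewrite (@eq_insert _ (fun=> 0)) ?insert0 //= bB.
have [bI _|bI tI] := boolP (b \in I).
  move: hom; rewrite /= bI.
  have -> : \sum_(y in I) u y *: codiff f [:: y, b & t]
      = - f (b :: t) + \sum_(y in I) u y *: absorb (fun s => f (y :: s)) b t.
    rewrite -(uP (fun z => f (z :: t)) bI) addrC -sumrB; apply: eq_bigr => y yI.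
    by rewrite /= (M0 yI (fW (b :: t) _)).2 ?sub0r ?opprB ?scalerBr //= bB.
  rewrite (M0 bI (insert_dom fW tB)).2 sub0r => hom.
  rewrite -absorb_sum in hom.
  rewrite (@absorb_ideal _ (fun s => \sum_(y in I) u y *: f (y :: s))) //.
  - by rewrite -[LHS]opprK opprB addrC hom oppr0.
  - exact: insert_dom.
  - move=> s sB; apply: dom_sum => y yI; apply: domZ; apply: fW.
    by rewrite /= IB.
  - by move=> c s cI sB /=; rewrite cI.
have bS : b \in S by move: bI; rewrite inE bB andbT negbK.
move: hom; rewrite /= (negPf bI) insertB insert_act => /eqP.
rewrite oppr_eq0 subr_eq0 => /eqP ->.
by rewrite -/(defect f b t) (defect_clear fW bS tB fn tI) subrr.
Qed.

Lemma clear_cohomologous n f : cocycle mul B f ->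
  exists2 g, cochain B g & cocycle mul B (fun t => f t - codiff g t) /\
    clear n (fun t => f t - codiff g t).
Proof.
move=> fP; elim: n => [|n [g gW [hP hc]]].
  exists (fun=> 0) => [s _|]; first exact: sm0.
  have -> : (fun t => f t - codiff (fun=> 0) t) = f.
    apply/funext => -[|b t] /=; first by rewrite subr0.
    by rewrite linear0 absorb0 !subr0.
  by split => // t _; rewrite take0.
set h := fun t => f t - codiff g t in hP hc.
exists (fun t => -1 *: insert_unit h t + g t).
  by move=> s sB; apply: dom_lin; [apply: insert_dom hP.1 _ _|apply: gW].
have -> : (fun t => f t - codiff (fun t => -1 *: insert_unit h t + g t) t)
    = fun t => h t + codiff (insert_unit h) t.
  apply/funext => t; rewrite codiffP scaleN1r /h opprD opprK addrCA.
  by rewrite [in RHS]addrC.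
split; last exact: clear_step hP hc.
split=> s sB.
  by apply: domD; [apply: hP.1|apply: (codiff_dom BM MP (insert_dom hP.1))].
have -> : (fun t => h t + codiff (insert_unit h) t) = fun t => 1 *: h t + codiff (insert_unit h) t.
  by apply/funext => t; rewrite scale1r.
rewrite codiffP hP.2 // scaler0 add0r (codiff_codiff mulA BM MP _ sB) //.
exact: insert_dom hP.1.
Qed.

Let words_sub t : words S t -> words B t.
Proof. by apply: sub_all => x; apply: subsetP. Qed.

(** A product of letters of [B] lies in [S] only if both letters do, so that the
    differential of a cochain extended by zero is again extended by zero. *)
Lemma absorb_extend g b t : cochain B g ->
  (forall s, words B s -> ~~ words S s -> g s = 0) ->
  words B (b :: t) -> ~~ words S (b :: t) -> absorb g b t = 0.
Proof.
elim: t g b => [|c t IH] g b gW g0 /=.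
  move=> /andP[bB _]; rewrite andbT => bS; rewrite (M0 _ (gW [::] _)).1 //.
  by rewrite inE bS bB.
move=> /andP[bB /andP[cB tB]] nS; rewrite g0 /= ?BM //; last first.
  apply: contra nS => /andP[cbS ->]; rewrite andbT.
  apply/andP; split; apply: contraLR cbS.
    by move=> bS; move: (IM (x := b) (b := c)); rewrite !inE bS bB cB => /(_ isT isT)[_ /andP[]].
  by move=> cS; move: (IM (x := c) (b := b)); rewrite !inE cS bB cB => /(_ isT isT)[/andP[]].
have [bS|bS] := boolP (b \in S); last first.
  rewrite (eq_in_absorb BM (g := fun=> 0)) ?absorb0 ?subr0 //.
  by move=> s sB _; rewrite g0 //= ?bB // negb_and bS.
rewrite IH ?subr0 //=; first exact: cochain_shift.
- by move=> s sB sS; rewrite g0 //= ?bB // bS.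
- by rewrite cB.
- by move: nS; rewrite /= bS.
Qed.

(** An annihilating ideal with a right unit does not change the cohomology: a
    cocycle can be changed by coboundaries until it vanishes on all words of
    length [n] with a letter in the ideal, and then it is a cocycle on words in
    [S], extended by zero. *)
Theorem excision n : exact mul (pred1 n) S M -> exact mul (pred1 n) B M.
Proof.
move=> SMx f fP; have [g gW [[hW h0] hc]] := clear_cohomologous n fP.
have [|e eW he] := SMx (fun t => f t - codiff g t).
  by split=> s sS; [apply: hW (words_sub sS)|apply: h0 (words_sub sS)].
pose e' t := if words S t then e t else 0.
have e'W : cochain B e'.
  by move=> s sB; rewrite /e'; case: ifP => sS; [apply: eW|apply: sm0].
have e'0 s : words B s -> ~~ words S s -> e' s = 0 by rewrite /e' => _ /negPf ->.
exists (fun t => 1 *: g t + e' t) => [s sB|s sB /eqP sn].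
  by apply: dom_lin; [apply: gW|apply: e'W].
rewrite codiffP scale1r; apply/eqP; rewrite addrC -subr_eq; apply/eqP.
have [sS|sS] := boolP (words S s).
  rewrite he //=; last by rewrite sn.
  by apply: (eq_in_codiff SM) => // t tS _; rewrite /e' tS.
rewrite hc //; last first.
  by rewrite -sn take_size; move: sS sB; rewrite -has_predC => /hasP[x xs /= xS] /allP sB;
    apply/hasP; exists x => //; rewrite /= inE xS; apply: sB.
case: s sB sS {sn} => //= b s sB sS; rewrite absorb_extend // subr0.
have [sS'|sS'] := boolP (words S s); last first.
  by rewrite e'0 ?linear0 //; case/andP: sB.
rewrite (M0 _ (e'W s _)).2 //; last by case/andP: sB.
by case/andP: sB => bB _; move: sS; rewrite sS' andbT inE bB andbT.
Qed.

End Excision.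

(** * Sign vectors and contractible cones *)

Section SignVectors.
Variable E : finType.
Definition signs := {ffun E -> option bool}.
Implicit Types (x y z w t : signs) (H : E) (Z : {set E}) (S U V : {set signs}).

Definition smul x y : signs := [ffun H => if x H is None then y H else x H].
Definition szero : signs := [ffun=> None].
Definition sneg x : signs := [ffun H => omap negb (x H)].
Definition opposite (a b : option bool) :=
  if (a, b) is (Some r, Some s) then r != s else false.
Definition assign x H (a : option bool) : signs :=
  [ffun H' => if H' == H then a else x H'].

Lemma smulA : associative smul.
Proof. by move=> x y z; apply/ffunP => H; rewrite !ffunE; case: (x H). Qed.
Lemma smulxx : idempotent_op smul.
Proof. by move=> x; apply/ffunP => H; rewrite !ffunE; case: (x H). Qed.
Lemma smulxyx x y : smul (smul x y) x = smul x y.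
Proof. by apply/ffunP => H; rewrite !ffunE; case: (x H); case: (y H). Qed.
Lemma smul0 x : smul szero x = x.
Proof. by apply/ffunP => H; rewrite !ffunE. Qed.
Lemma smulr0 x : smul x szero = x.
Proof. by apply/ffunP => H; rewrite !ffunE; case: (x H). Qed.

Lemma smul_idPr x y : reflect (forall H, x H -> y H = x H) (smul x y == y).
Proof.
apply: (iffP eqP) => [e H xH|e].
  by rewrite -e ffunE; case: (x H) xH.
by apply/ffunP => H; rewrite ffunE; case xH: (x H) => [a|] //; rewrite e xH.
Qed.

(** For [t] in [S] this is the principal right ideal [t S]; in general it is
    the cone of the members of [S] with the signs prescribed by [t]. *)
Definition up S t : {set signs} := [set x in S | smul t x == x].

(** A combinatorial form of contractibility, made for Mayer-Vietoris arguments: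
    principal ideals play the part of points. *)
Inductive contractible S : {set signs} -> Prop :=
| contractible_up w : w \in S -> contractible S (up S w)
| contractible_union U V : contractible S U -> contractible S V ->
    contractible S (U :&: V) -> contractible S (U :|: V).

Lemma in_up S t x : (x \in up S t) = (x \in S) && (smul t x == x).
Proof. by rewrite in_set. Qed.

Lemma up_ideal S w : mul_closed smul S -> right_ideal smul S (up S w).
Proof.
move=> SM; split; first by apply/subsetP => x; rewrite inE => /andP[].
by move=> x b; rewrite !inE => /andP[xS /eqP wx] bS; rewrite SM //= smulA wx.
Qed.

Lemma right_idealU S U V : right_ideal smul S U -> right_ideal smul S V ->
  right_ideal smul S (U :|: V).
Proof.
move=> [US UM] [VS VM]; split; first by rewrite subUset US.
by move=> x b; rewrite !inE => /orP[/UM|/VM] e /e ->; rewrite ?orbT.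
Qed.

Lemma contractible_ideal S U : mul_closed smul S -> contractible S U ->
  right_ideal smul S U.
Proof.
move=> SM; elim=> [w wS|{}U V _ IU _ IV _ _]; first exact: up_ideal.
exact: right_idealU.
Qed.

(** The covector axioms of an oriented matroid. *)
Record covectors (B : {set signs}) : Prop := Covectors {
  covector0 : szero \in B;
  covectorM : mul_closed smul B;
  covectorN : forall x, x \in B -> sneg x \in B;
  covector_elim : forall x y H s, x \in B -> y \in B ->
    x H = Some s -> y H = Some (~~ s) -> exists2 z, z \in B & z H = None /\
    forall H', ~~ opposite (x H') (y H') -> z H' = smul x y H' }.

Section Covectors.
Variable B : {set signs}.
Hypothesis BP : covectors B.

Definition flat Z : {set signs} := [set x in B | [forall H in Z, x H == None]].

Lemma flatP x Z : reflect (x \in B /\ forall H, H \in Z -> x H = None) (x \in flat Z).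
Proof.
rewrite inE; apply: (iffP andP) => -[xB xZ]; split => //.
  by move=> H HZ; apply/eqP/(forall_inP xZ).
by apply/forall_inP => H HZ; apply/eqP/xZ.
Qed.

Lemma flatM Z : mul_closed smul (flat Z).
Proof.
move=> x y /flatP[xB xZ] /flatP[yB yZ]; apply/flatP; split; first exact: covectorM BP _ _ xB yB.
by move=> H HZ; rewrite ffunE xZ // yZ.
Qed.

Lemma flatN Z x : x \in flat Z -> sneg x \in flat Z.
Proof.
by move=> /flatP[xB xZ]; apply/flatP; split=> [|H HZ]; rewrite ?(covectorN BP) // ffunE xZ.
Qed.

Lemma flat_setU1 H Z x : (x \in flat (H |: Z)) = (x \in flat Z) && (x H == None).
Proof.
apply/flatP/andP => [[xB xZ]|[/flatP[xB xZ] /eqP xH]].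
  by split; [apply/flatP; split=> // K KZ|apply/eqP]; rewrite xZ // !inE ?KZ ?eqxx ?orbT.
by split=> // K; rewrite !inE => /orP[/eqP->|/xZ].
Qed.

Lemma flat_elim Z x y H s : x \in flat Z -> y \in flat Z ->
  x H = Some s -> y H = Some (~~ s) -> exists2 z, z \in flat (H |: Z) &
  forall H', ~~ opposite (x H') (y H') -> z H' = smul x y H'.
Proof.
move=> /flatP[xB xZ] /flatP[yB yZ] xH yH.
have [z zB [zH zE]] := covector_elim BP xB yB xH yH; exists z => //.
rewrite flat_setU1 zH eqxx andbT; apply/flatP; split=> // K KZ.
by rewrite zE ?ffunE xZ // yZ.
Qed.

(** ** Cones are contractible *)

Lemma up_assign S t H s x : t H = None ->
  (x \in up S (assign t H (Some s))) = (x \in up S t) && (x H == Some s).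
Proof.
move=> tH; rewrite !inE -andbA; congr (_ && _).
apply/smul_idPr/andP => [e|[/smul_idPr e /eqP xH] K].
  split; last by rewrite e ffunE eqxx.
  apply/smul_idPr => K tK; rewrite e ffunE; case: eqP => // KH; by rewrite KH tH in tK.
by rewrite ffunE; case: eqP => [-> //|_ /e].
Qed.

(* the right ideal of [S] generated by [U] *)
Definition span S U : {set signs} := [set y in S | [exists p in U, smul p y == y]].

Lemma spanP S U y : reflect (y \in S /\ exists2 p, p \in U & smul p y = y) (y \in span S U).
Proof.
rewrite inE; apply: (iffP andP) => [[yS /exists_inP[p pU /eqP py]]|[yS [p pU py]]].
  by split=> //; exists p.
by split=> //; apply/exists_inP; exists p => //; apply/eqP.
Qed.

Lemma spanU S U V : span S (U :|: V) = span S U :|: span S V.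
Proof.
apply/setP => y; rewrite [RHS]inE; apply/spanP/orP.
  by move=> [yS [p]]; rewrite inE => /orP[pU|pV] py; [left|right]; apply/spanP;
    split=> //; exists p.
by move=> [] /spanP[yS [p pU py]]; split=> //; exists p => //; rewrite inE pU ?orbT.
Qed.

(** If both [p] and [q] fix [y] on the left, they agree with [y] where they are
    nonzero; so they commute, and [p q] lies in both ideals and fixes [y]. *)
Lemma spanI S0 S U V : right_ideal smul S0 U -> right_ideal smul S0 V ->
  span S (U :&: V) = span S U :&: span S V.
Proof.
move=> [US UM] [VS VM]; apply/setP => y; rewrite [RHS]inE; apply/spanP/andP.
  move=> [yS [p]]; rewrite inE => /andP[pU pV] py.
  by split; apply/spanP; split=> //; exists p.
move=> [/spanP[yS [p pU py]] /spanP[_ [q qV qy]]]; split=> //.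
have pq : smul p q = smul q p.
  apply/ffunP => H; rewrite !ffunE.
  have /eqP/smul_idPr/(_ H) := py; have /eqP/smul_idPr/(_ H) := qy.
  by case: (p H); case: (q H) => // a b -> // /(_ isT).
exists (smul p q); last by rewrite -smulA qy.
by rewrite inE UM ?(subsetP VS) //= pq VM ?(subsetP US).
Qed.

(** Extending an ideal of [S0] to [S] preserves unions, intersections and
    principal ideals, and therefore derivations of contractibility. *)
Lemma span_up S0 S w : w \in S0 -> span S (up S0 w) = up S w.
Proof.
move=> wS; apply/setP => y; rewrite [RHS]inE; apply/spanP/andP.
  move=> [yS [p]]; rewrite inE => /andP[_ /eqP wp] py.
  by split=> //; rewrite -py smulA wp.
by move=> [yS /eqP wy]; split=> //; exists w => //; rewrite inE wS smulxx eqxx.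
Qed.

Definition free Z t : {set E} := [set H | (H \notin Z) && (t H == None)].

(** A convex cone is contractible; the combinatorial proof is an induction on
    the number of hyperplanes [H] on which [t] leaves the sign open. If the cone
    does not meet [H], elimination shows that it lies on one side of [H]. If it
    does, the part on [H] is contractible in the smaller flat by induction, and
    so is the ideal that it spans; each open half is a cone with fewer open
    signs and meets this ideal in a contractible set. Gluing both halves to the
    ideal gives the whole cone. *)
Theorem contractible_cone Z t : up (flat Z) t != set0 ->
  contractible (flat Z) (up (flat Z) t).
Proof.
have [m] := ubnP #|free Z t|; elim: m => // m IH in Z t *.
rewrite ltnS => tm /set0Pn[x0 x0t].
have [/eqP|] := boolP (free Z t == set0).
  move=> /setP f0; suff tS : t \in flat Z by apply: contractible_up.
  move: (x0t); rewrite in_up => /andP[x0Z /smul_idPr tx].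
  suff -> : t = x0 by [].
  apply/ffunP => H; case tH: (t H) => [a|]; first by rewrite tx tH.
  have := f0 H; rewrite !inE tH eqxx andbT => /negbFE HZ.
  by case/flatP: x0Z => _ ->.
move=> /set0Pn[H]; rewrite inE => /andP[HZ /eqP tH].
pose S := flat Z; pose S0 := flat (H |: Z); pose P0 := up S0 t.
pose P s := up S (assign t H (Some s)).
have SM : mul_closed smul S by apply: flatM.
have inS0 x : (x \in S0) = (x \in S) && (x H == None) by rewrite flat_setU1.
have inP0 x : (x \in P0) = (x \in up S t) && (x H == None).
  by rewrite !in_up inS0 andbAC.
have inP s x : (x \in P s) = (x \in up S t) && (x H == Some s) by rewrite up_assign.
have lt_free Z' t' : (forall K, K \in free Z' t' -> K \in free Z t) ->
   H \notin free Z' t' -> (#|free Z' t'| < m)%N.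
  move=> sub nH; apply: leq_trans tm; apply: proper_card; apply/properP; split.
    exact/subsetP.
  by exists H => //; rewrite inE HZ tH.
have IHP s : P s != set0 -> contractible S (P s).
  move=> Ps; apply: IH Ps; apply: lt_free => [K|]; last first.
    by rewrite inE ffunE eqxx andbF.
  by rewrite !inE ffunE; case: ifP => // _; rewrite andbF.
have IH0 : P0 != set0 -> contractible S0 P0.
  move=> P00; apply: IH P00; apply: lt_free => [K|]; last by rewrite !inE eqxx.
  by rewrite !inE negb_or -andbA => /andP[_].
have move0 p s x : p \in P0 -> x \in S -> x H = Some s -> smul p x \in P s.
  rewrite inP0 => /andP[pt /eqP pH] xS xH.
  rewrite inP ffunE pH xH eqxx andbT.
  by have [_ ->] := up_ideal t SM.
have opp0 s : P0 != set0 -> P s != set0 -> P (~~ s) != set0.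
  move=> /set0Pn[p pP] /set0Pn[x]; rewrite inP => /andP[xt /eqP xH].
  apply/set0Pn; exists (smul p (sneg x)); apply: move0 => //.
    by apply: flatN; move: xt; rewrite in_up => /andP[].
  by rewrite ffunE xH.
have cover : up S t = P0 :|: P true :|: P false.
  apply/setP => x; rewrite !in_setU inP0 !inP -!andb_orr.
  by case: (x H) => [[]|]; rewrite ?andbT.
have [P00|P00] := eqVneq P0 set0.
  have nP s : P s != set0 -> P (~~ s) = set0.
    move=> /set0Pn[x]; rewrite inP => /andP[xt /eqP xH]; apply: contra_eq P00.
    move=> /set0Pn[y]; rewrite inP => /andP[yt /eqP yH].
    move: xt yt; rewrite !in_up => /andP[xS /smul_idPr xt] /andP[yS /smul_idPr yt].
    have [z zS zE] := flat_elim xS yS xH yH.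
    apply/set0Pn; exists z; rewrite in_up zS; apply/smul_idPr => K tK.
    rewrite zE ?ffunE xt ?yt //; first by case: (t K) tK.
    by case: (t K) => // a; rewrite /opposite eqxx.
  have [Pt|Pt] := boolP (P true != set0).
    by rewrite -/S cover P00 (nP true) // set0U setU0; apply: IHP.
  rewrite -/S cover P00 (eqP (negPn Pt)) !set0U; apply: IHP.
  move: x0t; rewrite -/S cover P00 (eqP (negPn Pt)) !set0U => x0P.
  by apply/set0Pn; exists x0.
have [Pt|Pt] := boolP (P true != set0); last first.
  have Pf : P false = set0.
    by apply/eqP; apply: contraR Pt => /(opp0 false P00).
  have SS0 : S = S0.
    apply/setP => x; rewrite inS0; case xS: (x \in S) => //=.
    case xH: (x H) => [s|] //; have /set0Pn[p pP] := P00.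
    have := move0 p s x pP xS xH; case: s {xH} => [|].
      by rewrite (eqP (negPn Pt)) in_set0.
    by rewrite Pf in_set0.
  rewrite -/S cover Pf (eqP (negPn Pt)) !setU0 SS0; exact: IH0.
have Pf := opp0 true P00 Pt.
(* transport along [span] of a derivation for [P0] in the flat of [H] *)
have tr U : contractible S0 U -> U \subset P0 -> contractible S (span S U) /\
    forall s, contractible S (span S U :&: P s).
  elim=> [w wS0|{}U V Uc IU Vc IV UVc IUV] sub.
    have wP0 : w \in P0 by apply: (subsetP sub); rewrite in_up wS0 smulxx eqxx.
    have wS : w \in S by move: wS0; rewrite inS0 => /andP[].
    have wH : w H = None by move: wS0; rewrite inS0 => /andP[_ /eqP].
    rewrite span_up //; split=> [|s]; first exact: contractible_up.
    have wt : w \in up S t by move: wP0; rewrite inP0 => /andP[].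
    have -> : up S w :&: P s = up S (assign w H (Some s)).
      apply/setP => x; rewrite in_setI inP up_assign //.
      case xw: (x \in up S w) => //=; suff -> : x \in up S t by [].
      move: xw; rewrite !in_up => /andP[-> /eqP <-] /=.
      by move: wt; rewrite in_up smulA => /andP[_ /eqP->].
    apply: IH.
      apply: lt_free => [K|]; last by rewrite inE ffunE eqxx andbF.
      rewrite !inE ffunE; case: ifP => [_|_ /andP[-> /=]]; first by rewrite andbF.
      by move: wt; rewrite in_up => /andP[_ /smul_idPr /(_ K)]; case: (t K) => // a -> .
    have /set0Pn[x] : P s != set0 by case: s.
    rewrite inP => /andP[]; rewrite in_up => /andP[xS _] /eqP xH.
    apply/set0Pn; exists (smul w x); rewrite up_assign // in_up SM //= smulA smulxx eqxx.
    by rewrite ffunE wH xH eqxx.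
  move: sub; rewrite subUset => /andP[Us Vs].
  have [[cU cUs] [cV cVs]] := (IU Us, IV Vs).
  have [|cI cIs] := IUV; first by apply: subset_trans Us; apply: subsetIl.
  have S0M : mul_closed smul S0 by apply: flatM.
  have sI := spanI S (contractible_ideal S0M Uc) (contractible_ideal S0M Vc).
  split=> [|s]; first by rewrite spanU; apply: contractible_union => //; rewrite -sI.
  rewrite spanU setIUl; apply: contractible_union => //.
  by rewrite setIACA setIid -sI.
have [cP0 cP0s] := tr _ (IH0 P00) (subxx _).
have half s : contractible S (P s :|: span S P0).
  by apply: contractible_union => //; [apply: IHP; case: s|rewrite setIC].
have P0s : P0 \subset span S P0.
  apply/subsetP => p pP0; apply/spanP; split; last by exists p; rewrite ?smulxx.
  by move: pP0; rewrite inP0 in_up => /andP[/andP[]].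
have st : span S P0 \subset up S t.
  apply/subsetP => x /spanP[xS [p]]; rewrite inP0 in_up => /andP[/andP[_ /eqP tp] _] px.
  by rewrite in_up xS -px smulA tp /=.
have -> : up (flat Z) t = (P true :|: span S P0) :|: (P false :|: span S P0).
  rewrite setUACA setUid -/S; apply/setP => x; rewrite in_setU.
  apply/idP/orP => [|[|/(subsetP st)//]].
    by rewrite cover !in_setU -orbA => /orP[/(subsetP P0s)|->]; [right|left].
  by rewrite cover !in_setU -orbA => ->; rewrite orbT.
apply: contractible_union (half _) (half _) _; rewrite -setUIl.
suff -> : P true :&: P false = set0 by rewrite set0U.
by apply/setP => x; rewrite in_setI !inP !inE; case: (x H) => [[]|]; rewrite ?andbF.
Qed.

Lemma up_setI Z w H s : w H = None ->
  up (flat Z) w :&: up (flat Z) (assign szero H (Some s)) = up (flat Z) (assign w H (Some s)).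
Proof.
move=> wH; apply/setP => x; rewrite in_setI !up_assign ?ffunE // !in_up smul0 eqxx andbT.
by case: (x \in flat Z).
Qed.

(** The faces off [H] form two cones. Each of them meets a principal ideal of
    the smaller flat in a cone, so that joining both to every ideal in a
    derivation for [U] gives a derivation in the larger flat. *)
Lemma contractible_flatU1 Z H U : contractible (flat (H |: Z)) U ->
  contractible (flat Z) (U :|: (flat Z :\: flat (H |: Z))).
Proof.
set S := flat Z; set S0 := flat (H |: Z).
have SM : mul_closed smul S by apply: flatM.
have inS0 x : (x \in S0) = (x \in S) && (x H == None) by rewrite flat_setU1.
pose P s := up S (assign szero H (Some s)).
have inP s x : (x \in P s) = (x \in S) && (x H == Some s).
  by rewrite up_assign ?ffunE // in_up smul0 eqxx andbT.
have [SS0|/set0Pn[x]] := eqVneq (S :\: S0) set0.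
  rewrite SS0; suff -> : S = S0 by rewrite setU0.
  by apply/eqP; rewrite eqEsubset -setD_eq0 SS0 eqxx /=; apply/subsetP => x; rewrite inS0 => /andP[].
rewrite in_setD inS0 negb_and => /andP[/orP[/negP//|xH] xS].
have ex s : exists2 y, y \in S & y H = Some s.
  case xs: (x H) xH => [r|] // _; have [<-|rs] := eqVneq r s; first by exists x.
  by exists (sneg x); [apply: flatN|rewrite ffunE xs /=; case: (r) (s) rs => [] []].
have cPw w s : w H = None -> w \in S -> contractible S (up S w :&: P s).
  move=> wH wS; rewrite up_setI //; apply: contractible_cone.
  have [y yS yH] := ex s; apply/set0Pn; exists (smul w y).
  by rewrite up_assign // in_up SM //= smulA smulxx ffunE wH yH !eqxx.
have cP s : contractible S (P s).
  have := cPw szero s; suff -> : up S szero = S.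
    rewrite (setIidPr _); last by apply/subsetP => y; rewrite inP => /andP[].
    by apply; rewrite ?ffunE //; apply/flatP; split=> [|K _]; rewrite ?ffunE //; apply: covector0 BP.
  by apply/setP => y; rewrite in_up smul0 eqxx andbT.
have -> : S :\: S0 = P true :|: P false.
  apply/setP => y; rewrite in_setD in_setU inS0 !inP -andb_orr.
  by case: (y \in S) => //=; case: (y H) => [[]|].
elim=> [w|{}U V _ IU _ IV _ IUV].
  rewrite inS0 => /andP[wS /eqP wH].
  have -> : up S0 w :|: (P true :|: P false) = up S w :|: P true :|: P false.
    apply/setP => y; rewrite !in_setU !inP !in_up inS0.
    by case: (y \in S) => //=; case: (y H) => [[]|]; rewrite /= ?orbT ?orbF ?andbT.
  apply: contractible_union => //.
    by apply: contractible_union => //; [apply: contractible_up|apply: cPw].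
  suff -> : (up S w :|: P true) :&: P false = up S w :&: P false by apply: cPw.
  apply/setP => y; rewrite !in_setI in_setU !inP.
  by case: (y H) => [[]|]; rewrite ?andbF ?orbF.
set I := _ :|: P false.
have -> : U :|: V :|: I = (U :|: I) :|: (V :|: I) by rewrite setUACA setUid.
by apply: contractible_union => //; rewrite -setUIl.
Qed.

Lemma contractible_flat Z0 Z U : Z0 \subset Z -> contractible (flat Z) U ->
  contractible (flat Z0) (U :|: (flat Z0 :\: flat Z)).
Proof.
have [m] := ubnP #|Z :\: Z0|; elim: m => // m IH in Z U *; rewrite ltnS => Zm sub cU.
have [|/set0Pn[H HZ]] := boolP (Z :\: Z0 == set0).
  rewrite setD_eq0 => sub'; have -> : Z0 = Z by apply/eqP; rewrite eqEsubset sub.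
  by rewrite setDv setU0.
have ZE : Z = H |: (Z :\ H) by rewrite setD1K //; case/setDP: HZ.
set Z' := Z :\ H in ZE.
have {}sub : Z0 \subset Z'.
  rewrite subsetD1 sub /=; by case/setDP: HZ.
have := cU; rewrite {1}ZE => /contractible_flatU1 /(IH Z').
have -> : U :|: (flat Z' :\: flat (H |: Z')) :|: (flat Z0 :\: flat Z') = U :|: (flat Z0 :\: flat Z).
  apply/setP => x; rewrite !in_setU !in_setD -ZE.
  have sub1 : (x \in flat Z) -> (x \in flat Z') by rewrite ZE flat_setU1 => /andP[].
  have sub2 : (x \in flat Z') -> (x \in flat Z0).
    by move=> /flatP[xB xZ]; apply/flatP; split=> // K /(subsetP sub)/xZ.
  case: (x \in U) => //=; case: (x \in flat Z) sub1 => [/(_ isT) x1|_].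
    by rewrite x1.
  by case: (x \in flat Z') sub2 => [/(_ isT) ->|].
apply=> //; apply: leq_trans Zm; apply: proper_card; apply/properP; split.
  by apply/subsetP => K; rewrite !inE => /andP[-> /andP[]].
by exists H; rewrite // !inE eqxx andbF.
Qed.

End Covectors.
End SignVectors.

(** * Bimodules of functions *)

Section FunctionModules.
Variables (k : fieldType) (T : finType) (mul : T -> T -> T).
Local Notation F := {ffun T -> k^o}.
Implicit Types (P Q S U V W : {set T}) (g : T -> option T) (v : F).

Fact supported0 P : forall x, x \notin P -> (0 : F) x = 0.
Proof. by move=> x _; rewrite ffunE. Qed.
Fact supportedP P (a : k) (v w : F) : (forall x, x \notin P -> v x = 0) ->
  (forall x, x \notin P -> w x = 0) -> forall x, x \notin P -> (a *: v + w) x = 0.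
Proof. by move=> v0 w0 x xP; rewrite !ffunE v0 // w0 // scaler0 addr0. Qed.
Definition supported P : submodule F := Submodule (@supported0 P) (@supportedP P).

(** A partial map acts on functions by composition and by summation over its
    fibres; the actions of all the bimodules below are of one of these kinds. *)
Definition pull_fun g v : F := [ffun x => if g x is Some y then v y else 0].
Definition push_fun g v : F := [ffun y => \sum_(x | g x == Some y) v x].

Fact pull_linear g : linear (pull_fun g).
Proof.
move=> a v w; apply/ffunP => x; rewrite !ffunE; case: (g x) => [y|]; rewrite ?ffunE //.
by rewrite scaler0 addr0.
Qed.
HB.instance Definition _ g := GRing.isLinear.Build k F F _ (pull_fun g) (pull_linear g).

Fact push_linear g : linear (push_fun g).
Proof.
move=> a v w; apply/ffunP => x; rewrite !ffunE scaler_sumr -big_split /=.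
by apply: eq_bigr => y _; rewrite !ffunE.
Qed.
HB.instance Definition _ g := GRing.isLinear.Build k F F _ (push_fun g) (push_linear g).

Definition pull g : {linear F -> F} := pull_fun g.
Definition push g : {linear F -> F} := push_fun g.

Lemma pull_pull g h v : pull g (pull h v) = pull (fun x => obind h (g x)) v.
Proof. by apply/ffunP => x; rewrite !ffunE; case: (g x) => [y|] //=; rewrite ffunE. Qed.

Lemma push_push g h v : push g (push h v) = push (fun x => obind g (h x)) v.
Proof.
apply/ffunP => x; rewrite !ffunE; under eq_bigr do rewrite ffunE.
rewrite (exchange_big_dep xpredT) //= [RHS]big_mkcond /=; apply: eq_bigr => z _.
case hz: (h z) => [y|] /=; last by rewrite big1 // => y /andP[].
case: eqP => [gy|gy].
  rewrite (bigD1 y) /= ?gy ?eqxx // big1 ?addr0 // => y' /andP[/andP[_ /eqP[->]]].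
  by rewrite eqxx.
by rewrite big1 // => y' /andP[/eqP gy' /eqP[e]]; rewrite e in gy.
Qed.

Lemma eq_pull g h v : g =1 h -> pull g v = pull h v.
Proof. by move=> e; apply/ffunP => x; rewrite !ffunE e. Qed.
Lemma eq_push g h v : g =1 h -> push g v = push h v.
Proof. by move=> e; apply/ffunP => x; rewrite !ffunE; apply: eq_bigl => y; rewrite e. Qed.

(** Products that leave [P] count as zero. *)
Definition within P (h : T -> T) x := if (x \in P) && (h x \in P) then Some (h x) else None.

Definition pull_mod P (l r : T -> T -> option T) : bimodule k T :=
  Bimodule (supported P) (fun b => pull (l b)) (fun b => pull (r b)).
Definition push_mod P (l r : T -> T -> option T) : bimodule k T :=
  Bimodule (supported P) (fun b => push (l b)) (fun b => push (r b)).

Definition restr P : {linear F -> F} := pull (within P id).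

Lemma restrE P v x : restr P v x = if x \in P then v x else 0.
Proof. by rewrite ffunE /within andbb; case: ifP. Qed.

Lemma restr_id P v : supported P v -> restr P v = v.
Proof.
by move=> v0; apply/ffunP => x; rewrite restrE; case: ifPn => // /v0.
Qed.

Lemma supportedS P Q v : P \subset Q -> supported P v -> supported Q v.
Proof. by move=> PQ v0 x xQ; apply: v0; apply: contra xQ; apply: subsetP. Qed.

Lemma short_exact_restr S P Q (lL rL lM rM lN rN : T -> {linear F -> F}) :
  Q \subset P ->
  (forall b v, b \in S -> supported (P :\: Q) v -> lL b v = lM b v) ->
  (forall b v, b \in S -> supported (P :\: Q) v -> rL b v = rM b v) ->
  (forall b v, b \in S -> supported P v -> restr Q (lM b v) = lN b (restr Q v)) ->
  (forall b v, b \in S -> supported P v -> restr Q (rM b v) = rN b (restr Q v)) ->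
  short_exact S (L := Bimodule (supported (P :\: Q)) lL rL)
    (M := Bimodule (supported P) lM rM) (N := Bimodule (supported Q) lN rN)
    (idfun : {linear F -> F}) (restr Q).
Proof.
move=> QP hlL hrL hlN hrN; split=> //=.
- by move=> v; apply: supportedS; apply: subsetDl.
- by move=> v _ x xQ; rewrite restrE (negPf xQ).
- move=> w w0; exists w; first exact: supportedS QP w0.
  exact: restr_id.
- by move=> v v0; apply/ffunP => x; rewrite restrE !ffunE; case: ifP => // xQ; rewrite v0 // inE xQ.
- move=> v v0 /ffunP vQ; exists v => // x; rewrite in_setD negb_and negbK => /orP[xQ|/v0//].
  by have := vQ x; rewrite restrE xQ ffunE.
Qed.

(** ** Functions on the differences of two right ideals *)

Section RightIdeals.
Variable S : {set T}.

(** When [P] is a difference of right ideals, these are the functions on the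
    larger ideal that vanish on the smaller one. The letters act on the left by
    translation and trivially on the right, whence the cohomology computed here
    is that of the semigroup with values in functions on [P]. *)
Definition ideal_mod P := pull_mod P (fun b => within P (fun x => mul x b)) (fun b => within P id).

Hypothesis mulA : associative mul.
Hypothesis SM : mul_closed mul S.

Lemma pull_dom P h v : supported P (pull (within P h) v).
Proof. by move=> x xP; rewrite ffunE /within (negPf xP). Qed.

Lemma ideal_mod_over (U V : {set T}) : right_ideal mul S U -> right_ideal mul S V ->
  bimodule_over mul S (ideal_mod (V :\: U)).
Proof.
move=> [US UM] [VS VM]; set P := V :\: U.
have conv x b c : x \in P -> b \in S -> c \in S -> mul x (mul b c) \in P -> mul x b \in P.
  rewrite !in_setD => /andP[_ xV] bS cS /andP[xbc _]; rewrite VM // andbT.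
  by apply: contra xbc => xb; rewrite mulA; apply: UM.
split=> //=.
- by move=> b v bS vP; apply: pull_dom.
- by move=> b v bS vP; apply: pull_dom.
- move=> b c v bS cS vP; rewrite pull_pull; apply: eq_pull => x; rewrite /within.
  case xP: (x \in P) => //=; case xbP: (mul x b \in P) => /=.
    by rewrite xbP mulA.
  by case: ifP => // /(conv _ _ _ xP bS cS); rewrite xbP.
- move=> b c v bS cS vP; rewrite pull_pull; apply: eq_pull => x; rewrite /within andbb.
  by case: ifP => //= xP; rewrite xP.
- move=> b c v bS cS vP; rewrite !pull_pull; apply: eq_pull => x; rewrite /within andbb.
  case: ifP => /= [/andP[xP xb]|nP]; rewrite ?xb ?xP /= ?xP ?xb //.
  by case: ifP => //= xP; rewrite nP.
Qed.

Lemma setDDD (U V W : {set T}) : U \subset V -> (W :\: U) :\: (V :\: U) = W :\: V.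
Proof.
move=> UV; apply/setP => x; rewrite !in_setD.
by case xU: (x \in U) => //=; rewrite (subsetP UV).
Qed.

Lemma short_exact_ideals (U V W : {set T}) : right_ideal mul S U -> right_ideal mul S V -> right_ideal mul S W ->
  U \subset V -> V \subset W ->
  short_exact S (L := ideal_mod ((W :\: U) :\: (V :\: U))) (M := ideal_mod (W :\: U)) (N := ideal_mod (V :\: U))
    (idfun : {linear F -> F}) (restr (V :\: U)).
Proof.
move=> [US UM] [VS VM] [WS WM] UV VW.
have idP P Q v : Q \subset P -> supported Q v -> pull (within Q id) v = pull (within P id) v.
  move=> QP v0; rewrite -!/(restr _) !restr_id //; exact: supportedS v0.
apply: short_exact_restr => /=; first exact: setSD.
- move=> b v bS; rewrite (setDDD W UV) => v0; apply/ffunP => x; rewrite !ffunE /within.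
  case xbV: (mul x b \in W :\: V); last first.
    by rewrite andbF; case: ifP => // _; rewrite v0 // xbV.
  move: xbV; rewrite !in_setD => /andP[xbV xbW]; rewrite xbW.
  have -> : mul x b \notin U by apply: contra xbV; apply: (subsetP UV).
  rewrite !andbT; case xV: (x \in V); first by rewrite VM in xbV.
  by case xU: (x \in U) => //; rewrite (subsetP UV) in xV.
- by move=> b v bS v0; apply: idP => //; apply: subsetDl.
- move=> b v bS v0; apply/ffunP => x; rewrite restrE !ffunE /within.
  case xQ: (x \in V :\: U) => //=.
  move: xQ; rewrite in_setD => /andP[xU xV].
  rewrite !in_setD xU (subsetP VW x xV) VM // (subsetP VW _ (VM x b xV bS)) /= !andbT.
  by case: ifP => // xb; rewrite restrE in_setD xb VM.
- move=> b v bS v0; rewrite -!/(restr _) (restr_id v0) [RHS]restr_id //.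
  by move=> x xQ; rewrite restrE (negPf xQ).
Qed.
End RightIdeals.

End FunctionModules.

(** * Contractible ideals have acyclic complements *)

Section Coinduction.
Variables (k : fieldType) (E : finType).
Local Notation signs := (signs E).
Local Notation smul := (@smul E).
Local Notation F := {ffun signs -> k^o}.
Variable S : {set signs}.
Hypothesis S0 : szero E \in S.
Hypothesis SM : mul_closed smul S.
Implicit Types (U V W P : {set signs}) (w x b : signs).
Local Notation mod P := (ideal_mod k smul P).

Lemma S_ideal : right_ideal smul S S.
Proof. by split=> // x b xS bS; apply: SM. Qed.

Section Principal.
Variable w : signs.
Hypothesis wS : w \in S.
Local Notation P := (S :\: up S w).

(** All functions on [S] form a coinduced module: the action of [x] moves
    the value at [x] to the value at 1, and appending [x] to a word contracts
    the complex. The functions that vanish on [w S] are the image of the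
    projection [v |-> v - v (w _)], which is the second term. *)
Definition coinduce (f : seq signs -> mod P) (t : seq signs) : mod P :=
  [ffun x => if x \in S then f (rcons t x) (szero E) - f (rcons t (smul w x)) (szero E) else 0].

Lemma coinduce_dom f t : supported k P (coinduce f t).
Proof.
move=> x; rewrite in_setD in_up ffunE; case: (x \in S) => //=; rewrite andbT negbK.
by move=> /eqP ->; rewrite subrr.
Qed.

Let P_zero x : x \in P -> szero E \in P.
Proof.
rewrite !in_setD !in_up S0 /= andbT smulr0 => /andP[nx xS].
by apply: contra nx => /eqP ->; rewrite xS smul0 eqxx.
Qed.

Let P_mul x b : x \in S -> b \in S -> smul x b \in P -> x \in P.
Proof.
move=> xS bS; rewrite !in_setD !in_up xS SM //= !andbT.
by apply: contra => /eqP {2}<-; rewrite smulA.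
Qed.

Let lact_zero x (v : mod P) : x \in S -> supported k P v -> lact (mod P) x v (szero E) = v x.
Proof.
move=> xS v0; rewrite ffunE /within smul0.
case xP: (x \in P); first by rewrite (P_zero xP).
by rewrite andbF v0 // xP.
Qed.

Let wP x : smul w x \notin P.
Proof. by rewrite in_setD in_up smulA smulxx eqxx andbT; case: (_ \in S). Qed.

Local Notation val v := (v : F).

Let ffun_sub (v v' : F) x : (v - v') x = v x - v' x.
Proof. by rewrite !ffunE. Qed.

Let lact_coinduce f t b x : x \in S -> b \in S ->
  lact (mod P) b (coinduce f t) x = val (coinduce f t) (smul x b).
Proof.
move=> xS bS; rewrite [LHS]ffunE /within.
case xbP: (smul x b \in P); first by rewrite (P_mul xS bS xbP).
by rewrite andbF coinduce_dom ?xbP.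
Qed.

Lemma absorb_coinduce f b t x : cochain S f -> b \in S -> words S t -> x \in S ->
  val (absorb (M := mod P) smul f b (rcons t x)) (szero E)
    - val (absorb (M := mod P) smul f b (rcons t (smul w x))) (szero E)
  = val (absorb (M := mod P) smul (coinduce f) b t) x + (-1) ^+ (size t).+1 * val (f (b :: t)) x.
Proof.
elim: t f b => [|c t IH] f b fW bS /=.
  move=> _ xS; have fb : supported k P (f [:: b]) by apply: fW; rewrite /= bS.
  have := lact_zero xS fb; have := lact_zero (SM wS xS) fb; rewrite /= => e1 e2.
  rewrite !ffun_sub e1 e2 lact_coinduce // ffunE SM // expr1 mulN1r smulA.
  by rewrite (fb (smul w x)) // subr0 addrAC.
move=> /andP[cS tS] xS; rewrite !ffun_sub opprD addrACA -opprD.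
have fbW : cochain S (fun s => f (b :: s)) by apply: cochain_shift.
rewrite IH // opprD addrA; congr (_ - _ + _).
  by rewrite [in RHS]ffunE xS.
by rewrite [in RHS]exprS mulN1r mulNr.
Qed.

Lemma exact_principal : exact smul predT S (mod P).
Proof.
move=> f [fW f0].
have sW : cochain S (coinduce f) by move=> t tS; apply: coinduce_dom.
have key b t : b \in S -> words S t ->
    codiff (M := mod P) smul (coinduce f) (b :: t) = (-1) ^+ (size t).+1 *: f (b :: t).
  move=> bS tS; apply/ffunP => x.
  have sP : supported k P (codiff (M := mod P) smul (coinduce f) (b :: t)).
    have MP := ideal_mod_over k (@smulA E) (up_ideal w SM) S_ideal.
    by have := codiff_dom SM MP sW (s := b :: t); apply; rewrite /= bS.
  have fP : supported k P (f (b :: t)) by apply: fW; rewrite /= bS.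
  rewrite [RHS]ffunE; have [xP|xP] := boolP (x \in P); last by rewrite sP // fP // scaler0.
  have xS : x \in S by case/setDP: xP.
  have bt y : y \in S -> words S (rcons (b :: t) y) by move=> yS; rewrite /words all_rcons /= yS bS.
  have := absorb_coinduce fW bS tS xS.
  have e y : y \in S -> val (absorb (M := mod P) smul f b (rcons t y)) (szero E) = val (f (rcons t y)) (szero E).
    move=> yS; have /ffunP/(_ (szero E)) := f0 _ (bt y yS).
    rewrite /= ffun_sub [RHS]ffunE => /eqP; rewrite subr_eq0 => /eqP <-.
    by rewrite -/(restr k P) restr_id //; apply: fW; move: (bt y yS) => /= /andP[].
  rewrite !e ?SM // => eq0.
  rewrite /= ffun_sub -/(restr k P) restr_id; last exact: coinduce_dom.
  by rewrite [X in X - _]ffunE xS eq0 addrC addKr.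
exists (fun t => (-1) ^+ (size t).+1 *: coinduce f t) => [t tS|[|b t] /=].
- by apply: domZ; apply: sW.
- move=> _ _; apply/ffunP => x; rewrite ffunE.
  have fP : supported k P (f [::]) by apply: fW.
  have e y : y \in S -> val (f [::]) y = val (f [::]) (szero E).
    move=> yS; have := f0 [:: y]; rewrite /= yS => /(_ isT) /ffunP /(_ (szero E)).
    rewrite ffun_sub [RHS]ffunE => /eqP; rewrite subr_eq0 => /eqP.
    by rewrite -/(restr k P) restr_id // => ->; rewrite lact_zero.
  have [xP|/fP//] := boolP (x \in P); have xS : x \in S by case/setDP: xP.
  by rewrite e // -(e w) // fP // in_setD in_up wS smulxx eqxx.
move=> /andP[bS tS] _.
rewrite -/(codiff smul (fun t => (-1) ^+ (size t).+1 *: coinduce f t) (b :: t)).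
rewrite (codiff_scale smul (fun n => (-1) ^+ n.+1)) key // scalerA -exprMn.
by rewrite mulrNN mulr1 expr1n scale1r.
Qed.
End Principal.

Lemma exact_diff U V : right_ideal smul S U -> right_ideal smul S V -> U \subset V ->
  exact smul predT S (mod (S :\: U)) -> exact smul predT S (mod (S :\: V)) ->
  exact smul predT S (mod (V :\: U)).
Proof.
move=> iU iV UV xU xV.
have over A B := ideal_mod_over k (@smulA E) (S := S) (U := A) (V := B).
apply: (exact_quo (@smulA E) SM _ (over _ _ iU S_ideal)
    (short_exact_ideals k iU iV S_ideal UV (proj1 iV)) _ xU).
  by rewrite (setDDD _ UV); apply: over S_ideal.
by rewrite (setDDD _ UV).
Qed.

(** A union is treated by excision of sets, since [U :|: V] minus [U] equals [V]
    minus [U :&: V]; exactness passes from [V] and the intersection to this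
    difference, and from there and [U] to the union. *)
Lemma contractible_exact U : contractible S U -> exact smul predT S (mod (S :\: U)).
Proof.
elim=> [w wS|{}U V Uc IU Vc IV UVc IUV]; first exact: exact_principal.
have id0 U' := contractible_ideal SM (U := U').
have [iU iV iUV] := And3 (id0 _ Uc) (id0 _ Vc) (id0 _ UVc).
have exV := exact_diff iUV iV (subsetIr _ _) IUV IV.
have iUuV := right_idealU iU iV.
have ex := short_exact_ideals k iU iUuV S_ideal (subsetUl _ _) (proj1 iUuV).
have := exact_sub (@smulA E) SM _ (ideal_mod_over k (@smulA E) iU S_ideal) ex IU.
rewrite (setDDD _ (subsetUl _ _)); apply; first exact: (ideal_mod_over k (@smulA E) iUuV S_ideal).
suff -> : (U :|: V) :\: U = V :\: (U :&: V) by [].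
by rewrite setDUl setDv set0U setDIr setDv setU0.
Qed.
End Coinduction.

(** * Chambers *)

Section Chambers.
Variables (k : fieldType) (E : finType) (B : {set signs E}).
Hypothesis BP : covectors B.
Variable Z0 : {set E}.
Local Notation signs := (signs E).
Local Notation smul := (@smul E).
Local Notation flat := (flat B).
Local Notation F := {ffun signs -> k^o}.
Local Notation S := (flat Z0).
Implicit Types (x y b t w : signs) (H K : E) (Z A : {set E}) (P : {set signs}) (v : F).

Definition cut A x : signs := [ffun K => if K \in A then x K else None].

(** The regions into which the hyperplanes of [A] divide the flat of [Z], each
    given by its signs on [A]. *)
Definition chambers Z A : {set signs} :=
  cut A @: [set x in flat Z | [forall K in A, x K != None]].

Lemma chambersP Z A t :
  reflect (exists2 x, x \in flat Z & (forall K, K \in A -> x K != None) /\ cut A x = t)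
          (t \in chambers Z A).
Proof.
apply: (iffP imsetP) => [[x]|[x xZ [xA <-]]].
  by rewrite in_set => /andP[xZ /forall_inP xA] ->; exists x.
by exists x => //; rewrite in_set xZ; apply/forall_inP.
Qed.

Lemma chambers_sign Z A t K : t \in chambers Z A -> (t K != None) = (K \in A).
Proof.
by move=> /chambersP[x _ [xA <-]]; rewrite ffunE; case: ifP => // /xA ->.
Qed.

Lemma chambersM Z A b t : b \in flat Z -> t \in chambers Z A ->
  cut A (smul b t) \in chambers Z A.
Proof.
move=> bZ /chambersP[x xZ [xA <-]]; apply/chambersP; exists (smul b x).
  exact: (flatM BP).
split=> [K /xA|]; first by rewrite ffunE; case: (b K).
by apply/ffunP => K; rewrite !ffunE; case: ifP => // ->.
Qed.

(** The product with a covector off the flat of [Z] is not a region of this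
    flat and counts as zero. *)
Definition chamber_act Z A b t :=
  if (b \in flat Z) && (t \in chambers Z A) then Some (cut A (smul b t)) else None.

Definition chamber_mod Z A : bimodule k signs :=
  push_mod k (chambers Z A) (chamber_act Z A) (fun=> within (chambers Z A) id).

Lemma push_dom P (g : signs -> option signs) v : (forall x y, g x = Some y -> y \in P) ->
  supported k P (push k g v).
Proof.
move=> gP y yP; rewrite ffunE big_pred0 // => x.
by apply/negP => /eqP /gP; rewrite (negPf yP).
Qed.

Lemma push_restr P v : supported k P v -> push k (within P id) v = v.
Proof.
move=> v0; apply/ffunP => y; rewrite ffunE /within.
have [yP|yP] := boolP (y \in P); last first.
  rewrite v0 // big1 // => x; rewrite andbb; case: ifP => // xP /eqP[e].
  by rewrite -e xP in yP.
rewrite (bigD1 y) /= ?yP // big1 ?addr0 // => x.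
by rewrite andbb; case: ifP => // _ /andP[/eqP[->]]; rewrite eqxx.
Qed.

Lemma flat_smul b c Z : b \in B -> c \in B ->
  (smul b c \in flat Z) = (b \in flat Z) && (c \in flat Z).
Proof.
move=> bB cB; apply/idP/andP => [/flatP[_ bcZ]|[bZ cZ]]; last exact: (flatM BP).
by split; apply/flatP; split=> // K /bcZ; rewrite ffunE; case: (b K).
Qed.

Let SB b : b \in S -> b \in B. Proof. by case/flatP. Qed.

Lemma chamber_mod_over Z A : bimodule_over smul S (chamber_mod Z A).
Proof.
set C := chambers Z A.
have idC v : supported k C v -> forall b, ract (chamber_mod Z A) b v = v.
  by move=> v0 b; apply: push_restr.
have lC b v : supported k C (lact (chamber_mod Z A) b v).
  apply: push_dom => x y; rewrite /chamber_act; case: ifP => // /andP[bZ xC] [<-].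
  exact: chambersM.
split.
- by [].
- by move=> b v bS vC; rewrite idC.
- move=> b c v bS cS vC; rewrite [LHS]push_push; apply: eq_push => t.
  rewrite /chamber_act flat_smul ?SB //; case bZ: (b \in flat Z) => /=; last by case: ifP.
  case cZ: (c \in flat Z) => //=; case tC: (t \in chambers Z A) => //=.
  rewrite chambersM //=; congr Some; apply/ffunP => K; rewrite !ffunE.
  by case: (K \in A); case: (b K).
- by move=> b c v bS cS vC; rewrite !idC.
- by move=> b c v bS cS vC; rewrite (idC v) // idC.
Qed.

(** ** Deletion and restriction *)

Section Deletion.
Variables (Z A : {set E}) (H : E) (y0 : signs).
Hypotheses (HA : H \in A) (y0Z : y0 \in flat Z) (y0H : y0 H != None).
Local Notation A' := (A :\ H).
Local Notation C := (chambers Z A).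
Local Notation C0 := (chambers (H |: Z) A').
Local Notation C1 := (chambers Z A').

Lemma both_signs s : exists2 y, y \in flat Z & y H = Some s.
Proof.
case ys: (y0 H) y0H => [r|] // _; have [<-|rs] := eqVneq r s; first by exists y0.
by exists (sneg y0); [apply: (flatN BP)|rewrite ffunE ys /=; case: (r) (s) rs => [] []].
Qed.

Let HZ : H \notin Z.
Proof. by apply: contraNN y0H => HZ; case/flatP: y0Z => _ ->. Qed.

Lemma cut_assign t a : cut A' t = t -> cut A' (assign t H a) = t.
Proof.
by move=> tA; rewrite -[RHS]tA; apply/ffunP => K; rewrite !ffunE in_setD1; case: eqP.
Qed.

Lemma assign_cut t : t \in C -> assign (cut A' t) H (t H) = t.
Proof.
move=> tC; apply/ffunP => K; rewrite !ffunE !in_setD1; case: eqP => [->//|_ /=].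
by have := chambers_sign K tC; case: (K \in A) => //; case: (t K).
Qed.

Lemma assign_chamber t s : t \in C0 -> assign t H (Some s) \in C.
Proof.
move=> /chambersP[x]; rewrite flat_setU1 => /andP[xZ /eqP xH] [xA <-].
have [y yZ yH] := both_signs s; apply/chambersP; exists (smul x y).
  exact: (flatM BP).
split=> [K KA|].
  have [->|KH] := eqVneq K H; first by rewrite ffunE xH yH.
  by rewrite ffunE; case: (x K) (xA K) => // /(_ _)/negP; rewrite in_setD1 KH KA => /(_ isT).
apply/ffunP => K; rewrite !ffunE in_setD1; have [->|KH] /= := eqVneq K H.
  by rewrite HA xH yH.
case KA: (K \in A) => //; case: (x K) (xA K) => //; by rewrite in_setD1 KH KA => /(_ isT).
Qed.

Lemma cut_chamber t : t \in C -> cut A' t \in C1.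
Proof.
move=> /chambersP[x xZ [xA <-]]; apply/chambersP; exists x => //; split.
  by move=> K /setD1P[_ /xA].
by apply/ffunP => K; rewrite !ffunE in_setD1; case: eqP => //= _; case: (K \in A).
Qed.

(** If a region of the smaller arrangement has points on both sides of [H], it
    has points on [H]: this is covector elimination. *)
Lemma elim_chamber t : assign t H (Some true) \in C -> assign t H (Some false) \in C ->
  cut A' t \in C0.
Proof.
move=> /chambersP[x xZ [xA xt]] /chambersP[y yZ [yA yt]].
have xH : x H = Some true by move/ffunP/(_ H): xt; rewrite !ffunE eqxx HA.
have yH : y H = Some false by move/ffunP/(_ H): yt; rewrite !ffunE eqxx HA.
have [z zZ zE] := flat_elim BP xZ yZ xH yH.
have xyK K : K \in A' -> x K = t K /\ y K = t K.
  rewrite in_setD1 => /andP[KH KA].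
  by move/ffunP/(_ K): xt; move/ffunP/(_ K): yt; rewrite !ffunE KA (negPf KH) => -> ->.
have zK K : K \in A' -> z K = t K /\ t K != None.
  move=> KA; have [xK yK] := xyK K KA.
  have tK : t K != None by rewrite -xK xA //; case/setD1P: KA.
  split=> //; rewrite zE ?ffunE xK ?yK; first by case: (t K).
  by case: (t K) => // a; rewrite /opposite eqxx.
apply/chambersP; exists z => //; split=> [K /zK[-> //]|].
by apply/ffunP => K; rewrite !ffunE; case: ifP => // /zK[->].
Qed.

(** The wall of [H] lies between two regions, and their difference is the image
    of the wall; forgetting [H] identifies the two regions. *)
Definition side s t := if t \in C0 then Some (assign t H (Some s)) else None.
Definition forget t := if t \in C then Some (cut A' t) else None.
Definition wall : {linear F -> F} := push k (side true) \- push k (side false).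

Let cut_id Z1 A1 t : t \in chambers Z1 A1 -> cut A1 t = t.
Proof.
by move=> /chambersP[x _ [_ <-]]; apply/ffunP => K; rewrite !ffunE; case: ifP => // ->.
Qed.

Let assign_inj t s s' : assign t H (Some s) = assign t H (Some s') -> s = s'.
Proof. by move/ffunP/(_ H); rewrite !ffunE eqxx => -[]. Qed.

Lemma push_side s v t : supported k C0 v ->
  push k (side s) v t = if t == assign (cut A' t) H (Some s) then v (cut A' t) else 0.
Proof.
move=> v0; rewrite ffunE /side.
have sP u : (if u \in C0 then Some (assign u H (Some s)) else None) == Some t ->
    [/\ u \in C0, cut A' t = u & t = assign (cut A' t) H (Some s)].
  by case: ifP => // uC /eqP[<-]; rewrite cut_assign ?(cut_id uC).
case: eqP => [et|nt]; last by rewrite big_pred0 // => u; apply/negP => /sP[_ _ /nt].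
have [tC|tC] := boolP (cut A' t \in C0); last first.
  rewrite v0 // big_pred0 // => u; apply/negP => /sP[uC tu _].
  by rewrite tu uC in tC.
rewrite (bigD1 (cut A' t)) /= ?tC -?et ?eqxx // big1 ?addr0 // => u /andP[/sP[_ -> _]].
by rewrite eqxx.
Qed.

Lemma push_forget v t : supported k C v -> cut A' t = t ->
  push k forget v t = v (assign t H (Some true)) + v (assign t H (Some false)).
Proof.
move=> v0 tA; rewrite ffunE; set tp := assign t H _; set tm := assign t H _.
have tpm : tp \notin [set tm] by rewrite in_set1; apply/eqP => /assign_inj.
have -> : v tp + v tm = \sum_(u in tp |: [set tm]) v u by rewrite big_setU1 //= big_set1.
rewrite [LHS]big_mkcond [RHS]big_mkcond /=; apply: eq_bigr => u _; rewrite /forget.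
have [uC|/v0->] := boolP (u \in C); last by rewrite !if_same.
have -> // : (Some (cut A' u) == Some t) = (u \in tp |: [set tm]).
apply/eqP/idP => [[ut]|].
  rewrite -(assign_cut uC) ut !inE; have := chambers_sign H uC; rewrite HA.
  by case: (u H) => [[]|] // _; rewrite eqxx ?orbT.
by rewrite !inE => /orP[] /eqP ->; rewrite cut_assign.
Qed.

Let wallC v : supported k C (wall v).
Proof.
have h s : supported k C (push k (side s) v).
  by apply: push_dom => x y; rewrite /side; case: ifP => // xC [<-]; apply: assign_chamber.
by move=> x xC; rewrite ffunE [X in _ + X]ffunE !h // subrr.
Qed.

Let dropC v : supported k C1 (push k forget v).
Proof.
by apply: push_dom => x y; rewrite /forget; case: ifP => // xC [<-]; apply: cut_chamber.
Qed.

Let sub_at v1 v2 t : (v1 - v2) t = v1 t - v2 t.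
Proof. by rewrite !ffunE. Qed.

Let wall_sub v : wall v = push k (side true) v - push k (side false) v.
Proof. by []. Qed.

(** A region of the arrangement without [H] is either a region of the full one,
    or it is divided by a wall into two regions. Hence the regions modulo the
    differences across walls are the regions without [H]. A letter that is
    nonzero on [H] kills the wall, and it moves both of its sides to one. *)
Lemma wall_exact :
  short_exact S (L := chamber_mod (H |: Z) A') (M := chamber_mod Z A) (N := chamber_mod Z A')
    wall (push k forget).
Proof.
have ractE Z1 A1 b v : supported k (chambers Z1 A1) v -> ract (chamber_mod Z1 A1) b v = v.
  by move=> v0; apply: push_restr.
split.
- by move=> v _; apply: wallC.
- move=> b v bS v0.
  change (wall (push k (chamber_act (H |: Z) A' b) v) = push k (chamber_act Z A b) (wall v)).
  rewrite !wall_sub linearB !push_push.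
  have [bH|bH] := eqVneq (b H) None.
    congr (_ - _); apply: eq_push => t; rewrite /side /chamber_act flat_setU1 bH eqxx andbT;
    (case tC: (t \in C0); last by rewrite andbF);
    rewrite andbT /= assign_chamber // andbT; case bZ: (b \in flat Z) => //=;
    rewrite chambersM // ?flat_setU1 ?bZ ?bH //; congr Some; apply/ffunP => K;
    rewrite !ffunE in_setD1; case: eqP => [->|_ /=]; by rewrite ?HA ?bH ?eqxx.
  have off (g : signs -> option signs) : (fun t => obind g (chamber_act (H |: Z) A' b t)) =1 (fun=> None).
    by move=> t; rewrite /chamber_act flat_setU1 (negPf bH) andbF.
  rewrite !(eq_push _ (off _)) subrr; apply/esym/eqP; rewrite subr_eq0; apply/eqP.
  apply: eq_push => t; rewrite /side; case tC: (t \in C0) => //=.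
  rewrite /chamber_act !assign_chamber //; case: (b \in flat Z) => //=.
  congr Some; apply/ffunP => K; rewrite !ffunE; case: (K \in A) => //.
  by have [->|//] := eqVneq K H; case: (b H) bH.
- by move=> b v bS v0; rewrite !ractE.
- move=> v v0 wv; apply/ffunP => t; rewrite ffunE.
  have [tC|/v0//] := boolP (t \in C0).
  have /ffunP/(_ (assign t H (Some true))) := wv.
  rewrite wall_sub sub_at !push_side // cut_assign ?(cut_id tC) // eqxx ffunE.
  by case: eqP => [/assign_inj//|_]; rewrite subr0.
- by move=> v _; apply: dropC.
- move=> b v bS v0.
  change (push k forget (push k (chamber_act Z A b) v) = push k (chamber_act Z A' b) (push k forget v)).
  rewrite !push_push; apply: eq_push => t; rewrite /forget /chamber_act.
  case tC: (t \in C); last by rewrite andbF.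
  case bZ: (b \in flat Z) => //=; rewrite chambersM // cut_chamber //=.
  congr Some; apply/ffunP => K; rewrite !ffunE in_setD1.
  by case: eqP => //= _; case: (K \in A).
- by move=> b v bS v0; rewrite !ractE.
- move=> w w0.
  pose lift t := if assign t H (Some true) \in C then assign t H (Some true)
                 else assign t H (Some false).
  have liftC t : t \in C1 -> lift t \in C /\ cut A' (lift t) = t.
    move=> tC; split; last by rewrite /lift; case: ifP => _; rewrite cut_assign ?(cut_id tC).
    rewrite /lift; case: ifPn => // tp; case/chambersP: tC => x xZ [xA tE].
    have [y yZ yH] := both_signs true.
    have xyC : cut A (smul x y) \in C.
      apply/chambersP; exists (smul x y); first exact: (flatM BP).
      split=> // K KA; rewrite ffunE; have [->|KH] := eqVneq K H; first by rewrite yH; case: (x H).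
      by have := xA K; rewrite in_setD1 KH KA => /(_ isT); case: (x K).
    have cxy : cut A' (cut A (smul x y)) = t.
      rewrite -tE; apply/ffunP => K; rewrite !ffunE; case KA: (K \in A') => //.
      by have := xA K KA; case/setD1P: KA => _ ->; case: (x K).
    move: (assign_cut xyC); rewrite cxy.
    have := chambers_sign H xyC; rewrite HA; case: (cut A _ H) => [[]|] // _ e.
      by rewrite e xyC in tp.
    by rewrite e.
  exists (push k (fun t => if t \in C1 then Some (lift t) else None) w).
    by apply: push_dom => x y; case: ifP => // /liftC[xC _] [<-].
  rewrite push_push -[RHS](push_restr w0); apply: eq_push => t.
  rewrite /within andbb; case: ifP => // /liftC[tC tE] /=.
  by rewrite /forget tC tE.
- move=> v v0; change (push k forget (wall v) = 0).
  rewrite wall_sub linearB !push_push; apply/eqP; rewrite subr_eq0; apply/eqP.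
  apply: eq_push => t; rewrite /side; case tC: (t \in C0) => //=.
  by rewrite /forget !assign_chamber //= !cut_assign ?(cut_id tC).
- move=> v v0 dv.
  pose u : F := [ffun t => if t \in C0 then v (assign t H (Some true)) else 0].
  have u0 : supported k C0 u by move=> t /negPf tC; rewrite ffunE tC.
  exists u => //; apply/ffunP => t.
  have [tC|tC] := boolP (t \in C); last by rewrite (wallC u tC) v0.
  set s := cut A' t.
  have sA : cut A' s = s by apply: cut_id (cut_chamber tC).
  have vs : v (assign s H (Some true)) + v (assign s H (Some false)) = 0.
    by rewrite -push_forget // dv ffunE.
  have us : u s = v (assign s H (Some true)).
    rewrite ffunE; case: ifPn => // sC; apply/esym/eqP; apply: contraNT sC => vp.
    rewrite -sA; apply: elim_chamber; first by apply: contraR vp => /v0 ->.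
    apply: contraR vp => /v0 vm; move: vs; rewrite vm addr0 => ->; exact: eqxx.
  change (wall u t = v t); rewrite wall_sub sub_at !push_side // -/s us.
  have := assign_cut tC; have := chambers_sign H tC; rewrite HA -/s.
  case: (t H) => [[]|] // _ <-; rewrite eqxx.
    by case: eqP => [/assign_inj//|_]; rewrite subr0.
  case: eqP => [/assign_inj//|_]; rewrite sub0r; apply/eqP.
  by rewrite eq_sym -addr_eq0 addrC vs.
Qed.

End Deletion.

(** ** One hyperplane *)

Section OneHyperplane.
Variables (Z : {set E}) (H : E) (y0 : signs).
Hypotheses (Z0Z : Z0 \subset Z) (y0Z : y0 \in flat Z) (y0H : y0 H != None).
Local Notation C := (chambers Z [set H]).
Local Notation ray s := (assign (szero E) H (Some s)).

(** A face of [H] of maximal dimension; it is a face of one region on each side. *)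
Lemma max_face : exists2 w, w \in flat (H |: Z) &
  forall z K, z \in flat (H |: Z) -> w K = None -> z K = None.
Proof.
have z0 : szero E \in flat (H |: Z).
  by apply/flatP; split=> [|K _]; [apply: covector0 BP|rewrite ffunE].
have [w wZ wmax] := arg_maxnP (fun w : signs => #|[set K | w K != None]|) z0.
exists w => // z K zZ wK; apply/eqP; apply: contraT => zK.
have := wmax _ (flatM BP wZ zZ); rewrite /geq /= leqNgt => /negP[]; apply: proper_card.
apply/properP; split.
  by apply/subsetP => L; rewrite !inE ffunE; case: (w L).
by exists K; rewrite !inE ?wK // ffunE wK.
Qed.

(** Let [w] be a face of [H] of maximal dimension. The cone of [w] in the flat of
    [Z] consists of [w] and its two neighbours off [H]; without the negative one
    it is the difference of two contractible ideals, and remains so when the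
    faces of [S] off the flat are added to both. The functions on the two
    remaining elements form the module of the two sides of [H]: the value at [w]
    is the coefficient of the positive side, the value at the positive neighbour
    is the sum of both coefficients. For a letter on the positive side moves
    both sides to the positive one and [w] to its positive neighbour; a letter
    on the negative side makes the positive coefficient zero and moves [w] out
    of the difference. *)
Lemma one_hyperplane_exact : exact smul predT S (chamber_mod Z [set H]).
Proof.
have [w wZH wmax] := max_face.
have [wZ wH] : w \in flat Z /\ w H = None.
  by move: wZH; rewrite flat_setU1 => /andP[-> /eqP].
have sgn := both_signs y0Z y0H.
pose U1 := up (flat Z) (assign w H (Some false)).
pose P := up (flat Z) w :\: U1.
have inP x : (x \in P) = (x \in up (flat Z) w) && (x H != Some false).
  by rewrite in_setD up_assign //; case: (x \in up (flat Z) w); rewrite /= ?andbT ?andbF.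
have ZS : flat Z \subset S.
  by apply/subsetP => x /flatP[xB xZ]; apply/flatP; split=> // K /(subsetP Z0Z)/xZ.
have exP : exact smul predT S (ideal_mod k smul P).
  have c1 : contractible (flat Z) U1.
    apply: (contractible_cone BP); have [y yZ yH] := sgn false; apply/set0Pn; exists (smul w y).
    by rewrite up_assign // in_up (flatM BP) //= smulA smulxx ffunE wH yH !eqxx.
  have /(contractible_flat BP Z0Z) c2 := contractible_up wZ.
  move/(contractible_flat BP Z0Z) in c1.
  have SM : mul_closed smul S by apply: flatM.
  have S0 : szero E \in S by apply/flatP; split=> [|K _]; [apply: covector0 BP|rewrite ffunE].
  have := exact_diff SM (contractible_ideal SM c1) (contractible_ideal SM c2) _
    (contractible_exact S0 SM c1 (k := k)) (contractible_exact S0 SM c2 (k := k)).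
  have -> : (up (flat Z) w :|: (S :\: flat Z)) :\: (U1 :|: (S :\: flat Z)) = P.
    apply/setP => x; rewrite in_setD !in_setU in_setD [RHS]in_setD negb_or negb_and.
    case xU: (x \in U1) => //=; have [xZ|xZ] := boolP (x \in flat Z); rewrite /= ?orbF //.
    by rewrite in_up (negPf xZ) /=; case: (x \in S).
  apply; apply: setSU; apply/subsetP => x; rewrite up_assign // => /andP[] //.
(* An element of the cone of [w] is determined by its sign on [H]: elimination of
   [H] between [x] and the opposite of [y] would give a face of [H] larger than [w]. *)
have same x y : x \in up (flat Z) w -> y \in up (flat Z) w -> x H = y H -> x = y.
  rewrite !in_up => /andP[xZ /smul_idPr wx] /andP[yZ /smul_idPr wy] xyH.
  apply/ffunP => K; case wK: (w K) => [a|]; first by rewrite wx ?wy wK.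
  case xH: (x H) => [s|]; last first.
    rewrite (wmax x) ?(wmax y) // flat_setU1 ?yZ ?xZ -?xyH xH eqxx //.
  have yH : sneg y H = Some (~~ s) by rewrite ffunE -xyH xH.
  have [z zZ /(_ K)] := flat_elim BP xZ (flatN BP yZ) xH yH.
  rewrite (wmax z) // !ffunE /opposite.
  case: (x K) (y K) => [a|] [b|] //= e; try by have := e isT.
  by move: e; case: (a); case: (b) => // /(_ isT).
have rayC s : ray s \in C.
  have [y yZ yH] := sgn s; apply/chambersP; exists y => //; split=> [K|].
    by rewrite in_set1 => /eqP ->; rewrite yH.
  by apply/ffunP => K; rewrite !ffunE in_set1; case: eqP => [->|].
have CE t : t \in C -> t = ray true \/ t = ray false.
  move=> tC; have tE : t = assign (szero E) H (t H).
    apply/ffunP => K; rewrite !ffunE; have := chambers_sign K tC; rewrite in_set1.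
    by have [->|_ /negbFE/eqP] := eqVneq K H.
  have := chambers_sign H tC; rewrite in_set1 eqxx; move: tE.
  by case: (t H) => [[]|] // ->; [left|right].
have rayI : ray true != ray false by apply/eqP => /ffunP/(_ H); rewrite !ffunE eqxx.
pose th (v : F) : F := [ffun x => if x \in P then v (ray true) +
   (if x H is Some _ then v (ray false) else 0) else 0].
have thL : linear th.
  move=> a u v; apply/ffunP => x; rewrite !ffunE; case: ifP => _; last by rewrite scaler0 addr0.
  by case: (x H) => [_|]; rewrite ?addr0 ?ffunE ?scalerDr // addrACA.
pose lth : {linear F -> F} := HB.pack th (GRing.isLinear.Build k F F _ th thL).
have th0 v : supported k P (th v) by move=> x /negPf xP; rewrite ffunE xP.
have ray_eq r s : (ray r == ray s) = (r == s).
  by apply/eqP/eqP => [/ffunP/(_ H)|-> //]; rewrite !ffunE eqxx => -[].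
have act_ray b r : b \in flat Z ->
    chamber_act Z [set H] b (ray r) = Some (ray (if b H is Some q then q else r)).
  move=> bZ; rewrite /chamber_act bZ rayC; congr Some; apply/ffunP => K.
  rewrite !ffunE in_set1; have [->|//] := eqVneq K H.
  by case: (b H).
have push_ray b v s : b \in flat Z -> push k (chamber_act Z [set H] b) v (ray s) =
    (if s == (if b H is Some q then q else true) then v (ray true) else 0) +
    (if s == (if b H is Some q then q else false) then v (ray false) else 0).
  move=> bZ; rewrite ffunE big_mkcond /= (bigD1 (ray true)) //= (bigD1 (ray false)) 1?eq_sym //=.
  rewrite !act_ray // big1 ?addr0 => [|t /andP[tt tf]].
    by congr (_ + _); rewrite [_ == Some _]ray_eq eq_sym.
  rewrite /chamber_act bZ /=; have [/CE[] e|//] := boolP (t \in C); by rewrite e eqxx in tt tf.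
have [y yZ yH] := sgn true.
have wP : w \in P by rewrite inP in_up wZ smulxx wH eqxx.
have wyP : smul w y \in P.
  by rewrite inP in_up (flatM BP) //= smulA smulxx ffunE wH yH !eqxx.
apply: (exact_iso (p := lth : {linear chamber_mod Z [set H] -> ideal_mod k smul P}) _ _ _ _ _ _ _ _ exP).
- exact: smulA.
- exact: flatM.
- exact: chamber_mod_over.
- by move=> v _; apply: th0.
- move=> b v bS v0; change (th (push k (chamber_act Z [set H] b) v) =
    pull k (within P (fun x => smul x b)) (th v)).
  apply/ffunP => x; rewrite [LHS]ffunE [RHS]ffunE /within.
  case xP: (x \in P) => //=.
  have xZ : x \in flat Z by move: xP; rewrite inP in_up => /andP[/andP[]].
  have [bZ|bZ] := boolP (b \in flat Z); last first.
    have -> : (smul x b \in P) = false.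
      by rewrite inP in_up flat_smul ?(negPf bZ) ?andbF //; [apply: SB (subsetP ZS _ xZ)|apply: SB].
    have e s : push k (chamber_act Z [set H] b) v (ray s) = 0.
      by rewrite ffunE big_pred0 // => t; rewrite /chamber_act (negPf bZ).
    by rewrite !e; case: (x H); rewrite addr0.
  have xbU : smul x b \in up (flat Z) w.
    move: xP; rewrite inP !in_up => /andP[/andP[_ /eqP wx] _].
    by rewrite (flatM BP) //= smulA wx eqxx.
  have xbP : (smul x b \in P) = (smul x b H != Some false) by rewrite inP xbU.
  have xH : x H != Some false by move: xP; rewrite inP => /andP[].
  rewrite !push_ray // xbP ffunE; move: xH; case xH: (x H) => [[]|] // _.
    rewrite /= [RHS]ffunE xbP ffunE xH /=.
    by case: (b H) => [[]|] //=; rewrite ?addr0 ?add0r.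
  have xbH : smul x b H = b H by rewrite ffunE xH.
  have thE : smul x b \in P -> th v (smul x b) =
      v (ray true) + (if b H is Some _ then v (ray false) else 0).
    by move=> xb; rewrite ffunE xb xbH.
  case bH: (b H) => [[]|] //=; rewrite !addr0 // thE ?bH ?addr0 //; by rewrite xbP xbH bH.
- move=> b v bS v0; change (th (push k (within C id) v) = restr k P (th v)).
  by rewrite push_restr // restr_id.
- move=> v v0 /ffunP thv.
  have vt : v (ray true) = 0 by have := thv w; rewrite !ffunE wP wH addr0.
  have vf : v (ray false) = 0.
    by have := thv (smul w y); rewrite !ffunE wyP wH yH vt add0r.
  apply/ffunP => t; rewrite ffunE; have [/CE[]->|/v0] := boolP (t \in C); by [].
- move=> u u0.
  pose v : F := [ffun t => if t == ray true then u w
     else if t == ray false then u (smul w y) - u w else 0].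
  exists v => [t tC|].
    by rewrite ffunE; do 2?[case: eqP => [e|_]; first by rewrite e rayC in tC].
  apply/ffunP => x; rewrite !ffunE; have [xP|/u0 //] := boolP (x \in P).
  rewrite eqxx eq_sym (negPf rayI) eqxx.
  have xU : x \in up (flat Z) w by move: xP; rewrite inP => /andP[].
  move: xP; rewrite inP xU /=; case xH: (x H) => [[]|] // _.
    rewrite addrC subrK; congr (u _); apply: same => //.
      by move: wyP; rewrite inP => /andP[].
    by rewrite ffunE wH yH.
  by rewrite addr0; congr (u _); apply: same; rewrite ?wH // in_up wZ smulxx eqxx.
Qed.
End OneHyperplane.

(** Induction on the number of hyperplanes: removing one of them leaves an
    extension of two modules with fewer hyperplanes. If no hyperplane of [A]
    divides the flat there are no regions at all. *)
Theorem chamber_exact Z A : Z0 \subset Z -> A != set0 ->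
  exact smul predT S (chamber_mod Z A).
Proof.
have [m] := ubnP #|A|; elim: m => // m IH in Z A *; rewrite ltnS => Am Z0Z /set0Pn[H HA].
have [/exists_inP[y0 y0Z y0H]|] := boolP [exists y in flat Z, y H != None]; last first.
  move=> /exists_inPn yH; apply: exact0 => v v0; apply/ffunP => t; rewrite ffunE v0 //.
  by apply/negP => /chambersP[x /yH] /negP xH [/(_ H HA)].
have [AH|AH] := eqVneq (A :\ H) set0.
  have -> : A = [set H] by rewrite -(setD1K HA) AH setU0.
  exact: one_hyperplane_exact Z0Z y0Z y0H.
have lt : (#|A :\ H| < m)%N by move: Am; rewrite (cardsD1 H) HA.
apply: (exact_ext (@smulA E) (flatM BP (Z := Z0)) _ _ (wall_exact HA y0Z y0H)).
- exact: chamber_mod_over.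
- exact: chamber_mod_over.
- by apply: IH => //; apply: subset_trans Z0Z _; apply: subsetUr.
- exact: IH.
Qed.

End Chambers.

(** * The bimodules of the semigroup algebra *)

Section SemigroupAlgebra.
Variables (k : fieldType) (E : finType) (B : {set signs E}).
Hypothesis BP : covectors B.
Local Notation signs := (signs E).
Local Notation smul := (@smul E).
Local Notation flat := (flat B).
Local Notation F := {ffun signs -> k^o}.
Local Notation one := (szero E).
Implicit Types (x y b c t : signs) (K : E) (Z : {set E}) (J L P Q : {set signs}) (v : F).

Definition two_sided J := J \subset B /\
  forall x b, x \in J -> b \in B -> smul x b \in J /\ smul b x \in J.

(** For a difference [P] of two-sided ideals this is the subquotient of the
    semigroup algebra with basis [P]: products that leave [P] are zero. *)
Definition alg_mod P : bimodule k signs :=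
  push_mod k P (fun b => within P (smul b)) (fun b => within P (smul^~ b)).

Definition dual_mod P : bimodule k signs :=
  pull_mod k P (fun b => within P (smul^~ b)) (fun b => within P (smul b)).

(** The property of differences of two-sided ideals that makes the partial
    actions on [P] associative and compatible. *)
Definition convex P := forall x b c, x \in P -> b \in B -> c \in B ->
  [/\ smul b (smul c x) \in P -> smul c x \in P,
      smul (smul x b) c \in P -> smul x b \in P &
      smul b (smul x c) \in P -> smul b x \in P /\ smul x c \in P].

Lemma convexD J L : two_sided J -> two_sided L -> convex (J :\: L).
Proof.
move=> [_ JM] [_ LM] x b c /setDP[xJ xL] bB cB.
have [xbJ bxJ] := JM x b xJ bB; have [xcJ cxJ] := JM x c xJ cB.
rewrite !in_setD xbJ bxJ xcJ cxJ !andbT.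
split=> [/andP[n _]|/andP[n _]|/andP[n _]].
- by apply: contra n => cx; case: (LM _ b cx bB).
- by apply: contra n => xb; case: (LM _ c xb cB).
- split; apply: contra n; last by move=> xc; case: (LM _ b xc bB).
  by move=> bx; rewrite smulA; case: (LM _ c bx cB).
Qed.

Lemma two_sided_convex J : two_sided J -> convex J.
Proof.
move=> [_ JM] x b c xJ bB cB.
by have [xb bx] := JM x b xJ bB; have [xc cx] := JM x c xJ cB.
Qed.

Lemma within_comp P (f g : signs -> signs) x :
  (x \in P -> g (f x) \in P -> f x \in P) ->
  obind (within P g) (within P f x) = within P (fun x => g (f x)) x.
Proof.
rewrite /within => fg; case xP: (x \in P) fg => //= /(_ isT) fg.
case fP: (f x \in P) fg => //=; first by rewrite fP.
by case: ifP => // _ /(_ isT).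
Qed.

Lemma alg_mod_over P : convex P -> bimodule_over smul B (alg_mod P).
Proof.
move=> Pc.
have PD b (f : signs -> signs -> signs) v : supported k P (push k (within P (f b)) v).
  by apply: push_dom => x y; rewrite /within; case: ifP => // /andP[_ yP] [<-].
split=> /=.
- by move=> b v _ _; apply: (PD b smul).
- by move=> b v _ _; apply: (PD b (fun b => smul^~ b)).
- move=> b c v bB cB _; rewrite [LHS]push_push; apply: eq_push => x.
  rewrite within_comp => [|xP]; last by case: (Pc x b c xP bB cB).
  by rewrite /within smulA.
- move=> b c v bB cB _; rewrite [LHS]push_push; apply: eq_push => x.
  rewrite within_comp => [|xP]; last by case: (Pc x c b xP cB bB).
  by rewrite /within smulA.
- move=> b c v bB cB _; rewrite [LHS]push_push [RHS]push_push; apply: eq_push => x.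
  rewrite !within_comp => [|xP|xP]; first by rewrite /within smulA.
    by have [_ _ h] := Pc x b c xP bB cB; rewrite -?smulA => /h; case.
  by have [_ _ h] := Pc x b c xP bB cB; rewrite -?smulA => /h; case.
Qed.

Lemma dual_mod_over P : convex P -> bimodule_over smul B (dual_mod P).
Proof.
move=> Pc; split=> /=.
- by move=> b v _ _; apply: pull_dom.
- by move=> b v _ _; apply: pull_dom.
- move=> b c v bB cB _; rewrite [LHS]pull_pull; apply: eq_pull => x.
  rewrite within_comp => [|xP]; last by case: (Pc x b c xP bB cB).
  by rewrite /within smulA.
- move=> b c v bB cB _; rewrite [LHS]pull_pull; apply: eq_pull => x.
  rewrite within_comp => [|xP]; last by case: (Pc x c b xP cB bB).
  by rewrite /within smulA.
- move=> b c v bB cB _; rewrite [LHS]pull_pull [RHS]pull_pull; apply: eq_pull => x.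
  rewrite !within_comp => [|xP|xP]; first by rewrite /within smulA.
    by have [_ _ h] := Pc x c b xP cB bB; rewrite -?smulA => /h; case.
  by have [_ _ h] := Pc x c b xP cB bB; rewrite -?smulA => /h; case.
Qed.

(** ** Layers *)

Definition zeros x : {set E} := [set K | x K == None].
(** The elements with a given support. On their span an element of the flat of
    [Z] acts trivially from the right and moves the chambers of the flat from the
    left; the other elements act by zero on both sides. *)
Definition layer Z : {set signs} := [set y in B | zeros y == Z].

Lemma layerP Z y : reflect (y \in B /\ forall K, (y K == None) = (K \in Z)) (y \in layer Z).
Proof.
rewrite in_set; apply: (iffP andP) => [[yB /eqP <-]|[yB yZ]].
  by split=> // K; rewrite in_set.
by split=> //; apply/eqP/setP => K; rewrite in_set.
Qed.

Lemma layer_flat Z y : y \in layer Z -> y \in flat Z.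
Proof. by move=> /layerP[yB yZ]; apply/flatP; split=> // K KZ; apply/eqP; rewrite yZ. Qed.

Lemma layer_mull Z b y : y \in layer Z -> b \in B -> (smul b y \in layer Z) = (b \in flat Z).
Proof.
move=> /layerP[yB yZ] bB; apply/layerP/flatP => -[h bZ]; split=> //.
- by move=> K KZ; apply/eqP; have := bZ K; rewrite KZ ffunE; case: (b K).
- exact: covectorM BP _ _ bB yB.
- move=> K; rewrite ffunE; have := yZ K; case KZ: (K \in Z); first by rewrite bZ.
  by case: (b K).
Qed.

Lemma layer_mulr Z b y : y \in layer Z -> b \in B -> (smul y b \in layer Z) = (b \in flat Z).
Proof.
move=> /layerP[yB yZ] bB; apply/layerP/flatP => -[h bZ]; split=> //.
- by move=> K KZ; apply/eqP; have := bZ K; have := yZ K; rewrite KZ ffunE => /eqP ->.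
- exact: covectorM BP _ _ yB bB.
- move=> K; rewrite ffunE; have := yZ K; case: (y K) => // /esym KZ.
  by rewrite KZ bZ.
Qed.

Lemma layer_mul_id Z b y : y \in layer Z -> b \in flat Z -> smul y b = y.
Proof.
move=> /layerP[yB yZ] /flatP[bB bZ]; apply/ffunP => K; rewrite ffunE.
by have := yZ K; case: (y K) => // /esym /bZ.
Qed.

Lemma layer_mul_layer Z x y : y \in layer Z -> x \in layer Z -> smul y x = y.
Proof. by move=> yZ /layer_flat; apply: layer_mul_id. Qed.

Lemma layer_convex Z : convex (layer Z).
Proof.
move=> x b c xL bB cB; have xB : x \in B by case/layerP: xL.
have bcB := covectorM BP bB cB.
split.
- by rewrite smulA !layer_mull // flat_smul // => /andP[].
- by rewrite -smulA !layer_mulr // flat_smul // => /andP[].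
- move=> bxc; have bxZ : b \in flat Z /\ c \in flat Z.
    have [_ h] := layerP _ _ bxc; split; apply/flatP; split=> // K KZ; apply/eqP.
      by have := h K; rewrite KZ ffunE; case: (b K).
    have xK : x K = None by apply/eqP; case/layerP: xL => _ ->.
    by have := h K; rewrite KZ !ffunE xK; case: (b K).
  by rewrite layer_mull // layer_mulr //; case: bxZ.
Qed.

Lemma layer_chambers Z : layer Z = chambers B Z (~: Z).
Proof.
apply/setP => y; apply/idP/chambersP => [yL|[x xZ [xA <-]]].
  exists y; first exact: layer_flat.
  case/layerP: yL => yB yZ; split=> [K|]; first by rewrite in_setC yZ.
  by apply/ffunP => K; rewrite ffunE in_setC -yZ; case: (y K).
case/flatP: (xZ) => xB xK.
have -> : cut (~: Z) x = x.
  by apply/ffunP => K; rewrite ffunE in_setC; case: ifPn => // /negPn /xK.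
apply/layerP; split=> // K; have [/xK ->//|KZ] := boolP (K \in Z).
by apply/negbTE/xA; rewrite in_setC.
Qed.

(** The elements off the flat of [Z] form an ideal that annihilates the layer. *)
Lemma layer_excision Z (M : bimodule k signs) n :
  bimodule_over smul B M ->
  (forall x (v : M), x \in B -> x \notin flat Z -> dom M v -> lact M x v = 0 /\ ract M x v = 0) ->
  exact smul (pred1 n) (flat Z) M -> exact smul (pred1 n) B M.
Proof.
move=> MP M0.
have IM x b : x \in B :\: flat Z -> b \in B ->
    smul x b \in B :\: flat Z /\ smul b x \in B :\: flat Z.
  rewrite !in_setD => /andP[xZ xB] bB; rewrite !flat_smul // !(covectorM BP) //.
  by rewrite (negPf xZ) andbF.
have [|u uP] := right_unit (@smulA E) (@smulxx E) (@smulxyx E) M (I := B :\: flat Z).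
  by move=> x y xI /setDP[yB _]; case: (IM x y xI yB).
apply: (excision (@smulA E) _ (covectorM BP) (flatM BP (Z := Z)) IM MP _ uP).
  by apply/subsetP => x /flatP[].
by move=> x v /setDP[xB xZ]; apply: M0.
Qed.

Lemma exact_degree (S : {set signs}) (M : bimodule k signs) n :
  exact smul predT S M -> exact smul (pred1 n) S M.
Proof. by move=> Mx f /Mx[g gW fg]; exists g => // s sS _; apply: fg. Qed.

Lemma eq_push_in P (g h : signs -> option signs) v : {in P, g =1 h} ->
  supported k P v -> push k g v = push k h v.
Proof.
move=> gh v0; apply/ffunP => y; rewrite !ffunE big_mkcond [RHS]big_mkcond /=.
apply: eq_bigr => x _; have [/gh ->//|/v0 ->] := boolP (x \in P).
by rewrite !if_same.
Qed.

Lemma layer_killed Z x v : x \in B -> x \notin flat Z -> supported k (layer Z) v ->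
  [/\ push k (within (layer Z) (smul x)) v = 0,
      push k (within (layer Z) (smul^~ x)) v = 0,
      pull k (within (layer Z) (smul x)) v = 0 &
      pull k (within (layer Z) (smul^~ x)) v = 0].
Proof.
move=> xB xZ v0.
have l y : within (layer Z) (smul x) y = None.
  by rewrite /within; case yL: (y \in _) => //=; rewrite layer_mull // (negPf xZ).
have r y : within (layer Z) (smul^~ x) y = None.
  by rewrite /within; case yL: (y \in _) => //=; rewrite layer_mulr // (negPf xZ).
split; apply/ffunP => y; rewrite !ffunE ?l ?r //;
  by rewrite big_pred0 // => z; rewrite ?l ?r.
Qed.

(** After excision the layer is the span of the chambers of the flat of [Z], and
    the right action is trivial. *)
Lemma layer_alg_exact Z n : Z != [set: E] -> exact smul (pred1 n) B (alg_mod (layer Z)).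
Proof.
move=> ZT; have LP := alg_mod_over (@layer_convex Z).
apply: layer_excision => //= [x v xB xZ v0|].
  by have [] := layer_killed xB xZ v0.
have AC : ~: Z != set0 by rewrite -setCT (inj_eq (can_inj (@setCK _))).
have fB b : b \in flat Z -> b \in B by case/flatP.
apply: exact_degree.
apply: (exact_iso (p := idfun : {linear alg_mod (layer Z) -> chamber_mod k B Z (~: Z)})) _.
- exact: smulA.
- exact: flatM.
- by case: LP => *; split; auto.
- by move=> v /=; rewrite layer_chambers.
- move=> b v bZ v0 /=; apply: (eq_push_in (P := layer Z)) => // x xL.
  rewrite /within /chamber_act xL bZ layer_mull ?fB // bZ -layer_chambers xL.
  congr Some; apply/ffunP => K; rewrite [RHS]ffunE in_setC.
  case: ifPn => // /negPn KZ; rewrite ffunE; case/flatP: bZ => _ -> //.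
  by apply/eqP; case/layerP: xL => _ ->.
- move=> b v bZ v0 /=; rewrite -layer_chambers; apply: (eq_push_in (P := layer Z)) => // x xL.
  by rewrite /within xL layer_mulr ?fB // bZ (layer_mul_id xL bZ).
- by [].
- by move=> v v0; exists v => //; rewrite /= layer_chambers.
exact: (chamber_exact BP (subxx Z) AC).
Qed.

Lemma layerT : layer [set: E] = [set one].
Proof.
apply/setP => x; rewrite in_set1; apply/layerP/eqP => [[_ xT]|->].
  by apply/ffunP => K; rewrite ffunE; apply/eqP; rewrite xT in_setT.
by split=> [|K]; [apply: covector0 BP|rewrite ffunE in_setT].
Qed.

Lemma flatT x : (x \in flat [set: E]) = (x == one).
Proof.
apply/flatP/eqP => [[_ xT]|->]; first by apply/ffunP => K; rewrite xT ?in_setT ?ffunE.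
by split=> [|K _]; [apply: covector0 BP|rewrite ffunE].
Qed.

(** The projection of the algebra to the field that kills all the faces but 1
    makes the field a projective left module: it is generated by the element
    [1 - u], where [u] is a right unit of the ideal of these faces. *)
Lemma layerT_alg_exact n : (0 < n)%N -> exact smul (pred1 n) B (alg_mod (layer [set: E])).
Proof.
move=> n0; set P := layer _; set I := B :\: flat [set: E].
have IM x b : x \in I -> b \in B -> smul x b \in I /\ smul b x \in I.
  rewrite !in_setD => /andP[xZ xB] bB; rewrite !flat_smul // !(covectorM BP) //.
  by rewrite (negPf xZ) andbF.
have IB x : x \in I -> x \in B by case/setDP.
have [|u uP] := right_unit (@smulA E) (@smulxx E) (@smulxyx E) (alg_mod P) (I := I).
  by move=> x y xI /IB yB; case: (IM x y xI yB).
have oneP : one \in P by rewrite /P layerT in_set1.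
have act1 v : supported k P v -> push k (within P (smul^~ one)) v = v.
  move=> v0; rewrite -[RHS](push_restr v0); apply: eq_push => x.
  by rewrite /within smulr0.
have actI x v : x \in I -> supported k P v -> push k (within P (smul^~ x)) v = 0.
  by move=> /setDP[xB xT] v0; have [] := layer_killed xB xT v0.
move=> f [fW f0].
have oneB := covector0 BP.
(* the homotopy for a projective module: [1 - u] is put before the word *)
pose fe (s : seq signs) : alg_mod P := -1 *: (\sum_(y in I) u y *: f (y :: s)) + f (one :: s).
have feW : cochain B fe.
  move=> s sB; apply: dom_lin; last by apply: fW; rewrite /= oneB.
  by apply: dom_sum => y yI; apply: domZ; apply: fW; rewrite /= IB.
have f1 c s : c \in B -> words B s -> absorb (M := alg_mod P) smul (fun s => f (one :: s)) c s = 0.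
  move=> cB sB; have csB : words B (c :: s) by rewrite /= cB.
  have : push k (within P (smul^~ one)) (f (c :: s)) -
      absorb (M := alg_mod P) smul f one (c :: s) = 0 by apply: (f0 [:: one, c & s]); rewrite /= oneB cB.
  rewrite act1; last exact: fW.
  by rewrite /= smulr0 opprB addrCA subrr addr0.
have fI y c s : y \in I -> c \in B -> words B s ->
    absorb (M := alg_mod P) smul (fun s => f (y :: s)) c s = f (smul c y :: s).
  move=> yI cB sB; have csB : words B (c :: s) by rewrite /= cB.
  have : push k (within P (smul^~ y)) (f (c :: s)) -
      absorb (M := alg_mod P) smul f y (c :: s) = 0 by apply: (f0 [:: y, c & s]); rewrite /= IB ?cB.
  rewrite actI //; last exact: fW.
  by rewrite /= sub0r opprB => /eqP; rewrite subr_eq0 => /eqP.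
exists fe => // -[|c s] /=; first by move=> _ /eqP e; rewrite -e in n0.
move=> /andP[cB sB] _.
have -> : absorb (M := alg_mod P) smul fe c s = - \sum_(y in I) u y *: f (smul c y :: s).
  rewrite absorbP f1 // addr0 scaleN1r; congr (- _).
  rewrite (@absorb_sum k signs smul B (flat [set: E]) (alg_mod P) u (fun y s => f (y :: s))).
  by apply: eq_bigr => y yI; rewrite fI.
rewrite opprK; have [cT|cT] := boolP (c \in flat [set: E]); last first.
  have cI : c \in I by rewrite in_setD cT.
  by rewrite (uP (fun z => f (z :: s))) // -[push_fun _ _]/(push k _ _) actI ?add0r //; apply: feW.
move: cT; rewrite flatT => /eqP ->.
rewrite -[push_fun _ _]/(push k _ _) act1; last exact: feW.
under [X in _ = _ + X]eq_bigr => y _ do rewrite smul0.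
by rewrite /fe scaleN1r addrAC addNr add0r.
Qed.

(** ** Filtration by two-sided ideals *)

(** Multiplication only removes zeros, so that an element of [J] cannot be
    multiplied into the layer of an element of [J] with the most zeros, unless
    it lies in this layer. *)
Lemma layer_split J : two_sided J -> J != set0 -> exists Z,
  [/\ layer Z \subset J, layer Z != set0 & two_sided (J :\: layer Z)].
Proof.
move=> [JB JM] /set0Pn[x0 x0J].
have [x xJ xmax] := arg_maxnP (fun x => #|zeros x|) x0J.
have xB := subsetP JB x xJ.
have xL : x \in layer (zeros x) by rewrite in_set xB eqxx.
have maxE y : y \in J -> zeros x \subset zeros y -> y \in layer (zeros x).
  move=> yJ xy; rewrite in_set (subsetP JB) // eq_sym.
  by rewrite eqEcard xy; apply: xmax.
exists (zeros x); split.
- apply/subsetP => y yL; rewrite -(layer_mul_layer yL xL).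
  by case: (JM x y xJ _) => //; case/layerP: yL.
- by apply/set0Pn; exists x.
- split; first by apply: subset_trans JB; apply: subsetDl.
  move=> y b /setDP[yJ yL] bB; have [yb by_] := JM y b yJ bB.
  rewrite !in_setD yb by_ !andbT; split; apply: contra yL => /layerP[_ h];
  by apply: maxE => //; apply/subsetP => K KZ; move: (h K); rewrite KZ !in_set ffunE;
    case: (y K) => //; case: (b K).
Qed.

Lemma restr_push P v : restr k P v = push k (within P id) v.
Proof.
have -> : push k (within P id) v = push k (within P id) (restr k P v).
  apply/ffunP => y; rewrite !ffunE; apply: eq_bigr => x; rewrite restrE /within andbb.
  by case: ifP.
by rewrite push_restr // => x /negPf xP; rewrite restrE xP.
Qed.

Section Filtration.
Variables (J L : {set signs}).
Hypotheses (JP : two_sided J) (JLP : two_sided (J :\: L)) (LJ : L \subset J).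

Let restr_map P (f : signs -> signs) v : restr k P (push k (within J f) v) =
  push k (fun x => if (x \in J) && (f x \in J) && (f x \in P) then Some (f x) else None) v.
Proof.
rewrite restr_push push_push; apply: eq_push => x; rewrite /within.
by case: ifP => //= _; rewrite andbb.
Qed.

Let alg_quo (f : signs -> signs) v :
  (forall x, x \in J -> f x \in J) -> (forall x, x \in J :\: L -> f x \in J :\: L) ->
  restr k L (push k (within J f) v) = push k (within L f) (restr k L v).
Proof.
move=> fJ fL; rewrite restr_map restr_push push_push; apply: eq_push => x.
rewrite /within andbb; case xL: (x \in L) => /=.
  by rewrite xL (subsetP LJ) // fJ ?(subsetP LJ).
case xJ: (x \in J) => //=; have := fL x; rewrite !in_setD xL xJ => /(_ isT)/andP[/negPf ->].
by rewrite andbF.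
Qed.

Let alg_sub (f : signs -> signs) v :
  (forall x, x \in J :\: L -> f x \in J :\: L) -> supported k (J :\: L) v ->
  push k (within (J :\: L) f) v = push k (within J f) v.
Proof.
move=> fL v0; apply: (eq_push_in (P := J :\: L)) => // x xJL.
rewrite /within xJL fL //; have /setDP[xJ _] := xJL.
by have /setDP[fJ _] := fL x xJL; rewrite xJ fJ.
Qed.

Lemma alg_filtration : short_exact B (L := alg_mod (J :\: L)) (M := alg_mod J) (N := alg_mod L)
  (idfun : {linear F -> F}) (restr k L).
Proof.
have [_ JM] := JP; have [_ JLM] := JLP.
apply: short_exact_restr => // b v bB v0.
- by apply: alg_sub => // x xJ; case: (JLM x b xJ bB).
- by apply: alg_sub => // x xJ; case: (JLM x b xJ bB).
- by apply: alg_quo => x xJ; [case: (JM x b xJ bB)|case: (JLM x b xJ bB)].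
- by apply: alg_quo => x xJ; [case: (JM x b xJ bB)|case: (JLM x b xJ bB)].
Qed.

Let dual_sub (f : signs -> signs) v :
  (forall x, x \in J -> f x \in J) -> (forall x, x \in J :\: L -> f x \in J :\: L) ->
  supported k L v -> pull k (within L f) v = pull k (within J f) v.
Proof.
move=> fJ fL v0; apply/ffunP => x; rewrite !ffunE /within.
case xJ: (x \in J); last by rewrite (contraFF (subsetP LJ x) xJ).
rewrite fJ //=; case xL: (x \in L) => /=; first by case: ifP => // /negbT/v0.
have := fL x; rewrite !in_setD xL xJ => /(_ isT)/andP[/v0 -> _] //.
Qed.

Let dual_quo (f : signs -> signs) v :
  (forall x, x \in J -> f x \in J) -> (forall x, x \in J :\: L -> f x \in J :\: L) ->
  restr k (J :\: L) (pull k (within J f) v) =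
  pull k (within (J :\: L) f) (restr k (J :\: L) v).
Proof.
move=> fJ fL; apply/ffunP => x; rewrite restrE !ffunE /within.
case xJL: (x \in J :\: L) => //=; rewrite fL //= restrE fL //.
by case/setDP: xJL => xJ _; rewrite xJ fJ.
Qed.

Lemma dual_filtration : short_exact B (L := dual_mod (J :\: (J :\: L))) (M := dual_mod J)
  (N := dual_mod (J :\: L)) (idfun : {linear F -> F}) (restr k (J :\: L)).
Proof.
have [_ JM] := JP; have [_ JLM] := JLP.
have JJ : J :\: (J :\: L) = L by rewrite setDDr setDv set0U; apply/setIidPr.
apply: short_exact_restr => [|b v bB|b v bB|b v bB v0|b v bB v0]; first exact: subsetDl.
- by rewrite JJ => v0; apply: dual_sub => // x xJ; [case: (JM x b xJ bB)|case: (JLM x b xJ bB)].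
- by rewrite JJ => v0; apply: dual_sub => // x xJ; [case: (JM x b xJ bB)|case: (JLM x b xJ bB)].
- by apply: dual_quo => // x xJ; [case: (JM x b xJ bB)|case: (JLM x b xJ bB)].
- by apply: dual_quo => // x xJ; [case: (JM x b xJ bB)|case: (JLM x b xJ bB)].
Qed.

End Filtration.

Let setB_two_sided : two_sided B.
Proof. by split=> // x b xB bB; rewrite !(covectorM BP). Qed.

(** A property of the layers that is stable under extensions holds for the
    bimodules of all two-sided ideals. *)
Lemma filtration_ind (M : {set signs} -> bimodule k signs) n :
  (forall J L, two_sided J -> two_sided (J :\: L) -> L \subset J ->
    exact smul (pred1 n) B (M (J :\: L)) -> exact smul (pred1 n) B (M L) ->
    exact smul (pred1 n) B (M J)) ->
  exact smul (pred1 n) B (M set0) ->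
  forall J, two_sided J -> (forall Z, layer Z \subset J -> exact smul (pred1 n) B (M (layer Z))) ->
  exact smul (pred1 n) B (M J).
Proof.
move=> ext M0 J; have [m] := ubnP #|J|; elim: m => // m IH in J *; rewrite ltnS => Jm JP ML.
have [->//|J0] := eqVneq J set0; have [Z [LJ L0 JLP]] := layer_split JP J0.
apply: (ext _ _ JP JLP LJ); last exact: ML.
apply: IH => // [|Z' Z'J]; last by apply: ML; apply: subset_trans Z'J _; apply: subsetDl.
apply: leq_trans Jm; apply: proper_card; apply/properP; split; first exact: subsetDl.
have /set0Pn[x xL] := L0; exists x; first exact: (subsetP LJ).
by rewrite in_setD xL.
Qed.

(** Only the layer of 1 contributes in degree zero; this is the origin of the
    one-dimensional centre. *)
Lemma alg_exact J n : two_sided J -> ((0 < n)%N || (one \notin J)) ->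
  exact smul (pred1 n) B (alg_mod J).
Proof.
move=> JP n1; apply: (filtration_ind _ _ JP) => [{n1}J L {}JP JLP LJ xJL xL||Z ZJ].
- apply: (exact_ext (@smulA E) (covectorM BP) _ _ (alg_filtration JP JLP LJ) xJL xL);
  exact/alg_mod_over/two_sided_convex.
- by apply: exact0 => v v0; apply/ffunP => x; rewrite ffunE v0 // inE.
have [ZT|] := eqVneq Z [set: E]; last exact: layer_alg_exact.
rewrite ZT; apply: layerT_alg_exact; move: n1; rewrite (subsetP ZJ) ?orbF //.
by rewrite ZT layerT in_set1.
Qed.

(** In the dual of a layer the flat of [Z] acts trivially on the left. On the
    right, the action of [y] followed by evaluation at a fixed element [x0] is
    evaluation at [y], because [y x0 = y] in the layer. Hence evaluation at [x0],
    with [y] put before the word, contracts the complex. *)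
Lemma layer_dual_exact Z n : (0 < n)%N -> exact smul (pred1 n) B (dual_mod (layer Z)).
Proof.
move=> n0; set L := layer Z.
have [L0|/set0Pn[x0 x0L]] := eqVneq L set0.
  by apply: exact0 => v v0; apply/ffunP => x; rewrite ffunE v0 // L0 inE.
have fB b : b \in flat Z -> b \in B by case/flatP.
apply: (layer_excision (Z := Z)); first exact/dual_mod_over/layer_convex.
  by move=> x v xB xZ v0; have [] := layer_killed xB xZ v0.
have lactE b v y : b \in flat Z -> y \in L -> pull k (within L (smul^~ b)) v y = v y.
  by move=> bZ yL; rewrite ffunE /within yL layer_mulr ?fB // bZ (layer_mul_id yL bZ).
have ractE b v y : b \in flat Z -> y \in L -> pull k (within L (smul b)) v y = v (smul b y).
  by move=> bZ yL; rewrite ffunE /within yL layer_mull ?fB // bZ.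
have sub_at (v1 v2 : F) x : (v1 - v2) x = v1 x - v2 x by rewrite !ffunE.
have move_at (f g : seq signs -> dual_mod L) y b s : y \in L -> b \in flat Z ->
    words (flat Z) s -> (forall t : seq signs, words (flat Z) t -> (f t : F) x0 = (g t : F) y) ->
    (absorb (M := dual_mod L) smul f b s : F) x0 = (absorb (M := dual_mod L) smul g b s : F) y.
  move=> yL; elim: s f g b => [|c s IH] f g b bZ /=.
    move=> _ fg; rewrite -[LHS]/(pull k (within L (smul^~ b)) (f [::]) x0).
    by rewrite lactE // fg // -[RHS]/(pull k (within L (smul^~ b)) (g [::]) y) lactE.
  move=> /andP[cZ sZ] fg; rewrite !sub_at fg /= ?(flatM BP) // (IH _ (fun t : seq signs => g (b :: t))) //.
  by move=> t tZ; apply: fg; rewrite /= bZ.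
move=> f [fW f0].
pose g (t : seq signs) : dual_mod L := [ffun y => if y \in L then (f (y :: t) : F) x0 else 0].
exists g => [t tZ x /negPf xL|[|b t] /=]; first by rewrite ffunE xL.
  by move=> _ /eqP e; rewrite -e in n0.
move=> /andP[bZ tZ] _; have fb : supported k L (f (b :: t)) by apply: fW; rewrite /= bZ.
have gW : cochain (flat Z) g by move=> s _ x /negPf xL; rewrite ffunE xL.
apply/ffunP => y; have [yL|yL] := boolP (y \in L); last first.
  have MS : bimodule_over smul (flat Z) (dual_mod L).
    by apply: bimodule_overS (dual_mod_over (@layer_convex Z)); apply/subsetP => x /fB.
  have dgW := codiff_dom (flatM BP (Z := Z)) MS gW (s := b :: t).
  by rewrite fb // -[RHS]/(codiff smul g (b :: t) y) dgW //= bZ.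
have ybZ : y \in flat Z by apply: layer_flat.
have := f0 [:: y, b & t]; rewrite /= ybZ bZ => /(_ tZ) /ffunP /(_ x0).
rewrite sub_at -[pull_fun _ _]/(pull k _ _) ractE // (layer_mul_layer yL x0L) sub_at ffunE.
rewrite (move_at _ g y) //; first last.
  by move=> s sZ; rewrite ffunE yL.
move=> /eqP; rewrite subr_eq0 => /eqP ->.
rewrite sub_at -[pull_fun _ _]/(pull k _ _) ractE // ffunE.
by rewrite layer_mull ?fB // bZ.
Qed.

Lemma dual_exact n : (0 < n)%N -> exact smul (pred1 n) B (dual_mod B).
Proof.
move=> n0; apply: (filtration_ind _ _ setB_two_sided) => [J L JP JLP LJ xJL xL||Z _].
- have JJ : J :\: (J :\: L) = L by rewrite setDDr setDv set0U; apply/setIidPr.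
  apply: (exact_ext (@smulA E) (covectorM BP) _ _ (dual_filtration JP JLP LJ) _ xJL).
  + exact/dual_mod_over/convexD.
  + exact/dual_mod_over/two_sided_convex.
  + by rewrite JJ.
- by apply: exact0 => v v0; apply/ffunP => x; rewrite ffunE v0 // inE.
- exact: layer_dual_exact.
Qed.

End SemigroupAlgebra.

(** * Cochains as alternating sums of faces *)

Section Faces.
Variables (k : fieldType) (T : finType) (mul : T -> T -> T) (x0 : T).
Variable M : bimodule k T.
Implicit Types (f : seq T -> M) (b : T) (s t : seq T).

(** The words in the expansion of the recursive differential: those in which two
    neighbouring letters are multiplied, in reversed order. *)
Definition face_word i t := take i t ++ mul (nth x0 t i.+1) (nth x0 t i) :: drop i.+2 t.

Lemma absorb_sum_faces f b s : absorb mul f b s =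
  \sum_(i < size s) (-1) ^+ i *: f (face_word i (b :: s))
  + (-1) ^+ size s *: lact M (last b s) (f (belast b s)).
Proof.
elim: s f b => [|c s IH] f b /=; first by rewrite big_ord0 add0r expr0 scale1r.
rewrite big_ord_recl /= expr0 scale1r {1}/face_word /= drop0 -addrA; congr (_ + _).
rewrite IH opprD -!sumrN; congr (_ + _); last by rewrite exprS mulN1r scaleNr.
by apply: eq_bigr => i _; rewrite /bump /= exprS mulN1r scaleNr.
Qed.

Lemma nth_face_word i t l : (i.+1 < size t)%N -> nth x0 (face_word i t) l =
  if (l < i)%N then nth x0 t l
  else if l == i then mul (nth x0 t i.+1) (nth x0 t i) else nth x0 t l.+1.
Proof.
move=> it; rewrite nth_cat size_take_min (minn_idPl _); last by lia.
case: ltnP => [li|il]; first by rewrite nth_take.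
case: eqP => [->|li]; first by rewrite subnn.
have -> : (l - i = (l - i.+1).+1)%N by lia.
by rewrite /= nth_drop; congr (nth _ _ _); lia.
Qed.

Lemma size_face_word i t : (i.+1 < size t)%N -> size (face_word i t) = (size t).-1.
Proof. by move=> it; rewrite size_cat /= size_take_min size_drop (minn_idPl _); lia. Qed.

End Faces.

(** * Finite duality *)

(** A complex of finite-dimensional spaces is exact where its dual is: a vector
    outside the row space of [P] is detected by a linear form that vanishes on
    this space; such a form is a combination of the columns of [Q], and these
    vanish on a cycle. *)
Lemma exact_transpose (k : fieldType) (I J K : finType) (P : I -> J -> k) (Q : J -> K -> k) :
  (forall phi : J -> k, (forall i, \sum_j P i j * phi j = 0) ->
     exists psi : K -> k, forall j, phi j = \sum_l Q j l * psi l) ->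
  forall x : J -> k, (forall l, \sum_j x j * Q j l = 0) ->
  exists y : I -> k, forall j, x j = \sum_i y i * P i j.
Proof.
move=> ex x xQ.
pose D := \matrix_(i < #|I|, j < #|J|) P (enum_val i) (enum_val j).
pose X := \row_(j < #|J|) x (enum_val j).
have sumE (L : finType) (F : L -> k) : \sum_l F l = \sum_(i < #|L|) F (enum_val i).
  by rewrite (reindex (@enum_val L predT)) //; apply: onW_bij; apply: enum_val_bij.
suff : (X <= D)%MS.
  move=> /submxP[Y XY]; exists (fun i => Y 0 (enum_rank i)) => j.
  have /matrixP/(_ 0 (enum_rank j)) := XY; rewrite !mxE enum_rankK => ->.
  by rewrite [RHS]sumE; apply: eq_bigr => i _; rewrite !mxE enum_valK enum_rankK.
rewrite submxE; apply/eqP/matrixP => i j; rewrite [LHS]mxE [RHS]mxE.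
pose phi l := cokermx D (enum_rank l) j.
have [i'|psi phiE] := ex phi.
  have /matrixP/(_ (enum_rank i') j) := mulmx_coker D; rewrite [LHS]mxE [RHS]mxE => e.
  rewrite -[RHS]e [LHS]sumE; apply: eq_bigr => l _.
  by rewrite [D _ _]mxE enum_rankK /phi enum_valK.
transitivity (\sum_l x l * phi l).
  by rewrite [RHS]sumE; apply: eq_bigr => l _; rewrite [X _ _]mxE /phi enum_valK.
under eq_bigr => l _ do rewrite phiE mulr_sumr.
rewrite exchange_big big1 // => l _.
by under eq_bigr => l' _ do rewrite mulrA; rewrite -mulr_suml xQ mul0r.
Qed.

(** * Multilinear maps on the face algebra *)

Section Multilinear.
Variables (k : fieldType) (R : realType) (d : nat) (A : arrangement R d).
Local Notation fA := (face_algebra k A).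
Implicit Types (x y : face A) (a : fA).

Definition fbase x : fA := << x >>.

Lemma coeff_fbase x y : (fbase x)@_y = (x == y)%:R.
Proof. exact: mcoeffU1. Qed.

Lemma fbase_expand a : a = \sum_(x : face A) a@_x *: fbase x.
Proof.
apply/malgP => y; rewrite raddf_sum /= (bigD1 y) //= mcoeffZ coeff_fbase eqxx mulr1.
rewrite big1 ?addr0 // => x xy; rewrite mcoeffZ coeff_fbase (negPf xy) mulr0 //.
Qed.

Lemma fbaseM x y : fbase x * fbase y = fbase (face_mul x y).
Proof. by rewrite /fbase malgM_def fgmulUU mul1r. Qed.

Lemma multilinear_sum_at n (V : lmodType k) (f : {ffun 'I_n -> fA} -> V) v j a :
  multilinear f -> f (upd v j a) = \sum_x a@_x *: f (upd v j (fbase x)).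
Proof.
move=> fm; have f0 : f (upd v j 0) = 0.
  have := fm v j 1 0 0; rewrite scaler0 addr0 scale1r => e.
  by apply: (addrI (f (upd v j 0))); rewrite -e addr0.
rewrite {1}(fbase_expand a); elim: (index_enum _) => [|x r IH]; first by rewrite !big_nil.
by rewrite !big_cons fm IH.
Qed.

Lemma multilinear_ext n (V : lmodType k) (f g : {ffun 'I_n -> fA} -> V) :
  multilinear f -> multilinear g ->
  (forall c : {ffun 'I_n -> face A}, f [ffun i => fbase (c i)] = g [ffun i => fbase (c i)]) ->
  forall v, f v = g v.
Proof.
move=> fm gm fg v.
suff h (P : {set 'I_n}) (u : {ffun 'I_n -> fA}) : (forall i, i \notin P -> exists x, u i = fbase x) -> f u = g u.
  by apply: (h setT) => i; rewrite inE.
have [m] := ubnP #|P|; elim: m => // m IH in P u *; rewrite ltnS => Pm uP.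
have [P0|/set0Pn[j jP]] := eqVneq P set0.
  have /fin_all_exists[c cP] : forall i, exists x, u i = fbase x.
    by move=> i; apply: uP; rewrite P0 inE.
  have -> : u = [ffun i => fbase (finfun c i)] by apply/ffunP => i; rewrite !ffunE.
  exact: fg.
have uu : u = upd u j (u j) by apply/ffunP => i; rewrite ffunE; case: eqP => [->|].
rewrite uu (multilinear_sum_at _ _ _ fm) (multilinear_sum_at _ _ _ gm).
apply: eq_bigr => x _; congr (_ *: _); apply: (IH (P :\ j)).
  by move: Pm; rewrite (cardsD1 j) jP.
move=> i; rewrite !inE negb_and negbK ffunE; case: eqP => [_ _|_ /= /uP //].
by exists x.
Qed.

Definition multilinear_of n (V : lmodType k) (w : {ffun 'I_n -> face A} -> V)
  (v : {ffun 'I_n -> fA}) : V := \sum_(c : {ffun 'I_n -> face A}) (\prod_i (v i)@_(c i)) *: w c.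

Lemma multilinear_of_base n (V : lmodType k) (w : {ffun 'I_n -> face A} -> V) (c : {ffun 'I_n -> face A}) :
  multilinear_of w [ffun i => fbase (c i)] = w c.
Proof.
rewrite /multilinear_of (bigD1 c) //= big1 ?scale1r => [|i _]; last first.
  by rewrite ffunE coeff_fbase eqxx.
rewrite big1 ?addr0 // => c' cc'.
have [i ci] : exists i, c i != c' i.
  apply/existsP; rewrite -negb_forall; apply: contra cc' => /forallP cc'.
  by apply/eqP/ffunP => i; apply/esym/eqP.
by rewrite (bigD1 i) //= ffunE coeff_fbase (negPf ci) mul0r scale0r.
Qed.

Lemma multilinear_ofP n (V : lmodType k) (w : {ffun 'I_n -> face A} -> V) :
  multilinear (multilinear_of w).
Proof.
move=> v j e a b; rewrite /multilinear_of scaler_sumr -big_split /=; apply: eq_bigr => c _.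
rewrite !(bigD1 (P := predT) j) //= !ffunE eqxx mcoeffD mcoeffZ.
have eqP' z z' : \prod_(i | i != j) (upd v j z i)@_(c i) = \prod_(i | i != j) (upd v j z' i)@_(c i).
  by apply: eq_bigr => i /negPf ij; rewrite !ffunE ij.
rewrite (eqP' _ 0) (eqP' a 0) (eqP' b 0).
by rewrite mulrDl scalerDl -mulrA scalerA.
Qed.

(** The tensor power is a quotient of the free module on all tuples; it is
    spanned by the tuples of faces. *)
Lemma tpow_ext n (V : lmodType k) (f g : {linear tpow fA n -> V}) :
  (forall c : {ffun 'I_n -> face A}, f (tens [ffun i => fbase (c i)]) = g (tens [ffun i => fbase (c i)])) ->
  forall q, f q = g q.
Proof.
move=> fg q.
have fgt v : f (tens v) = g (tens v).
  apply: (multilinear_ext (f := fun v => f (tens v)) (g := fun v => g (tens v))) => // u j e a b;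
  by rewrite tens_multilinear linearP.
rewrite -[q]quotpiK [repr q]monalgE.
rewrite !linear_sum; apply: eq_bigr => u _.
have -> : << (repr q)@_u *g u >> = (repr q)@_u *: (<< u >> : {malg k[{ffun 'I_n -> fA}]}).
  by apply/malgP => u'; rewrite mcoeffZ !mcoeffU mulr_natr.
by rewrite !linearZ; congr (_ *: _); apply: fgt.
Qed.

End Multilinear.

(** * The faces of an arrangement *)

Import Order.TTheory Num.Theory.

Section ArrangementFaces.
Variables (R : realType) (d : nat) (A : arrangement R d).
Local Notation E := (A : finType).
Local Notation signs := (signs E).
Implicit Types (s t : signs) (x y : face A) (v w : 'rV[R]_d).

Definition realizable : {set signs} := [set s | `[< classical_sets.nonempty (face_set (A := A) s) >]].

Lemma realizableP s : reflect (exists v, forall H, s H = sign_of (hform H v)) (s \in realizable).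
Proof.
rewrite in_set; apply: (iffP idP) => [/asboolP[v /face_setP vs]|[v vs]]; first by exists v.
by apply/asboolP; exists v; apply/face_setP.
Qed.

Lemma sign_ofN (a : R) : sign_of (- a) = omap negb (sign_of a).
Proof.
by rewrite /sign_of oppr_eq0 oppr_gt0; case: (ltgtP a 0).
Qed.

Lemma sign_of_pos (a : R) : sign_of a = Some true <-> 0 < a.
Proof. by rewrite /sign_of; case: (ltgtP a 0). Qed.

Lemma sign_of_neg (a : R) : sign_of a = Some false <-> a < 0.
Proof. by rewrite /sign_of; case: (ltgtP a 0). Qed.

Lemma sign_of_mul (a x : R) : 0 < a -> sign_of (a * x) = sign_of x.
Proof. by move=> a0; rewrite /sign_of mulf_eq0 (gt_eqF a0) pmulr_rgt0. Qed.

Lemma sign_of_add (x y : R) : ~~ opposite (sign_of x) (sign_of y) ->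
  sign_of (x + y) = if sign_of x is None then sign_of y else sign_of x.
Proof.
case: (ltgtP x 0) => [x0|x0|->]; last by rewrite add0r [sign_of 0]/sign_of eqxx.
  rewrite (sign_of_neg x).2 //; case: (ltgtP y 0) => [y0|y0|->].
  - by move=> _; apply/sign_of_neg; rewrite -oppr_gt0 opprD addr_gt0 ?oppr_gt0.
  - by rewrite (sign_of_pos y).2.
  - by move=> _; rewrite addr0; apply/sign_of_neg.
rewrite (sign_of_pos x).2 //; case: (ltgtP y 0) => [y0|y0|->].
- by rewrite (sign_of_neg y).2.
- by move=> _; apply/sign_of_pos; rewrite addr_gt0.
- by move=> _; rewrite addr0; apply/sign_of_pos.
Qed.

(** For elimination between [s] and [t], realized by [v] and [w], take the point
    at which the segment from [v] to [w] crosses [H]. *)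
Lemma realizable_covectors : covectors realizable.
Proof.
split.
- by apply/realizableP; exists 0 => H; rewrite linear0 /sign_of eqxx ffunE.
- move=> s t; rewrite !in_set => /asboolP sF /asboolP tF; apply/asboolP.
  exact: mul_sign_face (Face (asboolT sF)) (Face (asboolT tF)).
- move=> s /realizableP[v vs]; apply/realizableP; exists (- v) => H.
  by rewrite ffunE vs linearN sign_ofN.
- move=> s t H e /realizableP[v vs] /realizableP[w wt]; rewrite vs wt => vH wH.
  pose hv := `|hform H v|; pose hw := `|hform H w|.
  have [hv0 hw0] : 0 < hv /\ 0 < hw.
    rewrite !normr_gt0; split; apply/eqP => h0.
      by move: vH; rewrite h0 /sign_of eqxx.
    by move: wH; rewrite h0 /sign_of eqxx.
  pose z := hw *: v + hv *: w.
  exists [ffun K => sign_of (hform K z)]; first by apply/realizableP; exists z => K; rewrite ffunE.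
  rewrite ffunE; split=> [|K nop].
    suff -> : hform H z = 0 by rewrite /sign_of eqxx.
    rewrite linearD !linearZ /= /GRing.scale /= /hw /hv.
    case: e vH wH => /= [/sign_of_pos v0 /sign_of_neg w0|/sign_of_neg v0 /sign_of_pos w0].
      by rewrite (gtr0_norm v0) (ltr0_norm w0) mulrC mulrN addNr.
    by rewrite (ltr0_norm v0) (gtr0_norm w0) mulrC mulNr addrN.
  rewrite !ffunE linearD !linearZ /= /GRing.scale /= vs wt.
  by rewrite sign_of_add ?sign_of_mul // -vs -wt.
Qed.

Lemma realizable_face x : val x \in realizable.
Proof. by rewrite in_set; apply/(valP x). Qed.

Definition face_of s : face A := insubd (face_one A) s.

Lemma face_ofK s : s \in realizable -> val (face_of s) = s.
Proof. by rewrite in_set => sF; rewrite val_insubd sF. Qed.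

Lemma valKface x : face_of (val x) = x.
Proof. by apply: val_inj; rewrite face_ofK // realizable_face. Qed.

Lemma face_ofM s t : s \in realizable -> t \in realizable ->
  face_of (smul s t) = face_mul (face_of s) (face_of t).
Proof.
move=> sB tB; apply: val_inj; rewrite face_ofK ?(covectorM realizable_covectors) //=.
by have := face_ofK sB; have := face_ofK tB => /= -> ->.
Qed.

End ArrangementFaces.

(** * Hochschild cochains on the basis of faces *)

Section Link.
Variables (k : fieldType) (R : realType) (d : nat) (A : arrangement R d).
Local Notation fA := (face_algebra k A).
Local Notation E := (A : finType).
Local Notation signs := (signs E).
Local Notation smul := (@smul E).
Local Notation B := (realizable A).
Local Notation F := {ffun signs -> k^o}.
Local Notation BP := (realizable_covectors A).
Implicit Types (s : signs) (x : face A) (a : fA) (v : F).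

Definition coeffs_fun a : F := [ffun s => if s \in B then a@_(face_of s) else 0].

Fact coeffs_linear : linear coeffs_fun.
Proof.
move=> c a b; apply/ffunP => s; rewrite !ffunE; case: ifP => _; last by rewrite scaler0 addr0.
by rewrite mcoeffD mcoeffZ.
Qed.
HB.instance Definition _ := GRing.isLinear.Build k fA F _ coeffs_fun coeffs_linear.
Definition coeffs : {linear fA -> F} := coeffs_fun.

Definition decode v : fA := \sum_(x : face A) v (val x) *: fbase k x.

Lemma coeffs_supported a : supported k B (coeffs a).
Proof. by move=> s /negPf sB; rewrite ffunE sB. Qed.

Lemma coeffsK : cancel coeffs decode.
Proof.
move=> a; rewrite [RHS]fbase_expand; apply: eq_bigr => x _.
by rewrite ffunE realizable_face valKface.
Qed.

Lemma mcoeff_decode v x : (decode v)@_x = v (val x).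
Proof.
rewrite raddf_sum /= (bigD1 x) //= mcoeffZ coeff_fbase eqxx mulr1 big1 ?addr0 // => y yx.
by rewrite mcoeffZ coeff_fbase (negPf yx) mulr0.
Qed.

Lemma decodeK v : supported k B v -> coeffs (decode v) = v.
Proof.
move=> v0; apply/ffunP => s; rewrite ffunE; case: ifPn => [sB|/v0//].
by rewrite mcoeff_decode face_ofK.
Qed.

Lemma sum_faces (V : nmodType) (G : signs -> V) :
  \sum_(s in B) G s = \sum_(x : face A) G (val x).
Proof.
rewrite (reindex_onto (fun x : face A => val x) (@face_of R d A)) => [|s sB]; last exact: face_ofK.
by apply: eq_bigl => x; rewrite realizable_face valKface eqxx.
Qed.

(** A linear map of the algebra that sends faces to faces is the summation of
    coefficients over the fibres of the map of faces. *)
Lemma coeffs_push (h : signs -> signs) (g : fA -> fA) a :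
  linear g -> (forall x, val x \in B -> h (val x) \in B /\ g (fbase k x) = fbase k (face_of (h (val x)))) ->
  coeffs (g a) = push k (within B h) (coeffs a).
Proof.
move=> gL gh; pose gl : {linear fA -> fA} := HB.pack g (GRing.isLinear.Build k fA fA _ g gL).
apply/ffunP => t; rewrite ffunE [RHS]ffunE.
have -> : g a = \sum_(x : face A) a@_x *: fbase k (face_of (h (val x))).
  rewrite {1}(fbase_expand a) -[g _]/(gl _) linear_sum; apply: eq_bigr => x _.
  by rewrite linearZ; congr (_ *: _); case: (gh x (realizable_face x)).
have -> : \sum_(s | within B h s == Some t) coeffs a s =
    \sum_(s in B) if h s == t then (coeffs a s : k) else 0.
  rewrite big_mkcond [RHS]big_mkcond /=; apply: eq_bigr => s _; rewrite /within.
  case sB: (s \in B) => //=.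
  have [/= hB _] := gh (face_of s) (realizable_face _); move: hB; rewrite (face_ofK sB) => -> //.
rewrite sum_faces; have [tB|tB] := boolP (t \in B); last first.
  rewrite big1 // => x _; case: eqP => // ht; have [] := gh x (realizable_face x).
  by rewrite ht (negPf tB).
rewrite raddf_sum; apply: eq_bigr => x _ /=.
have [hB _] := gh x (realizable_face x).
rewrite mcoeffZ coeff_fbase ffunE realizable_face valKface.
have -> : (face_of (h (val x)) == face_of t) = (h (val x) == t).
  apply/eqP/eqP => [e|-> //]; by rewrite -(face_ofK hB) e face_ofK.
by case: eqP; rewrite ?mulr1 ?mulr0.
Qed.

Lemma coeffs_mull s a : s \in B ->
  coeffs (fbase k (face_of s) * a) = push k (within B (smul s)) (coeffs a).
Proof.
move=> sB; apply: (coeffs_push (g := fun a => fbase k (face_of s) * a)).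
  by move=> c x y; rewrite mulrDr scalerAr.
move=> x xB; split; first exact: (covectorM BP).
by rewrite fbaseM face_ofM // valKface.
Qed.

Lemma coeffs_mulr s a : s \in B ->
  coeffs (a * fbase k (face_of s)) = push k (within B (smul^~ s)) (coeffs a).
Proof.
move=> sB; apply: (coeffs_push (g := fun a => a * fbase k (face_of s))).
  by move=> c x y; rewrite mulrDl scalerAl.
move=> x xB; split; first exact: (covectorM BP).
by rewrite fbaseM face_ofM // valKface.
Qed.

(** ** Words of faces as arguments *)

(** The first letter of a word is the last argument. *)
Definition args n (t : seq signs) : {ffun 'I_n -> fA} :=
  [ffun i : 'I_n => fbase k (face_of (nth (szero E) t (n - i.+1)))].

Lemma args_face n t (j : 'I_n) : size t = n.+1 -> words B t ->
  args n (face_word smul (szero E) (n - j.+1) t) = mulface j (args n.+1 t).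
Proof.
move=> tn tB; have jn := ltn_ord j.
apply/ffunP => l; have ln := ltn_ord l; rewrite !ffunE nth_face_word; last by rewrite tn; lia.
have tN i : (i < size t)%N -> nth (szero E) t i \in B.
  by move=> it; apply: (allP tB); apply: mem_nth.
rewrite /= /bump /=.
have [lj|jl|lj] := ltngtP l j.
- have -> : (n - l.+1 < n - j.+1)%N = false by lia.
  have -> : (n - l.+1 == n - j.+1)%N = false by lia.
  by congr (fbase k (face_of (nth _ _ _))); lia.
- have -> : (n - l.+1 < n - j.+1)%N by lia.
  have -> : (l == j) = false by apply/eqP => e; rewrite e ltnn in jl.
  by congr (fbase k (face_of (nth _ _ _))); lia.
have -> : l = j by apply: val_inj.
rewrite ltnn !eqxx fbaseM -face_ofM ?tN ?tn; try lia.
have -> : (n - j.+1).+1 = (n - j)%N by lia.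
by rewrite !subSS.
Qed.

Lemma args_behead n t : args n (behead t) = belast_ffun (args n.+1 t).
Proof.
apply/ffunP => i; have := ltn_ord i; rewrite !ffunE nth_behead /= => il.
by congr (fbase k (face_of (nth _ _ _))); lia.
Qed.

Lemma args_belast n s t : size t = n -> args n (belast s t) = behead_ffun (args n.+1 (s :: t)).
Proof.
move=> tn; apply/ffunP => i; have il := ltn_ord i; rewrite !ffunE /= /bump /=.
rewrite lastI nth_rcons size_belast tn.
have -> : (n.+1 - (1 + i).+1 < n)%N by lia.
by congr (fbase k (face_of (nth _ _ _))); lia.
Qed.

Lemma sign_rev n (j : 'I_n) : (-1) ^+ (n - j.+1) = (-1) ^+ (n + j.+1) :> k.
Proof. by rewrite -[LHS]signr_odd -[RHS]signr_odd oddB // oddD. Qed.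

Definition alg_cochain n (f : cochains fA n) (t : seq signs) : alg_mod k B :=
  if size t == n then coeffs (mlin_fun f (args n t)) else 0.

Lemma alg_cochain_dom n (f : cochains fA n) : cochain B (alg_cochain f).
Proof.
move=> t _; rewrite /alg_cochain; case: ifP => _; first exact: coeffs_supported.
by move=> s _; rewrite ffunE.
Qed.

Let coeffsD a b : coeffs (a + b) = coeffs a + coeffs b. Proof. exact: linearD. Qed.
Let coeffsZ c a : coeffs (c *: a) = c *: coeffs a. Proof. exact: linearZ. Qed.
Let coeffs_sum n (G : 'I_n -> fA) : coeffs (\sum_i G i) = \sum_i coeffs (G i).
Proof. exact: linear_sum. Qed.

(** The recursive differential agrees with the Hochschild differential up to a
    sign that depends on the degree only. *)
Lemma codiff_alg_cochain n (f : cochains fA n) t : size t = n.+1 -> words B t ->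
  codiff smul (alg_cochain f) t = (-1) ^+ n.+1 *: coeffs (coboundary_fun f (args n.+1 t)).
Proof.
case: t => [|b s] //= [sn] /andP[bB sB]; pose t := b :: s; pose a := args n.+1 t.
have tn : size t = n.+1 by rewrite /= sn.
have tB : words B t by rewrite /= bB.
have lB : last b s \in B by apply: (allP tB); apply: mem_last.
have aM : a ord_max = fbase k (face_of b) by rewrite ffunE /= subnn.
have a0 : a ord0 = fbase k (face_of (last b s)) by rewrite ffunE subn1 -sn nth_last.
have s1 : (-1) ^+ n.+1 * (-1) ^+ n.+1 = 1 :> k by rewrite -expr2 sqrr_sign.
rewrite (absorb_sum_faces _ (szero E)) /coboundary_fun -/t -/a !coeffsD coeffsZ coeffs_sum.
rewrite a0 aM coeffs_mull // coeffs_mulr // -args_behead -args_belast //=.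
rewrite {1}/alg_cochain sn eqxx {2}/alg_cochain size_belast sn eqxx.
rewrite 2!scalerDr scalerA s1 scale1r [RHS]addrC; congr (_ + _).
rewrite opprD addrC; congr (_ + _); first by rewrite exprS mulN1r scaleNr.
rewrite scaler_sumr -sumrN (reindex_inj rev_ord_inj) /=; apply: eq_bigr => j _.
have jn := ltn_ord j.
rewrite /alg_cochain size_face_word ?tn ?eqxx; last by lia.
rewrite args_face // coeffsZ scalerA -exprD -scaleNr sign_rev; congr (_ *: _).
by rewrite addSn exprS mulN1r.
Qed.

Definition word n (c : {ffun 'I_n -> face A}) : seq signs :=
  rev [seq val (c i) | i <- enum 'I_n].

Lemma size_word n (c : {ffun 'I_n -> face A}) : size (word c) = n.
Proof. by rewrite size_rev size_map size_enum_ord. Qed.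

Lemma word_realizable n (c : {ffun 'I_n -> face A}) : words B (word c).
Proof.
by apply/allP => s; rewrite mem_rev => /mapP[i _ ->]; apply: realizable_face.
Qed.

Lemma nth_word n (c : {ffun 'I_n -> face A}) (i : 'I_n) :
  nth (szero E) (word c) (n - i.+1) = val (c i).
Proof.
have im := ltn_ord i; rewrite nth_rev size_map size_enum_ord; last by lia.
rewrite (nth_map i) ?size_enum_ord; last by lia.
have -> : (n - (n - i.+1).+1 = i)%N by lia.
by rewrite nth_ord_enum.
Qed.

Lemma args_word n (c : {ffun 'I_n -> face A}) : args n (word c) = [ffun i => fbase k (c i)].
Proof. by apply/ffunP => i; rewrite !ffunE nth_word valKface. Qed.

Lemma word_args n (t : seq signs) : size t = n -> words B t ->
  word [ffun i : 'I_n => face_of (nth (szero E) t (n - i.+1))] = t.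
Proof.
move=> tn tB; apply: (@eq_from_nth _ (szero E)) => [|l]; first by rewrite size_word.
rewrite size_word => ln; have rn : (n - l.+1 < n)%N by lia.
have -> : l = (n - (Ordinal rn).+1)%N by rewrite /=; lia.
rewrite nth_word ffunE face_ofK //.
by apply: (allP tB); apply: mem_nth; rewrite tn /=; lia.
Qed.

Lemma codiff_zero (M : bimodule k signs) n (f : seq signs -> M) t : words B t ->
  (forall w : seq signs, size w != n -> f w = 0) -> size t != n.+1 -> codiff smul f t = 0.
Proof.
move=> tB f0 tn; rewrite (eq_in_codiff (covectorM BP) (g := fun=> 0) tB).
  by case: t {tB tn} => //= b s; rewrite linear0 absorb0 subr0.
by move=> s _ st; apply: f0; apply: contra tn => /eqP <-; rewrite st.
Qed.

Lemma homology0 (U V W : lmodType k) (f : {linear U -> V}) (g : {linear V -> W}) :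
  (forall w : V, g w = 0 -> exists u, f u = w) -> forall q : homology f g, q = 0.
Proof.
move=> ex q; rewrite -[q]quotpiK -[RHS](linear0 (quotpi (imker f g))).
apply/quotpi_eq; rewrite subr0.
by case: (repr q) => v vP; apply: ex; apply/eqP.
Qed.

Let two_sidedB : two_sided B B.
Proof. by split=> // x b xB bB; rewrite !(covectorM BP). Qed.

(** A cocycle on words of faces has a primitive by [alg_exact], and this extends
    to a multilinear cochain. *)
Theorem cohomology_vanishes n (q : hochschild_cohomology fA n.+1) : q = 0.
Proof.
move: q; apply: homology0 => f df.
have [|g gW fg] := alg_exact BP (k := k) two_sidedB (n := n.+1) isT (f := alg_cochain f).
  split; first exact: alg_cochain_dom.
  move=> t tB; have [tn|tn] := eqVneq (size t) n.+2.
    have -> := codiff_alg_cochain f tn tB.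
    have -> : coboundary_fun f (args n.+2 t) = mlin_fun (coboundary f) (args n.+2 t) by [].
    by rewrite df; change ((-1) ^+ n.+2 *: coeffs 0 = 0); rewrite linear0 scaler0.
  apply: codiff_zero tB _ tn => s sn; by rewrite /alg_cochain (negPf sn).
pose u : cochains fA n := mkmlin (multilinear_ofP (fun c => decode (g (word c)))).
have ug t : words B t -> size t = n -> alg_cochain u t = g t.
  move=> tB tn; rewrite /alg_cochain tn eqxx.
  have -> : args n t = [ffun i => fbase k ([ffun i : 'I_n => face_of (nth (szero E) t (n - i.+1))] i)].
    by apply/ffunP => i; rewrite !ffunE.
  rewrite -[mlin_fun u _]/(multilinear_of _ _) multilinear_of_base word_args // decodeK //.
  exact: gW.
exists ((-1) ^+ n.+1 *: u); apply: val_inj; apply/funext.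
apply: multilinear_ext; [exact: mlinP|exact: mlinP|move=> c].
rewrite -args_word; set t := word c.
have [tB tn] : words B t /\ size t = n.+1 by rewrite word_realizable size_word.
have := fg t tB; rewrite /= tn eqxx => /(_ isT).
rewrite {1}/alg_cochain tn eqxx (eq_in_codiff (covectorM BP) (g := alg_cochain u) tB); last first.
  by move=> s sB st; rewrite ug //; move: st; rewrite tn => -[].
rewrite codiff_alg_cochain // -linearZ => /(can_inj coeffsK) ->.
change (mlin_fun (coboundary ((-1) ^+ n.+1 *: u)) (args n.+1 t) =
  (-1) ^+ n.+1 *: mlin_fun (coboundary u) (args n.+1 t)).
by rewrite linearZ.
Qed.

End Link.

(** * Hochschild chains *)

Section Chains.
Variables (k : fieldType) (R : realType) (d : nat) (A : arrangement R d).
Local Notation fA := (face_algebra k A).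
Local Notation E := (A : finType).
Local Notation signs := (signs E).
Local Notation smul := (@smul E).
Local Notation B := (realizable A).
Local Notation F := {ffun signs -> k^o}.
Local Notation BP := (realizable_covectors A).
Local Notation args := (@args k R d A).
Implicit Types (b s : signs) (t : seq signs) (x : face A).

Definition tbase n (c : {ffun 'I_n -> face A}) : tpow fA n := tens [ffun i => fbase k (c i)].

Definition functional n (phi : {ffun 'I_n -> face A} -> k) : {linear tpow fA n -> k^o} :=
  tlift (mkmlin (multilinear_ofP (phi : _ -> k^o))).

Lemma functional_tens n phi c : @functional n phi (tbase c) = phi c.
Proof. by rewrite /functional /tbase [LHS]tlift_tens; apply: multilinear_of_base. Qed.

(** The coordinates of the tensor power in the basis of tuples of faces. *)
Definition tcoord n c : {linear tpow fA n -> k^o} := functional (fun c' => (c' == c)%:R).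

Lemma tpow_expand n (w : tpow fA n) : w = \sum_c tcoord c w *: tbase c.
Proof.
pose g (w : tpow fA n) := \sum_c (tcoord c w : k) *: tbase c.
have gL : linear g.
  move=> a v w'; rewrite /g scaler_sumr -big_split; apply: eq_bigr => c _ /=.
  by rewrite linearP scalerDl scalerA.
pose gl : {linear tpow fA n -> tpow fA n} := HB.pack g (GRing.isLinear.Build k _ _ _ g gL).
rewrite -[RHS]/(gl w); apply: (tpow_ext (f := idfun)) => c.
rewrite -[RHS]/(g (tbase c)) /g (bigD1 c) //= functional_tens eqxx scale1r big1 ?addr0 // => c' cc'.
by rewrite functional_tens eq_sym (negPf cc') scale0r.
Qed.

Lemma functional_expand n phi (w : tpow fA n) :
  functional phi w = \sum_c (tcoord c w : k) * phi c.
Proof.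
rewrite {1}(tpow_expand w) linear_sum; apply: eq_bigr => c _.
by rewrite linearZ /= functional_tens.
Qed.

(** A linear form on chains is a cochain with values in the dual of the algebra;
    the coefficient factor of a chain, which has index 0, is the last letter of
    the word and becomes the argument of the value. *)
Definition dual_cochain n (phi : {linear tpow fA n.+1 -> k^o}) t : dual_mod k B :=
  [ffun s => if (s \in B) && (size t == n) then phi (tens (args n.+1 (rcons t s))) else 0].

Lemma args_cyc n s b t : size t = n -> s \in B -> b \in B ->
  args n.+1 (rcons t (smul b s)) = cycface (args n.+2 (rcons (b :: t) s)).
Proof.
move=> tn sB bB; apply/ffunP => i; rewrite !ffunE.
have [->|i0] := eqVneq i ord0.
  rewrite /= subnn subn1 /= !nth_rcons tn ltnn eqxx fbaseM -face_ofM //.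
have i1 : (0 < i)%N by rewrite lt0n; apply: contra i0 => /eqP e; apply/eqP/val_inj.
have il := ltn_ord i; rewrite /= !subSS.
have -> : (n.+1 - i = (n - i).+1)%N by lia.
rewrite /= !nth_rcons tn.
by have -> : (n - i < n)%N by lia.
Qed.

Lemma rcons_face_word i t s : (i.+1 < size t)%N ->
  rcons (face_word smul (szero E) i t) s = face_word smul (szero E) i (rcons t s).
Proof.
move=> it; have it' := ltnW it; rewrite /face_word rcons_cat /= !nth_rcons it it'.
rewrite drop_rcons //; congr (_ ++ _); rewrite -cats1 takel_cat //.
exact: ltnW it'.
Qed.

Lemma belast_face_word b t s :
  rcons (belast b t) (smul s (last b t)) = face_word smul (szero E) (size t) (rcons (b :: t) s).
Proof.
have tS : size (rcons (belast b t) (last b t)) = (size t).+1 by rewrite size_rcons size_belast.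
rewrite /face_word lastI drop_oversize ?size_rcons ?size_belast // -tS nth_rcons ltnn eqxx.
rewrite nth_rcons tS ltnSn nth_rcons size_belast ltnn eqxx -[LHS]cats1; congr (_ ++ _).
by rewrite -[in RHS]cats1 takel_cat ?tS // -[in RHS]cats1 take_size_cat ?size_belast.
Qed.

(** The differential of cochains with values in the dual is the transpose of the
    boundary of chains, up to a sign: the right action of the first letter
    gives the cyclic face, the left action of the last letter the product with
    the coefficient factor. *)
Lemma codiff_dual_cochain n (phi : {linear tpow fA n.+1 -> k^o}) t s :
  size t = n.+1 -> words B t -> s \in B ->
  (codiff smul (dual_cochain phi) t : F) s =
  (-1) ^+ n.+1 * (phi (boundary fA n (tens (args n.+2 (rcons t s)))) : k).
Proof.
case: t => [|b t] //= [tn] /andP[bB tB] sB.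
have phiD u v : phi (u + v) = phi u + phi v by apply: linearD.
have phiZ c v : phi (c *: v) = c * (phi v : k) by apply: linearZ.
have phi_sum m (G : 'I_m -> tpow fA n.+1) : phi (\sum_i G i) = \sum_i phi (G i) by apply: linear_sum.
have sub_at (v1 v2 : F) (x : signs) : (v1 - v2) x = v1 x - v2 x by rewrite !ffunE.
have add_at (v1 v2 : F) (x : signs) : (v1 + v2) x = v1 x + v2 x by rewrite !ffunE.
have scale_at (c : k) (v : F) (x : signs) : (c *: v) x = c * v x by rewrite ffunE.
have MB (x y : signs) : x \in B -> y \in B -> smul x y \in B by move=> xB yB; exact: (covectorM BP xB yB).
have lB : last b t \in B.
  by have /allP h : words B (b :: t) by [rewrite /= bB]; apply: h; apply: mem_last.
pose T := rcons (b :: t) s; pose a := args n.+2 T.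
have TB : words B T by rewrite /words /T all_rcons /= sB bB.
have Tn : size T = n.+2 by rewrite /T size_rcons /= tn.
have phiE u : size u = n -> forall x : signs, x \in B ->
    (dual_cochain phi u : F) x = phi (tens (args n.+1 (rcons u x))).
  by move=> un x xB; rewrite ffunE xB un eqxx.
have bdE : boundary fA n (tens a) = boundary_fun a by apply: tlift_tens.
have s1 : (-1) ^+ n.+1 * (-1) ^+ n.+1 = 1 :> k by rewrite -expr2 sqrr_sign.
rewrite bdE phiD phi_sum phiZ mulrDr mulrA s1 mul1r [RHS]addrC.
transitivity ((pull k (within B (smul b)) (dual_cochain phi t) : F) s -
    (absorb smul (dual_cochain phi) b t : F) s); first exact: sub_at.
congr (_ + _).
  by rewrite ffunE /within sB MB //= phiE ?MB // args_cyc.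
rewrite (absorb_sum_faces _ (szero E)).
transitivity (- (\sum_(i < size t) (-1) ^+ i * (dual_cochain phi (face_word smul (szero E) i (b :: t)) : F) s
    + (-1) ^+ size t * (pull k (within B (smul^~ (last b t))) (dual_cochain phi (belast b t)) : F) s)).
  by rewrite [in LHS]add_at [in LHS]scale_at [in LHS]sum_ffunE; under [in LHS]eq_bigr do rewrite scale_at.
transitivity (- \sum_(i < n.+1) (-1) ^+ i *
    (phi (tens (args n.+1 (face_word smul (szero E) i T))) : k)).
  congr (- _); rewrite big_ord_recr /= tn; congr (_ + _ * _).
    apply: eq_bigr => i _; have ilt := ltn_ord i.
    have it : (i.+1 < size (b :: t))%N by rewrite /= tn.
    have sz : size (face_word smul (szero E) i (b :: t)) = n by rewrite size_face_word //= tn.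
    by rewrite (phiE _ sz _ sB) (rcons_face_word _ it).
  rewrite ffunE /within sB MB //= phiE; [|by rewrite size_belast|exact: MB].
  by rewrite belast_face_word tn.
rewrite -sumrN mulr_sumr (reindex_inj rev_ord_inj) /=; apply: eq_bigr => j _.
rewrite (args_face k j Tn TB) phiZ mulrA -exprD -mulNr; congr (_ * _).
by rewrite (sign_rev k) addnS exprS mulN1r opprK.
Qed.

End Chains.

Section Vanishing.
Variables (k : fieldType) (R : realType) (d : nat) (A : arrangement R d).
Local Notation fA := (face_algebra k A).
Local Notation E := (A : finType).
Local Notation signs := (signs E).
Local Notation smul := (@smul E).
Local Notation B := (realizable A).
Local Notation F := {ffun signs -> k^o}.
Local Notation BP := (realizable_covectors A).
Local Notation args := (@args k R d A).
Local Notation tbase := (@tbase k R d A).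
Local Notation functional := (@functional k R d A).
Local Notation tcoord := (@tcoord k R d A).
Implicit Types (s : signs) (t : seq signs).

Let letters n t : {ffun 'I_n -> face A} :=
  [ffun i : 'I_n => face_of (nth (szero E) t (n - i.+1))].

Let tens_args n t : tens (args n t) = tbase (letters n t).
Proof. by rewrite /tbase; congr tens; apply/ffunP => i; rewrite !ffunE. Qed.

Let word_letters n t : size t = n -> words B t -> word (letters n t) = t.
Proof. exact: word_args. Qed.

Let letters_word n (c : {ffun 'I_n -> face A}) : letters n (word c) = c.
Proof. by apply/ffunP => i; rewrite ffunE nth_word valKface. Qed.

Let take_word n (c : {ffun 'I_n.+1 -> face A}) : rcons (take n (word c)) (val (c ord0)) = word c.
Proof.
by rewrite -(nth_word c ord0) subn1 -take_nth ?size_word // take_oversize ?size_word.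
Qed.

Lemma dual_cochain_dom n (phi : {linear tpow fA n.+1 -> k^o}) : cochain B (dual_cochain phi).
Proof. by move=> t _ s /negPf sB; rewrite ffunE sB. Qed.

Lemma dual_cochain_cocycle n (phi : {linear tpow fA n.+1 -> k^o}) :
  (forall c, phi (boundary fA n (tbase c)) = 0) ->
  cocycle smul B (dual_cochain phi).
Proof.
move=> phi0; split=> [|t tB]; first exact: dual_cochain_dom.
have [tn|tn] := eqVneq (size t) n.+1; last first.
  apply: codiff_zero tB _ tn => s /negPf sn; apply/ffunP => x.
  by rewrite !ffunE sn andbF.
apply/ffunP => s; rewrite [RHS]ffunE; have [sB|sB] := boolP (s \in B).
  by rewrite codiff_dual_cochain // tens_args phi0 mulr0.
have MP : bimodule_over smul B (dual_mod k B).
  by apply/dual_mod_over/two_sided_convex; split=> // x b xB bB; rewrite !(covectorM BP).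
exact: (codiff_dom (covectorM BP) MP (@dual_cochain_dom n phi) tB s sB).
Qed.

(** By finite duality, chains are exact where the linear forms on them are, and
    these are the cochains with values in the dual of the algebra. *)
Theorem homology_vanishes n (q : hochschild_homology fA n.+1) : q = 0.
Proof.
move: q; apply: homology0 => w bw.
have coordB m p l (f : {linear tpow fA m -> tpow fA p}) (y : {ffun 'I_m -> face A} -> k) :
    tcoord l (f (\sum_c y c *: tbase c)) = \sum_c y c * (tcoord l (f (tbase c)) : k).
  have -> : f (\sum_c y c *: tbase c) = \sum_c y c *: f (tbase c).
    by rewrite linear_sum; apply: eq_bigr => c _; apply: linearZ.
  rewrite [LHS](linear_sum (tcoord l)); apply: eq_bigr => c _; exact: (linearZ_LR (tcoord l)).
pose P i j : k := tcoord j (boundary fA n.+1 (tbase i)).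
pose Q j l : k := tcoord l (boundary fA n (tbase j)).
have [|l|y yP] := exact_transpose (P := P) (Q := Q) _ (x := fun j => tcoord j w); last first.
- exists (\sum_i y i *: tbase i); rewrite [RHS]tpow_expand [LHS]tpow_expand.
  apply: eq_bigr => j _; congr (_ *: _); rewrite yP.
  by rewrite (coordB _ _ j (boundary fA n.+1)).
- have -> : \sum_j tcoord j w * Q j l = tcoord l (boundary fA n w).
    by rewrite [in RHS](tpow_expand w) coordB.
  by rewrite [boundary fA n w]bw linear0.
move=> phi phi0.
have [|g gW fg] := dual_exact BP (k := k) (n := n.+1) isT (f := dual_cochain (functional phi)).
  apply: dual_cochain_cocycle => c; rewrite functional_expand; exact: phi0.
pose psi (l : {ffun 'I_n.+1 -> face A}) : k := (g (take n (word l)) : F) (val (l ord0)).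
have psiE t : words B t -> size t = n -> dual_cochain (functional psi) t = g t.
  move=> tB tn; apply/ffunP => s; rewrite ffunE tn eqxx andbT; case: ifPn => sB; last first.
    by rewrite (gW t tB s sB).
  rewrite tens_args functional_tens /psi; set c := letters _ _.
  have wc : word c = rcons t s by apply: word_letters; rewrite ?size_rcons ?tn // /words all_rcons /= sB.
  have [] := rcons_inj (etrans (take_word c) wc) => -> e; exact: (congr1 (g t : F) e).
exists (fun l => (-1) ^+ n.+1 * psi l) => j.
pose t := take n.+1 (word j); pose s := val (j ord0).
have tB : words B t by apply/allP => x /mem_take; apply/allP/word_realizable.
have tn : size t = n.+1 by rewrite size_takel // size_word.
have sB : s \in B by apply: realizable_face.
have tE : tens (args n.+2 (rcons t s)) = tbase j by rewrite tens_args take_word letters_word.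
have -> : phi j = (dual_cochain (functional phi) t : F) s.
  by rewrite ffunE sB tn eqxx tE functional_tens.
rewrite fg //=; last by rewrite tn.
rewrite (eq_in_codiff (covectorM BP) (g := dual_cochain (functional psi)) tB); last first.
  by move=> t' t'B; rewrite tn => -[t'n]; rewrite psiE.
rewrite codiff_dual_cochain // tE functional_expand mulr_sumr; apply: eq_bigr => l _.
exact: mulrCA.
Qed.

End Vanishing.

(** * Degree zero *)

Lemma homology_iso (k : fieldType) (U V W X : lmodType k) (f : {linear U -> V})
    (g : {linear V -> W}) (h : {linear V -> X}) :
  (forall u, h (f u) = 0) ->
  (forall v, g v = 0 -> h v = 0 -> exists u, f u = v) ->
  (forall x, exists2 v, g v = 0 & h v = x) ->
  exists e : {linear homology f g -> X}, bijective e.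
Proof.
move=> hf inj sur.
pose h' (v : kermod g) : X := h (val v).
have h'L : linear h' by move=> a x y; rewrite /h' -linearP.
pose hl : {linear kermod g -> X} := HB.pack h' (GRing.isLinear.Build k _ _ _ h' h'L).
have h0 (v : kermod g) : imker f g v -> hl v = 0.
  by case=> u fu; rewrite -[LHS]/(h (val v)) -fu hf.
pose e : {linear homology f g -> X} :=
  HB.pack (quotlift hl) (GRing.isLinear.Build k _ _ _ (quotlift hl) (quotlift_linear h0)).
have ePi v : e (quotpi (imker f g) v) = h (val v) by apply: (quotlift_pi h0).
have e_inj : injective e.
  move=> p q; rewrite -[p]quotpiK -[q]quotpiK !ePi => epq.
  apply/quotpi_eq; apply: inj; last by rewrite linearB epq subrr.
  by case: (_ - _) => v vP; apply/eqP.
have /boolp.choice[e' e'K] : forall x, exists q, e q = x.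
  move=> x; have [v gv hv] := sur x; have vP : kerpred g v by apply/eqP.
  by exists (quotpi (imker f g) (KerMod vP)); rewrite ePi.
exists e; exists e' => // q; exact: e_inj.
Qed.

Section CohomologyDegreeZero.
Variables (k : fieldType) (R : realType) (d : nat) (A : arrangement R d).
Local Notation fA := (face_algebra k A).
Local Notation E := (A : finType).
Local Notation signs := (signs E).
Local Notation smul := (@smul E).
Local Notation one := (szero E).
Local Notation B := (realizable A).
Local Notation F := {ffun signs -> k^o}.
Local Notation BP := (realizable_covectors A).
Local Notation coeffs := (@coeffs k R d A).
Implicit Types (x y : face A) (s : signs).

Let two_sidedB : two_sided B B.
Proof. by split=> // x b xB bB; rewrite !(covectorM BP). Qed.

Let L := layer B [set: E].

Let two_sidedBL : two_sided B (B :\: L).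
Proof.
rewrite /L (layerT BP); split; first exact: subsetDl.
move=> s b /setD1P[s1 sB] bB; rewrite !in_setD1 !(covectorM BP) // !andbT.
have [H sH] : exists H, s H != None.
  apply/existsP; rewrite -negb_forall; apply: contra s1 => /forallP s0.
  by apply/eqP/ffunP => H; rewrite ffunE; apply/eqP.
split; apply: contra sH => /eqP/ffunP/(_ H); rewrite !ffunE; first by case: (s H).
by case: (b H) => // ->.
Qed.

(** The isomorphism takes a central element to its coefficient at 1. Its kernel
    consists of the central elements in the ideal of the faces other than 1,
    which is zero by exactness in degree zero; the multiples of 1 are central. *)
Theorem cohomology_degree0 : exists g : {linear hochschild_cohomology fA 0 -> k^o}, bijective g.
Proof.
pose z : {ffun 'I_0 -> fA} := [ffun=> 0].
pose h (f : cochains fA 0) : k^o := (mlin_fun f z)@_(face_one A).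
have hL : linear h.
  by move=> c f g; rewrite /h -[mlin_fun _ _]/(c *: mlin_fun f z + mlin_fun g z) mcoeffD mcoeffZ.
pose hl : {linear cochains fA 0 -> k^o} := HB.pack h (GRing.isLinear.Build k _ _ _ h hL).
apply: (homology_iso (h := hl)) => [u|f df hf|c]; first exact: (linear0 hl).
- exists 0; rewrite linear0; pose v := coeffs (mlin_fun f z).
  have v0 : supported k (B :\: L) v.
    move=> s; rewrite in_setD negb_and negbK /L (layerT BP) in_set1 => /orP[/eqP->|sB].
      rewrite ffunE; case: ifP => // oB; rewrite -[RHS]hf; congr mcoeff.
      by apply: val_inj; rewrite face_ofK.
    exact: coeffs_supported.
  have v_supp : supported k B v by apply: coeffs_supported.
  have LB : L \subset B by rewrite /L (layerT BP) sub1set (covector0 BP).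
  have fl := alg_filtration k two_sidedB two_sidedBL LB.
  have vC b : b \in B -> push k (within B (smul^~ b)) v = push k (within B (smul b)) v.
    move=> bB; rewrite -coeffs_mulr // -coeffs_mull //.
    suff -> : mlin_fun f z * fbase k (face_of b) = fbase k (face_of b) * mlin_fun f z by [].
    apply/esym/eqP.
    have := congr1 (fun g : cochains fA 1 => mlin_fun g [ffun=> fbase k (face_of b)]) df.
    rewrite -[LHS]/(coboundary_fun f _) -[RHS]/(0 : fA) /coboundary_fun big_ord0 addr0 expr1 !ffunE.
    rewrite scaleN1r => /eqP; rewrite subr_eq0.
    have zE (a : {ffun 'I_0 -> fA}) : a = z by apply/ffunP => - [].
    by rewrite (zE (behead_ffun _)) (zE (belast_ffun _)).
  pose g (t : seq signs) : alg_mod k (B :\: L) := if nilp t then v else 0.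
  have oJ : (0 < 0)%N || (one \notin B :\: L) by rewrite /L (layerT BP) !inE eqxx.
  have [|w _ /(_ [::] isT isT) vw] := alg_exact BP (k := k) two_sidedBL oJ (f := g).
    split=> [t _|t tB]; first by rewrite /g; case: ifP => // _ s _; rewrite ffunE.
    have [tn|tn] := eqVneq (size t) 1%N; last first.
      by apply: codiff_zero tB _ tn => s s0; rewrite /g /nilp (negPf s0).
    case: t tn tB => [|b [|? ?]] //= _; rewrite andbT => bB.
    have := inj_lact fl bB v0; have := inj_ract fl bB v0 => /= -> ->.
    by rewrite vC ?subrr.
  have f0 : mlin_fun f z = 0.
    by rewrite -[LHS]coeffsK -/v -[v]/(g [::]) vw /decode big1 // => x _; rewrite ffunE scale0r.
  apply/esym/val_inj/funext => a; rewrite -[RHS]/(0 : fA) -f0; congr (mlin_fun f _).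
  by apply/ffunP => - [].
- have cm : multilinear (fun _ : {ffun 'I_0 -> fA} => c *: 1 : fA) by move=> a [].
  exists (mkmlin cm); last first.
    by rewrite -[LHS]/((c *: 1 : fA)@_(face_one A)) mcoeffZ mcoeff1 eqxx mulr1.
  apply: val_inj; apply/funext => a; rewrite -[LHS]/(coboundary_fun (mkmlin cm) a).
  rewrite /coboundary_fun big_ord0 addr0 expr1 /= -[RHS]/(0 : fA) -scalerAl -scalerAr mulr1 mul1r.
  by rewrite scaleN1r (ord1 ord_max) subrr.
Qed.

End CohomologyDegreeZero.

Section HomologyDegreeZero.
Variables (k : fieldType) (R : realType) (d : nat) (A : arrangement R d).
Local Notation fA := (face_algebra k A).
Local Notation tbase := (@tbase k R d A).
Local Notation tcoord := (@tcoord k R d A).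
Implicit Types (x y : face A).

(** ** Faces up to support *)

Local Notation supports := (intersection_lattice A).
Local Notation rows := 'rV[k]_#|` supports|%fset.

Lemma sign_supp x (H : A) : (x H == None) = (supp x <= val H)%VS.
Proof.
have [v /face_setP xv] := faceP x.
have vH (K : A) : (x K == None) = (v \in val K).
  by rewrite xv -lker_hform memv_ker /sign_of; case: ifP.
apply/idP/subvP => [xH|sH]; last first.
  rewrite vH; apply: sH; rewrite memvE; apply/subv_bigcapP => K xK; by rewrite -memvE -vH.
by move=> w; rewrite memvE => /subv_bigcapP/(_ H xH); rewrite -memvE.
Qed.

Lemma supp_mul x y : supp (face_mul x y) = supp (face_mul y x).
Proof.
apply: eq_bigl => H; rewrite !ffunE; by case: (x H) => //; case: (y H).
Qed.

Lemma supp_eq_mul x y : supp x = supp y -> face_mul x y = x.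
Proof.
move=> xy; apply/val_inj/ffunP => H; rewrite ffunE.
case xH: (x H) => //; apply/eqP; rewrite sign_supp -xy -sign_supp xH //.
Qed.

Definition nth_support (j : 'I_#|` supports|%fset) : {vspace 'rV[R]_d} :=
  nth 0%VS (enum_fset supports) j.

Lemma index_support x : exists j, forall i, (supp x == nth_support i) = (i == j).
Proof.
have xL : supp x \in supports by apply/imfsetP; exists x.
have jL : (index (supp x) (enum_fset supports) < #|` supports|)%N by rewrite index_mem.
exists (Ordinal jL) => i; apply/eqP/eqP => [xi|->]; last by rewrite /nth_support nth_index.
by apply: val_inj; rewrite /= xi index_uniq ?fset_uniq.
Qed.

Lemma nth_supportP j : exists x, supp x = nth_support j.
Proof.
have : nth_support j \in supports by apply: mem_nth.
by case/imfsetP=> x _ ->; exists x.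
Qed.

Definition face_with (X : {vspace 'rV[R]_d}) : face A :=
  odflt (face_one A) [pick y | supp y == X].

Lemma supp_face_with x : supp (face_with (supp x)) = supp x.
Proof. by rewrite /face_with; case: pickP => [y /eqP //|/(_ x)]; rewrite eqxx. Qed.

Let point x : tpow fA 1 := tbase [ffun=> x].

Let point_ord0 (c : {ffun 'I_1 -> face A}) : tbase c = point (c ord0).
Proof. by rewrite /point; congr tbase; apply/ffunP => i; rewrite ffunE ord1. Qed.

Lemma boundary_pair x y :
  boundary fA 0 (tbase [ffun i => if i == ord0 then x else y]) =
  point (face_mul x y) - point (face_mul y x).
Proof.
rewrite [LHS]tlift_tens -[LHS]/(boundary_fun _) /boundary_fun big_ord_recl big_ord0 addr0.
rewrite expr0 scale1r expr1 scaleN1r /point /tbase.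
congr (tens _ - tens _); apply/ffunP => i; rewrite !ffunE (ord1 i) /= ?fbaseM //.
Qed.

(** The algebra modulo commutators has the supports as a basis: [x y] and [y x]
    have the same support, and if [x] and [y] have the same support, then
    [x y = x] and [y x = y], so that [x - y] is a commutator. *)
Theorem homology_degree0 : exists f : {linear hochschild_homology fA 0 -> rows}, bijective f.
Proof.
pose cls x : rows := \row_j (supp x == nth_support j)%:R.
pose h : {linear tpow fA 1 -> rows} := tlift (mkmlin (multilinear_ofP (fun c => cls (c ord0)))).
have hE x : h (point x) = cls x.
  by rewrite [LHS]tlift_tens [LHS]multilinear_of_base ffunE.
pose S (r : rows) : tpow fA 1 := \sum_j r 0 j *: point (face_with (nth_support j)).
have S_linear : linear S.
  move=> a r r'; rewrite /S scaler_sumr -big_split; apply: eq_bigr => j _ /=.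
  by rewrite !mxE scalerDl scalerA.
pose Sl : {linear rows -> tpow fA 1} := HB.pack S (GRing.isLinear.Build k _ _ _ S S_linear).
have ShE x : S (cls x) = point (face_with (supp x)).
  have [j xj] := index_support x; rewrite /S (bigD1 j) //= mxE xj eqxx scale1r.
  rewrite big1 ?addr0 => [|i ij]; first by move: (xj j); rewrite eqxx => /eqP <-.
  by rewrite mxE xj (negPf ij) scale0r.
apply: (homology_iso (h := h)) => [u|v _ hv|r].
- pose g : {linear tpow fA 2 -> rows} := h \o boundary fA 0.
  rewrite -[LHS]/(g u) -[RHS]/((\0 : {linear tpow fA 2 -> rows}) u).
  apply: tpow_ext => c.
  have -> : tens [ffun i => fbase k (c i)] =
      tbase [ffun i => if i == ord0 then c ord0 else c (lift ord0 ord0)].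
    rewrite /tbase; congr tens; apply/ffunP => i; rewrite !ffunE.
    by case: (unliftP ord0 i) => [i' ->|->] //=; rewrite (ord1 i').
  rewrite -[LHS]/(h (boundary fA 0 _)) boundary_pair linearB !hE -[RHS]/(0 : rows).
  by apply/rowP => j; rewrite !mxE supp_mul subrr.
- pose D x := tbase [ffun i => if i == ord0 then x else face_with (supp x)] : tpow fA 2.
  have DE x : boundary fA 0 (D x) = point x - S (h (point x)).
    rewrite /D boundary_pair supp_eq_mul ?supp_face_with // supp_eq_mul ?supp_face_with //.
    by rewrite hE ShE.
  (* [v] minus the combination of representatives [S (h v)] is a boundary *)
  exists (\sum_c (tcoord c v : k) *: D (c ord0)).
  transitivity (v - Sl (h v)); last by rewrite hv linear0 subr0.
  pose g : {linear tpow fA 1 -> tpow fA 1} := Sl \o h.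
  rewrite -[Sl (h v)]/(g v) {2 3}(tpow_expand v) [g _]linear_sum -sumrB [LHS]linear_sum.
  apply: eq_bigr => c _; rewrite [LHS]linearZ [g _]linearZ -scalerBr DE.
  by rewrite point_ord0.
exists (S r); first by [].
rewrite [LHS]linear_sum; apply/rowP => j.
transitivity (\sum_i r 0 i * (i == j)%:R : k); last first.
  rewrite (bigD1 j) //= eqxx mulr1 big1 ?addr0 // => i ij; by rewrite (negPf ij) mulr0.
rewrite summxE; apply: eq_bigr => i _; rewrite [h _]linearZ hE !mxE; congr (_ * _%:R).
have [x xi] := nth_supportP i; rewrite -xi supp_face_with.
have [l xl] := index_support x; rewrite xl.
by move: (xl i); rewrite xi eqxx => /esym/eqP ->; rewrite eq_sym.
Qed.

End HomologyDegreeZero.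

Theorem proposition9p8 (k : fieldType) (R : realType) (d : nat)
    (A : arrangement R d) :
  (forall i : nat, (0 < i)%N ->
     (forall x : hochschild_homology (face_algebra k A) i, x = 0) /\
     (forall x : hochschild_cohomology (face_algebra k A) i, x = 0)) /\
  (exists f : {linear hochschild_homology (face_algebra k A) 0 ->
                      'rV[k]_#|` intersection_lattice A|%fset},
     bijective f) /\
  (exists g : {linear hochschild_cohomology (face_algebra k A) 0 -> k^o},
     bijective g).
Proof.
split=> [[//|n] _|]; first by split=> q; [exact: homology_vanishes|exact: cohomology_vanishes].
by split; [exact: homology_degree0|exact: cohomology_degree0].
Qed.
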